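(* The spherical rotational horo-shrinkers (with rotation axis the $z$-axis) intersecting the rotation axis are the surfaces $\mathcal{B}(z_0)$, where the parameter $z_0>0$ is the height of the intersection point of the surface with the rotation axis. Each $\mathcal{B}(z_0)$ is an entire graph (over the $xy$-plane) that oscillates around the horosphere $\mathsf{H}_1=\{z=1\}$. Furthermore: (1) If $z_0=1$, then $\mathcal{B}(1)=\mathsf{H}_1$. (2) If $z_0\in(0,1)$, then $\mathcal{B}(z_0)$ is strictly convex at $r=0$. (3) If $z_0\in(1,\infty)$, then $\mathcal{B}(z_0)$ is strictly concave at $r=0$.
   Context: $\mathbb{H}^3$ is the upper half-space $\mathbb{R}^3_+=\{z>0\}$ with the metric $\langle\cdot,\cdot\rangle=\frac{1}{z^2}(dx^2+dy^2+dz^2)$. A horo-shrinker is an isometric immersion $\Psi:\Sigma\to\mathbb{H}^3$ of an oriented smooth surface whose mean curvature $H$ satisfies $H=\langle N,\partial_z\rangle$, where $N$ is the unit normal; $H$ is the average of the principal curvatures, with the sign convention that the horosphere $z=c$ with $N=c\,\partial_z$ has $H=1$. A spherical rotational surface is one invariant by the group of Euclidean rotations about the $z$-axis; it is parametrized by $(s,t)\mapsto(x(s)\cos t,x(s)\sin t,z(s))$. Surfaces are connected and maximal (not extendable to a larger rotational horo-shrinker). $\mathcal{B}(z_0)$ is the surface obtained by rotating about the $z$-axis the curve $r\mapsto(r,0,z(r))$, where $z=z(r)>0$ is the maximal solution of $$\frac{z''}{1+z'^2}+\frac{z'}{r}=2\,\frac{1-z}{z^2},\qquad z(0)=z_0,\quad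 z'(0)=0 .$$ Entire graph means that $z(r)$ is defined for all $r\in[0,\infty)$. For $z_0\neq1$, ''oscillates around $\mathsf{H}_1$'' means that $z(r)$ has, as $r\to\infty$, an infinite sequence of alternating local maxima with value $>1$ and local minima with value $<1$, so that it crosses $z=1$ infinitely often; for $z_0=1$ the oscillation is degenerate ($z\equiv1$). Strictly convex (resp. concave) at $r=0$ means $z''(0)>0$ (resp. $z''(0)<0$). *)

(* Defs.v *)
(* Stdlib reals with Coquelicot. *)
From Stdlib Require Import Reals Lra.
From Coquelicot Require Import Coquelicot.
Open Scope R_scope.

(** * Vectors of R^3 *)

Definition R3 : Type := (R * R * R)%type.
Definition xc (P : R3) : R := fst (fst P).
Definition yc (P : R3) : R := snd (fst P).
Definition zc (P : R3) : R := snd P.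

Definition add3 (v w : R3) : R3 := (xc v + xc w, yc v + yc w, zc v + zc w).
Definition dot3 (v w : R3) : R := xc v * xc w + yc v * yc w + zc v * zc w.

Definition rot (t : R) (P : R3) : R3 :=
  (cos t * xc P - sin t * yc P, sin t * xc P + cos t * yc P, zc P).

Definition on_axis (P : R3) : Prop := xc P = 0 /\ yc P = 0.

Definition horosphere (c : R) (P : R3) : Prop := zc P = c.

(** * Hyperbolic geometry in the upper half-space *)

Definition hyp (P v w : R3) : R := dot3 v w / zc P ^ 2.

(* The tensor Gamma_P(v,w)^k = Gamma^k_ij v^i w^j of the Christoffel symbols of
   the metric (dx^2+dy^2+dz^2)/z^2.  For a conformal metric e^(2f) <.,.> it is
   df(v) w + df(w) v - <v,w> grad f, here with f = - ln z. *)
Definition christoffel (P v w : R3) : R3 :=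
  ( - (zc v * xc w + zc w * xc v) / zc P,
    - (zc v * yc w + zc w * yc v) / zc P,
    (dot3 v w - 2 * (zc v * zc w)) / zc P ).

(* pd m k X q = d^(m+k) X / du^m dv^k at q = (u,v). *)
Definition pd (m k : nat) (X : R * R -> R3) (q : R * R) : R3 :=
  let d (c : R3 -> R) :=
    partial_derive m k (fun u v => c (X (u, v))) (fst q) (snd q) in
  (d xc, d yc, d zc).

(* Covariant derivatives nabla_{X_u} X_u, nabla_{X_u} X_v, nabla_{X_v} X_v along
   X, for the Levi-Civita connection of H^3. *)
Definition cov_uu (X : R * R -> R3) (q : R * R) : R3 :=
  add3 (pd 2 0 X q) (christoffel (X q) (pd 1 0 X q) (pd 1 0 X q)).
Definition cov_uv (X : R * R -> R3) (q : R * R) : R3 :=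
  add3 (pd 1 1 X q) (christoffel (X q) (pd 1 0 X q) (pd 0 1 X q)).
Definition cov_vv (X : R * R -> R3) (q : R * R) : R3 :=
  add3 (pd 0 2 X q) (christoffel (X q) (pd 0 1 X q) (pd 0 1 X q)).

(* Half the trace of the shape operator g^-1 h, i.e. the average of the
   principal curvatures, of the parametrization X at q with respect to the
   hyperbolic unit normal N at X q. *)
Definition mean_curvature (X : R * R -> R3) (N : R3) (q : R * R) : R :=
  let g := hyp (X q) in
  let g11 := g (pd 1 0 X q) (pd 1 0 X q) in
  let g12 := g (pd 1 0 X q) (pd 0 1 X q) in
  let g22 := g (pd 0 1 X q) (pd 0 1 X q) in
  let h11 := g (cov_uu X q) N in
  let h12 := g (cov_uv X q) N in
  let h22 := g (cov_vv X q) N in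
  (h11 * g22 - 2 * (h12 * g12) + h22 * g11) / (2 * (g11 * g22 - g12 ^ 2)).

(* Sign convention: H = 1 for the horosphere z = c with N = c d/dz. *)
Lemma mean_curvature_horosphere (c : R) (q : R * R) :
  0 < c -> mean_curvature (fun p => (fst p, snd p, c)) (0, 0, c) q = 1.
Proof.
  intros Hc.
  unfold mean_curvature, cov_uu, cov_uv, cov_vv, christoffel, hyp, add3, dot3,
    pd, xc, yc, zc, partial_derive; simpl.
  repeat (rewrite ?Derive_const, ?Derive_id;
          try (rewrite (Derive_ext _ (fun _ => 0)) by
                 (intros; rewrite ?Derive_const, ?Derive_id; reflexivity));
          try (rewrite (Derive_ext _ (fun _ => 1)) by
                 (intros; rewrite ?Derive_const, ?Derive_id; reflexivity))).
  field; lra.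
Qed.

(** * Abstract smooth surfaces

   A set together with injective parametrizations par i : dom i -> pt, as in do
   Carmo; the value of par i outside of dom i is irrelevant. *)

Record surface : Type := Surface {
  pt : Type;
  idx : Type;
  dom : idx -> R * R -> Prop;
  par : idx -> R * R -> pt
}.

Arguments dom {_} _ _.
Arguments par {_} _ _.

Definition is_open {S : surface} (O : pt S -> Prop) : Prop :=
  forall i : idx S, open (fun q : R * R => dom i q /\ O (par i q)).

Definition smooth_at (f : R * R -> R) (q : R * R) : Prop :=
  forall n : nat, ex_diff_n (fun u v => f (u, v)) n (fst q) (snd q).

(* Near every point, f reads in the parametrizations as a smooth map g.  That g
   is defined near q with values in dom j makes f continuous. *)
Definition smooth_map {S T : surface} (f : pt S -> pt T) : Prop :=
  forall (i : idx S) (j : idx T) (q p : R * R),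
    dom i q -> dom j p -> f (par i q) = par j p ->
    exists g : R * R -> R * R,
      locally q (fun w : R * R =>
        smooth_at (fun w' => fst (g w')) w /\
        smooth_at (fun w' => snd (g w')) w /\
        dom j (g w) /\ f (par i w) = par j (g w)).

(* In order: open domains, injectivity, covering by countably many charts
   (second countability), smooth transition maps, Hausdorff. *)
Definition is_smooth_surface (S : surface) : Prop :=
  (forall i : idx S, open (dom i)) /\
  (forall (i : idx S) q p, dom i q -> dom i p -> par i q = par i p -> q = p) /\
  (exists e : nat -> idx S, forall x : pt S,
     exists (n : nat) (q : R * R), dom (e n) q /\ par (e n) q = x) /\
  smooth_map (fun x : pt S => x) /\
  (forall x y : pt S, x <> y ->
     exists O O' : pt S -> Prop,
       is_open O /\ is_open O' /\ O x /\ O' y /\ forall w, ~ (O w /\ O' w)).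

Definition connected (S : surface) : Prop :=
  (exists x : pt S, True) /\
  forall O : pt S -> Prop,
    is_open O -> is_open (fun x => ~ O x) -> (exists x, O x) -> forall x, O x.

(** * Oriented immersed surfaces in H^3

   The surface carries the metric induced by imm, which is then an isometric
   immersion; its orientation is the choice of the unit normal field. *)

Record immersed_surface : Type := ImmersedSurface {
  carrier :> surface;
  imm : pt carrier -> R3;
  normal : pt carrier -> R3
}.

Arguments imm {_} _.
Arguments normal {_} _.

Definition local_imm {S : immersed_surface} (i : idx S) (q : R * R) : R3 :=
  imm (par i q).
Definition local_normal {S : immersed_surface} (i : idx S) (q : R * R) : R3 :=
  normal (par i q).

Definition is_immersion (S : immersed_surface) : Prop :=
  (forall x : pt S, 0 < zc (imm x)) /\
  forall (i : idx S) (q : R * R), dom i q ->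
    smooth_at (fun p => xc (local_imm i p)) q /\
    smooth_at (fun p => yc (local_imm i p)) q /\
    smooth_at (fun p => zc (local_imm i p)) q /\
    forall a b : R,
      a * xc (pd 1 0 (local_imm i) q) + b * xc (pd 0 1 (local_imm i) q) = 0 ->
      a * yc (pd 1 0 (local_imm i) q) + b * yc (pd 0 1 (local_imm i) q) = 0 ->
      a * zc (pd 1 0 (local_imm i) q) + b * zc (pd 0 1 (local_imm i) q) = 0 ->
      a = 0 /\ b = 0.

Definition is_unit_normal (S : immersed_surface) : Prop :=
  forall (i : idx S) (q : R * R), dom i q ->
    continuous (fun p => xc (local_normal i p)) q /\
    continuous (fun p => yc (local_normal i p)) q /\
    continuous (fun p => zc (local_normal i p)) q /\
    hyp (local_imm i q) (local_normal i q) (local_normal i q) = 1 /\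
    hyp (local_imm i q) (local_normal i q) (pd 1 0 (local_imm i) q) = 0 /\
    hyp (local_imm i q) (local_normal i q) (pd 0 1 (local_imm i) q) = 0.

Definition horo_shrinker (S : immersed_surface) : Prop :=
  is_smooth_surface S /\ is_immersion S /\ is_unit_normal S /\
  forall (i : idx S) (q : R * R), dom i q ->
    mean_curvature (local_imm i) (local_normal i q) q =
    hyp (local_imm i q) (local_normal i q) (0, 0, 1).

(* The circle group R / 2 pi Z acts continuously on the surface by
   diffeomorphisms which the immersion intertwines with the rotations. *)
Definition rotational (S : immersed_surface) : Prop :=
  exists act : R -> pt S -> pt S,
    (forall x, act 0 x = x) /\
    (forall s t x, act (s + t) x = act s (act t x)) /\
    (forall x, act (2 * PI) x = x) /\
    (forall t, smooth_map (act t)) /\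
    (forall (x : pt S) (O : pt S -> Prop), is_open O ->
       open (fun t : R => O (act t x))) /\
    (forall t x, imm (act t x) = rot t (imm x)).

Definition connected_rotational_horo_shrinker (S : immersed_surface) : Prop :=
  horo_shrinker S /\ connected S /\ rotational S.

(* S is not a proper part of a larger connected rotational horo-shrinker. *)
Definition spherical_rotational_horo_shrinker (S : immersed_surface) : Prop :=
  connected_rotational_horo_shrinker S /\
  forall (T : immersed_surface) (f : pt S -> pt T),
    connected_rotational_horo_shrinker T ->
    smooth_map f -> (forall x y, f x = f y -> x = y) ->
    (forall x, imm (f x) = imm x) ->
    forall y : pt T, exists x : pt S, f x = y.

(* Equality of immersed surfaces: up to a reparametrizing diffeomorphism.  The
   orientation is not compared, as reversing it changes the sign of both sides
   of H = <N, d/dz>. *)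
Definition same_surface (S T : immersed_surface) : Prop :=
  exists (f : pt S -> pt T) (h : pt T -> pt S),
    smooth_map f /\ smooth_map h /\
    (forall x, h (f x) = x) /\ (forall y, f (h y) = y) /\
    (forall x, imm (f x) = imm x).

(** * The profile curves *)

(* g is the derivative of f on [0,b), one-sided at 0. *)
Definition derivative_on (b : Rbar) (f g : R -> R) : Prop :=
  filterlim (fun r => (f r - f 0) / r) (at_right 0) (locally (g 0)) /\
  forall r : R, 0 < r -> Rbar_lt r b -> is_derive f r (g r).

Definition profile_solution (z0 : R) (b : Rbar) (z : R -> R) : Prop :=
  Rbar_lt 0 b /\
  (forall r : R, 0 <= r -> Rbar_lt r b -> 0 < z r) /\
  exists z' z'' : R -> R,
    derivative_on b z z' /\ derivative_on b z' z'' /\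
    z 0 = z0 /\ z' 0 = 0 /\
    forall r : R, 0 < r -> Rbar_lt r b ->
      z'' r / (1 + z' r ^ 2) + z' r / r = 2 * ((1 - z r) / z r ^ 2).

Definition agree_on (b : Rbar) (z w : R -> R) : Prop :=
  forall r : R, 0 <= r -> Rbar_lt r b -> z r = w r.

Definition maximal_profile (z0 : R) (b : Rbar) (z : R -> R) : Prop :=
  profile_solution z0 b z /\
  forall (c : Rbar) (w : R -> R),
    profile_solution z0 c w -> agree_on (Rbar_min b c) z w -> Rbar_le c b.

Definition oscillates_around_H1 (z0 : R) (z : R -> R) : Prop :=
  (z0 <> 1 ->
   exists a : nat -> R,
     0 < a O /\ (forall n, a n < a (S n)) /\ is_lim_seq a p_infty /\
     (forall n, Nat.Even n ->
        1 < z (a n) /\ locally (a n) (fun r => z r <= z (a n))) /\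
     (forall n, Nat.Odd n ->
        z (a n) < 1 /\ locally (a n) (fun r => z (a n) <= z r)) /\
     (forall n, exists r : R, a n < r < a (S n) /\ z r = 1)) /\
  (z0 = 1 -> forall r : R, 0 <= r -> z r = 1).

Definition strictly_convex_at_0 (b : Rbar) (z : R -> R) : Prop :=
  exists z' z'' : R -> R,
    derivative_on b z z' /\ derivative_on b z' z'' /\ 0 < z'' 0.

Definition strictly_concave_at_0 (b : Rbar) (z : R -> R) : Prop :=
  exists z' z'' : R -> R,
    derivative_on b z z' /\ derivative_on b z' z'' /\ z'' 0 < 0.

(** * Surfaces generated by a profile defined on [0, +oo) *)

Definition plane : surface :=
  {| pt := R * R; idx := unit; dom := fun _ _ => True; par := fun _ q => q |}.

Definition height (z : R -> R) (u v : R) : R := z (sqrt (u ^ 2 + v ^ 2)).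

(* The entire graph of height z, with its upward unit normal. *)
Definition rotate (z : R -> R) : immersed_surface :=
  {| carrier := plane;
     imm := fun q : pt plane => (fst q, snd q, height z (fst q) (snd q)) : R3;
     normal := fun q : pt plane =>
       let h := height z (fst q) (snd q) in
       let hu := partial_derive 1 0 (height z) (fst q) (snd q) in
       let hv := partial_derive 0 1 (height z) (fst q) (snd q) in
       let k := h / sqrt (1 + hu ^ 2 + hv ^ 2) in
       (- (k * hu), - (k * hv), k) : R3 |}.

(* Main.v *)
Require Import Defs.
From Stdlib Require Import ZArith Reals Lra Lia Psatz Classical ClassicalEpsilon
  FunctionalExtensionality.
From Coquelicot Require Import Coquelicot.
Open Scope R_scope.

(** The profile equation says [theta' + z' / r = 2 force (z)], where
    [theta = atan z'] and [force = (1 - z) / z^2] derives from the potential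
    [2 / z + 2 ln z], a well with its bottom at [z = 1].  The term [z' / r] is
    a friction, so the energy [ln (1 + z'^2) / 2 + 2 / z + 2 ln z] decreases,
    and [z] and [z'] stay bounded ([energy_bound], [entire_solution_exists]).
    Hence the profile is entire.  It cannot stay on one side of 1: the
    logarithmic derivative of [z - 1] satisfies a Riccati inequality whose
    solutions blow up in finite time ([profile_crosses]); and it crosses 1
    transversally by uniqueness, so maxima above 1 and minima below 1 alternate
    for ever ([profile_alternates]).

    The equation is singular at [r = 0].  In the variable [x = r^2] the function
    [psi] with [z' = 2 r psi] satisfies [(x psi)' = k], where [k] depends on
    [psi] only through a multiple of [x].  So [psi] is the mean of [k] over
    [[0, x]], and a contraction argument for this averaged equation gives
    existence ([singular_ivp]).  Its solutions are smooth on a neighbourhood of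
    [x = 0], on both sides ([averaged_solution_smooth]), which makes the
    rotational graph smooth on the axis.  Uniqueness holds from [r = 0] on
    because the singular term is monotone ([profile_ode_unique]).

    A graph [z = h (x, y)] is a horo-shrinker iff [h] satisfies the equation
    [horo_graph_eq], and this remains so after a change of coordinates in the
    domain ([graph_mean_curvature]).  For rotational [h] it is the profile
    equation, in both directions ([radial_horo_graph_eq], [section_ode]), so
    the rotated profiles are rotational horo-shrinkers.  They are maximal: in a
    larger surface an entire graph is open, by the inverse function theorem,
    and closed, because the plane is already covered ([rotate_maximal]).

    Conversely, let a rotational horo-shrinker have a point [x0] on the axis.
    The circle fixes [x0] ([axis_fixed]), so it preserves the tangent plane
    there, which is therefore horizontal ([axis_horizontal]).  Near [x0] the
    surface is thus a rotational graph, over a piece of the profile that starts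
    at the height of [x0].  Let the swept part of the surface be formed by the
    orbits of the lifts of pieces of this profile that start at [x0].  It is
    open ([swept_open]).  It is closed as well ([swept_closed_ray]): at a limit
    point the tangent plane is not vertical, because the slope of the profile is
    bounded, so the surface is a rotational graph there too, and by uniqueness
    of the profile the lift passes through the limit point.  By connectedness
    the surface is swept.  So it embeds into the rotated profile, and it is all
    of it because it is maximal ([same_surface_rotate]). *)

(** * Calculus on intervals *)

(** Connectedness of an interval, in the form used throughout: a property whose
    truth value is locally constant is constant.  The supremum of the points up
    to which the property has not changed cannot be interior. *)
Lemma interval_locally_constant (P : R -> Prop) (a b : R) :
  (forall t, a <= t <= b -> exists d, 0 < d /\
     forall s, a <= s <= b -> Rabs (s - t) < d -> (P s <-> P t)) ->
  forall t, a <= t <= b -> (P t <-> P a).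
Proof.
  intros H t Ht.
  set (E := fun x => a <= x <= b /\ forall s, a <= s <= x -> (P s <-> P a)).
  assert (Ea : E a).
  { split; [lra|]. intros s Hs. replace s with a by lra. tauto. }
  destruct (completeness E) as [m [Hm1 Hm2]].
  { exists b. intros x [Hx _]. lra. }
  { now exists a. }
  assert (Hma : a <= m) by now apply Hm1.
  assert (Hmb : m <= b). { apply Hm2. intros x [Hx _]. lra. }
  destruct (H m ltac:(lra)) as [d [Hd Hd']].
  assert (Hx : exists x, E x /\ m - d < x).
  { apply NNPP. intros Hn. assert (m <= m - d); [|lra].
    apply Hm2. intros x Hx. destruct (Rle_dec x (m - d)); [easy|].
    exfalso. apply Hn. exists x. split; [easy|lra]. }
  destruct Hx as [x [[Hx1 Hx2] Hx3]].
  assert (x <= m) by (apply Hm1; split; auto).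
  assert (Pm : P m <-> P a).
  { rewrite <- (Hd' x ltac:(lra)).
    - apply Hx2; lra.
    - rewrite Rabs_left1; lra. }
  assert (Em : forall s, a <= s <= b -> s < m + d -> (P s <-> P a)).
  { intros s Hs Hsm. destruct (Rle_dec s x) as [h|h].
    - apply Hx2; lra.
    - rewrite (Hd' s Hs); [easy|]. apply Rabs_def1; lra. }
  destruct (Rlt_le_dec m b) as [Hlt|Hge].
  - exfalso. set (m' := Rmin b (m + d / 2)).
    assert (m' <= b /\ m' <= m + d / 2 /\ m < m').
    { unfold m', Rmin. destruct Rle_dec; lra. }
    assert (E m').
    { split; [lra|]. intros s Hs. apply Em; lra. }
    assert (m' <= m) by now apply Hm1. lra.
  - apply Em; lra.
Qed.

Lemma continuity_pt_eps (f : R -> R) (x : R) :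
  continuity_pt f x <->
  forall e, 0 < e -> exists d, 0 < d /\
    forall y, Rabs (y - x) < d -> Rabs (f y - f x) < e.
Proof.
  split; intros H e He.
  - destruct (H e He) as [d [Hd Hd']]. exists d. split; [easy|].
    intros y Hy. destruct (Req_dec x y) as [->|Hn].
    + unfold Rminus. rewrite Rplus_opp_r, Rabs_R0. easy.
    + apply Hd'. split; [split; [exact I|easy]|exact Hy].
  - destruct (H e He) as [d [Hd Hd']]. exists d. split; [easy|].
    intros y [_ Hy]. now apply Hd'.
Qed.

Lemma is_derive_continuity_pt (f : R -> R) (x l : R) :
  is_derive f x l -> continuity_pt f x.
Proof.
  intros H. apply derivable_continuous_pt. exists l.
  now apply is_derive_Reals.
Qed.

Definition right_continuous (f : R -> R) (a : R) : Prop :=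
  forall e, 0 < e -> exists d, 0 < d /\
    forall x, a < x < a + d -> Rabs (f x - f a) < e.

Lemma continuity_pt_right (f : R -> R) (a : R) :
  continuity_pt f a -> right_continuous f a.
Proof.
  intros H e He. destruct (proj1 (continuity_pt_eps f a) H e He) as [d [Hd Hd']].
  exists d. split; [easy|]. intros x Hx. apply Hd'. apply Rabs_def1; lra.
Qed.

Lemma nonincreasing_of_derive (f df : R -> R) (a b : R) :
  a <= b -> right_continuous f a ->
  (forall x, a < x <= b -> is_derive f x (df x)) ->
  (forall x, a < x <= b -> df x <= 0) -> f b <= f a.
Proof.
  intros Hab Hc Hd Hn.
  destruct (Req_dec a b) as [->|Hne]; [lra|].
  assert (H : forall x, a < x <= b -> f b <= f x).
  { intros x Hx.
    destruct (MVT_gen f x b df) as [c [Hc1 Hc2]].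
    - intros y. rewrite Rmin_left, Rmax_right by lra. intros. apply Hd; lra.
    - intros y. rewrite Rmin_left, Rmax_right by lra. intros.
      apply (is_derive_continuity_pt f y (df y)), Hd; lra.
    - rewrite Rmin_left, Rmax_right in Hc1 by lra.
      assert (df c <= 0) by (apply Hn; lra). nra. }
  destruct (Rle_dec (f b) (f a)) as [|Hf]; [easy|exfalso].
  destruct (Hc (f b - f a) ltac:(lra)) as [d [Hd1 Hd2]].
  set (x := a + Rmin (d / 2) (b - a)).
  assert (a < x < a + d /\ x <= b).
  { unfold x, Rmin. destruct Rle_dec; lra. }
  assert (Hx := Hd2 x ltac:(easy)). apply Rabs_def2 in Hx.
  assert (f b <= f x) by (apply H; lra). lra.
Qed.

Lemma right_continuous_clamp (f : R -> R) (a : R) :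
  right_continuous f a <-> continuity_pt (fun y => f (Rmax a y)) a.
Proof.
  split; intros H.
  - apply continuity_pt_eps. intros e He.
    destruct (H e He) as [d [Hd Hd']]. exists d. split; [easy|].
    intros y Hy. apply Rabs_def2 in Hy. rewrite (Rmax_left a a) by lra.
    destruct (Rle_dec y a).
    + rewrite Rmax_left by lra. rewrite Rminus_diag, Rabs_R0. easy.
    + rewrite Rmax_right by lra. apply Hd'. lra.
  - intros e He. destruct (proj1 (continuity_pt_eps _ _) H e He) as [d [Hd Hd']].
    exists d. split; [easy|]. intros x Hx.
    assert (h := Hd' x ltac:(apply Rabs_def1; lra)).
    rewrite Rmax_right, Rmax_left in h by lra. easy.
Qed.

Lemma is_derive_value (f : R -> R) (x l l' : R) :
  is_derive f x l -> l = l' -> is_derive f x l'.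
Proof. now intros H <-. Qed.

Lemma derive_ext (f g : R -> R) (x l : R) :
  (forall t, f t = g t) -> is_derive f x l -> is_derive g x l.
Proof. exact (is_derive_ext f g x l). Qed.

Lemma derive_add (f g : R -> R) (x a b : R) :
  is_derive f x a -> is_derive g x b ->
  is_derive (fun t => f t + g t) x (a + b).
Proof. intros; now apply (is_derive_plus f g x a b). Qed.

Lemma derive_sub (f g : R -> R) (x a b : R) :
  is_derive f x a -> is_derive g x b ->
  is_derive (fun t => f t - g t) x (a - b).
Proof. intros; now apply (is_derive_minus f g x a b). Qed.

Lemma derive_opp (f : R -> R) (x a : R) :
  is_derive f x a -> is_derive (fun t => - f t) x (- a).
Proof. intros; now apply (is_derive_opp f x a). Qed.

Lemma derive_mul (f g : R -> R) (x a b : R) :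
  is_derive f x a -> is_derive g x b ->
  is_derive (fun t => f t * g t) x (a * g x + f x * b).
Proof.
  intros Hf Hg. apply is_derive_Reals.
  apply (derivable_pt_lim_mult f g); now apply is_derive_Reals.
Qed.

Lemma derive_inv (f : R -> R) (x a : R) :
  is_derive f x a -> f x <> 0 ->
  is_derive (fun t => / f t) x (- a / f x ^ 2).
Proof. intros; now apply is_derive_inv. Qed.

Lemma derive_chain (f g : R -> R) (x a b : R) :
  is_derive f (g x) a -> is_derive g x b ->
  is_derive (fun t => f (g t)) x (a * b).
Proof.
  intros Hf Hg. apply is_derive_Reals.
  apply (derivable_pt_lim_comp g f); now apply is_derive_Reals.
Qed.

Lemma derive_const (c x : R) : is_derive (fun _ : R => c) x 0.
Proof. apply @is_derive_const. Qed.

Lemma derive_id (x : R) : is_derive (fun t : R => t) x 1.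
Proof. apply @is_derive_id. Qed.

Lemma derive_pow (f : R -> R) (n : nat) (x a : R) :
  is_derive f x a -> is_derive (fun t => f t ^ n) x (INR n * a * f x ^ pred n).
Proof. intros; now apply is_derive_pow. Qed.

Lemma derive_ext_near (f g : R -> R) (x l d : R) : 0 < d ->
  (forall y, Rabs (y - x) < d -> f y = g y) -> is_derive f x l -> is_derive g x l.
Proof.
  intros Hd H. apply is_derive_ext_loc. exists (mkposreal d Hd). exact H.
Qed.

(** The goals left by [derive] are the derivatives of the atoms, the
    non-vanishing of denominators, and last the equality of the computed
    derivative with the claimed one. *)
Ltac derive_step :=
  lazymatch goal with
  | |- is_derive (fun _ => ?c) _ _ => apply derive_const
  | |- is_derive (fun x => x) _ _ => apply derive_id
  | |- is_derive (fun x => @?f x + @?g x) _ _ => eapply (derive_add f g); derive_step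
  | |- is_derive (fun x => @?f x - @?g x) _ _ => eapply (derive_sub f g); derive_step
  | |- is_derive (fun x => - @?f x) _ _ => eapply (derive_opp f); derive_step
  | |- is_derive (fun x => @?f x * @?g x) _ _ => eapply (derive_mul f g); derive_step
  | |- is_derive (Rmult ?c) _ _ => eapply (derive_mul (fun _ => c) (fun x => x)); derive_step
  | |- is_derive (fun x => @?f x / @?g x) _ _ =>
      eapply (derive_mul f (fun x => / g x)); derive_step
  | |- is_derive (fun x => / @?f x) _ _ => eapply (derive_inv f); [derive_step|]
  | |- is_derive (fun x => @?f x ^ ?n) _ _ => eapply (derive_pow f n); derive_step
  | |- _ => idtac
  end.
Ltac derive := cbv beta; eapply is_derive_value; [derive_step|].

Ltac cont :=
  lazymatch goal with
  | |- continuity_pt (fun _ => ?c) _ => apply continuity_pt_const; now intros ? ?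
  | |- continuity_pt (fun x => x) _ => apply continuity_pt_id
  | |- continuity_pt (fun x => @?f x + @?g x) _ => apply (continuity_pt_plus f g); cont
  | |- continuity_pt (fun x => @?f x - @?g x) _ => apply (continuity_pt_minus f g); cont
  | |- continuity_pt (fun x => - @?f x) _ => apply (continuity_pt_opp f); cont
  | |- continuity_pt (fun x => @?f x * @?g x) _ => apply (continuity_pt_mult f g); cont
  | |- continuity_pt (fun x => @?f x / @?g x) _ =>
      apply (continuity_pt_mult f (fun x => / g x)); cont
  | |- continuity_pt (fun x => / @?f x) _ => apply (continuity_pt_inv f); [cont|auto]
  | |- continuity_pt (fun x => @?f x ^ ?n) _ =>
      apply (continuity_pt_comp f (fun y => y ^ n));
        [cont|apply derivable_continuous_pt, derivable_pt_pow]
  | |- _ => auto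
  end.

Ltac rmin x y := pose proof (Rmin_l x y); pose proof (Rmin_r x y).

(** Gronwall: [Q exp(- C x)] decreases. *)
Lemma gronwall_zero (Q dQ : R -> R) (C a b : R) :
  a <= b -> right_continuous Q a ->
  (forall x, a < x <= b -> is_derive Q x (dQ x)) ->
  (forall x, a < x <= b -> dQ x <= C * Q x) ->
  Q a <= 0 -> Q b <= 0.
Proof.
  intros Hab Hc Hd Hn HQ.
  assert (H : Q b * exp (- C * b) <= Q a * exp (- C * a)).
  { apply (nonincreasing_of_derive (fun x => Q x * exp (- C * x))
             (fun x => (dQ x - C * Q x) * exp (- C * x)) a b Hab).
    - apply right_continuous_clamp, (continuity_pt_mult (fun y => Q (Rmax a y))).
      + now apply right_continuous_clamp.
      + apply (right_continuous_clamp (fun x => exp (- C * x))), continuity_pt_right.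
        apply (is_derive_continuity_pt (fun x => exp (- C * x)) a (- C * exp (- C * a))).
        auto_derive; [easy|ring].
    - intros x Hx. specialize (Hd x Hx).
      derive; [exact Hd|apply (derive_chain exp); [apply is_derive_exp|derive_step]|].
      ring.
    - intros x Hx. assert (h := Hn x Hx). assert (h' := exp_pos (- C * x)). nra. }
  assert (h1 := exp_pos (- C * a)). assert (h2 := exp_pos (- C * b)). nra.
Qed.

Lemma sum_sqr_le_0 (x y : R) : x ^ 2 + y ^ 2 <= 0 -> x = 0.
Proof.
  intros H. apply Rsqr_0_uniq. unfold Rsqr.
  assert (h := pow2_ge_0 x). assert (h' := pow2_ge_0 y). lra.
Qed.

Lemma Rabs_le_inv (x M : R) : Rabs x <= M -> - M <= x <= M.
Proof.
  intros H. assert (h1 := Rle_abs x). assert (h2 := Rle_abs (- x)).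
  rewrite Rabs_Ropp in h2. lra.
Qed.

(** Clamping the argument at [a] turns continuity from the right into continuity,
    so the extreme value theorem applies. *)
Lemma right_continuous_bounds (f : R -> R) (a b : R) :
  a <= b -> right_continuous f a ->
  (forall x, a < x <= b -> continuity_pt f x) ->
  exists lo hi, forall x, a <= x <= b -> f lo <= f x <= f hi /\
    a <= lo <= b /\ a <= hi <= b.
Proof.
  intros Hab Hr Hc.
  assert (Hext : forall x, a <= x <= b ->
    continuity_pt (fun y => f (Rmax a y)) x).
  { intros x Hx. apply continuity_pt_eps. intros e He.
    destruct (Req_dec x a) as [->|Hn].
    - apply (proj1 (continuity_pt_eps (fun y => f (Rmax a y)) a)); [|easy].
      now apply (proj1 (right_continuous_clamp f a)).
    - destruct (proj1 (continuity_pt_eps f x) (Hc x ltac:(lra)) e He)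
        as [d [Hd Hd']].
      exists (Rmin d (x - a)). split; [apply Rmin_pos; lra|].
      intros y Hy. rmin d (x - a). assert (Hy' := Rabs_def2 _ _ Hy).
      rewrite !Rmax_right by lra. apply Hd'. lra. }
  destruct (continuity_ab_maj _ a b Hab Hext) as [hi [Hhi Hhi']].
  destruct (continuity_ab_min _ a b Hab Hext) as [lo [Hlo Hlo']].
  exists lo, hi. intros x Hx. specialize (Hhi x Hx). specialize (Hlo x Hx).
  simpl in Hhi, Hlo. rewrite !Rmax_right in Hhi, Hlo by lra. lra.
Qed.

(** ** Contractions *)

Lemma half_pow_pos (n : nat) : 0 < (/ 2) ^ n.
Proof. apply pow_lt. lra. Qed.

Lemma half_pow_small (c e : R) : 0 < e -> exists n, c * (/ 2) ^ n < e.
Proof.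
  intros He. destruct (Rle_dec c 0) as [Hc|Hc].
  - exists 0%nat. simpl. lra.
  - assert (Hc' : 0 < c) by lra.
    destruct (pow_lt_1_zero (/ 2) ltac:(rewrite Rabs_pos_eq; lra) (e / c)
                ltac:(now apply Rdiv_lt_0_compat)) as [n Hn].
    exists n. specialize (Hn n (le_n n)).
    rewrite Rabs_pos_eq in Hn by (apply Rlt_le, half_pow_pos).
    apply Rmult_lt_compat_l with (r := c) in Hn; [|easy].
    replace (c * (e / c)) with e in Hn by (field; lra). easy.
Qed.

(** The contraction principle for functions, in a weighted sup norm.  The class
    [K] need only be closed under limits with the geometric rate of the
    iteration.  With [T] a pair of points it gives the contraction principle
    in the plane. *)
Lemma contraction_fixed_point {T : Type} (w : T -> R) (K : (T -> R) -> Prop)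
  (Phi : (T -> R) -> T -> R) (f0 : T -> R) (D : R) :
  (forall f, K f -> K (Phi f)) ->
  (forall f g d, K f -> K g -> (forall t, Rabs (f t - g t) <= d * w t) ->
     forall t, Rabs (Phi f t - Phi g t) <= d / 2 * w t) ->
  (forall (s : nat -> T -> R) f, (forall n, K (s n)) ->
     (forall n t, Rabs (s n t - f t) <= 2 * D * (/ 2) ^ n * w t) -> K f) ->
  K f0 -> (forall t, Rabs (Phi f0 t - f0 t) <= D * w t) ->
  exists f, K f /\ (forall t, Phi f t = f t) /\
    forall t, Rabs (f t - f0 t) <= 2 * D * w t.
Proof.
  intros HK Hc Hlim Hf0 HD.
  set (s := fun n => Nat.iter n Phi f0).
  assert (Ks : forall n, K (s n)).
  { induction n as [|n IH]; [exact Hf0|]. simpl. now apply HK. }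
  assert (Hstep : forall n t,
    Rabs (s (S n) t - s n t) <= D * (/ 2) ^ n * w t).
  { induction n as [|n IH]; intros t.
    - simpl. rewrite Rmult_1_r. apply HD.
    - replace (D * (/ 2) ^ S n * w t) with (D * (/ 2) ^ n / 2 * w t)
        by (simpl; field).
      exact (Hc (s (S n)) (s n) _ (Ks _) (Ks _) IH t). }
  assert (Hw : forall t, 0 <= D * w t).
  { intros t. eapply Rle_trans; [apply Rabs_pos|apply (HD t)]. }
  assert (Hdist : forall t n k, Rabs (s (n + k)%nat t - s n t)
      <= 2 * (D * w t) * (/ 2) ^ n - 2 * (D * w t) * (/ 2) ^ (n + k)).
  { intros t n k. induction k as [|k IH].
    - rewrite Nat.add_0_r, !Rminus_diag, Rabs_R0. lra.
    - rewrite Nat.add_succ_r.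
      replace (s (S (n + k)) t - s n t) with
        ((s (S (n + k)) t - s (n + k)%nat t) + (s (n + k)%nat t - s n t)) by ring.
      eapply Rle_trans; [apply Rabs_triang|].
      specialize (Hstep (n + k)%nat t).
      assert (h : (/ 2) ^ S (n + k) = / 2 * (/ 2) ^ (n + k)) by reflexivity.
      rewrite h. nra. }
  assert (Hdist' : forall t n k, Rabs (s (n + k)%nat t - s n t)
      <= 2 * D * (/ 2) ^ n * w t).
  { intros t n k. specialize (Hdist t n k). specialize (Hw t).
    assert (h := half_pow_pos (n + k)). nra. }
  assert (Hcv : forall t, { l : R | Un_cv (fun n => s n t) l }).
  { intros t. apply Rcomplete.R_complete. intros e He.
    destruct (half_pow_small (2 * D * w t) (e / 2) ltac:(lra)) as [N HN].
    exists N. intros n m Hn Hm. unfold Rdist.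
    replace n with (N + (n - N))%nat by lia.
    replace m with (N + (m - N))%nat by lia.
    assert (h1 := Hdist' t N (n - N)%nat). assert (h2 := Hdist' t N (m - N)%nat).
    set (x := s (N + (n - N))%nat t) in *. set (y := s (N + (m - N))%nat t) in *.
    replace (x - y) with ((x - s N t) - (y - s N t)) by ring.
    eapply Rle_lt_trans; [apply Rabs_triang|]. rewrite Rabs_Ropp. nra. }
  set (f := fun t => proj1_sig (Hcv t)).
  assert (Hf : forall n t, Rabs (s n t - f t) <= 2 * D * (/ 2) ^ n * w t).
  { intros n t. unfold f. destruct (Hcv t) as [l Hl]. simpl.
    apply Rnot_lt_le. intros Hlt.
    destruct (Hl (Rabs (s n t - l) - 2 * D * (/ 2) ^ n * w t) ltac:(lra))
      as [N HN].
    specialize (HN (n + N)%nat ltac:(lia)). unfold Rdist in HN.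
    assert (h := Hdist' t n N).
    assert (h' : Rabs (s n t - l) <= Rabs (s (n + N)%nat t - l) +
                 Rabs (s (n + N)%nat t - s n t)).
    { replace (s n t - l) with
        ((s (n + N)%nat t - l) - (s (n + N)%nat t - s n t)) by ring.
      eapply Rle_trans; [apply Rabs_triang|]. rewrite Rabs_Ropp. lra. }
    lra. }
  assert (Kf : K f) by (apply (Hlim s f Ks Hf)).
  exists f. split; [easy|]. split.
  - intros t. apply Rminus_diag_uniq.
    destruct (Req_dec (Phi f t - f t) 0) as [|Hn]; [easy|exfalso].
    apply Rabs_pos_lt in Hn.
    destruct (half_pow_small (4 * D * w t) _ Hn) as [n H].
    assert (h1 : Rabs (s (S n) t - Phi f t) <= 2 * D * (/ 2) ^ n / 2 * w t).
    { apply (Hc (s n) f _ (Ks n) Kf (Hf n)). }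
    assert (h2 := Hf (S n) t).
    assert (h3 : Rabs (Phi f t - f t) <=
      Rabs (s (S n) t - Phi f t) + Rabs (s (S n) t - f t)).
    { replace (Phi f t - f t) with
        ((s (S n) t - f t) - (s (S n) t - Phi f t)) by ring.
      eapply Rle_trans; [apply Rabs_triang|]. rewrite Rabs_Ropp. lra. }
    assert (h4 : (/ 2) ^ S n = / 2 * (/ 2) ^ n) by reflexivity.
    rewrite h4 in h2. specialize (Hw t). nra.
  - intros t. assert (h := Hf 0%nat t). simpl in h.
    rewrite Rabs_minus_sym. lra.
Qed.

(** * Smooth functions of two variables *)

Ltac split4 := split; [|split; [|split]].

Definition open2 (D : R -> R -> Prop) : Prop :=
  forall u v, D u v -> locally_2d D u v.

(** The partial derivatives are existentially quantified, rather than total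
    functions [Derive], so that closure properties are proved by giving them. *)
Fixpoint Ck (n : nat) (D : R -> R -> Prop) (f : R -> R -> R) : Prop :=
  (forall u v, D u v -> continuity_2d_pt f u v) /\
  match n with
  | O => True
  | S n => exists fu fv : R -> R -> R,
      (forall u v, D u v -> is_derive (fun t => f t v) u (fu u v)) /\
      (forall u v, D u v -> is_derive (fun t => f u t) v (fv u v)) /\
      Ck n D fu /\ Ck n D fv
  end.

Definition smooth_on (D : R -> R -> Prop) (f : R -> R -> R) : Prop :=
  forall n, Ck n D f.

Lemma Ck_continuity (n : nat) D f u v :
  Ck n D f -> D u v -> continuity_2d_pt f u v.
Proof. destruct n; intros [H _]; apply H. Qed.

Lemma locally_2d_1 (P : R -> R -> Prop) u v :
  locally_2d P u v -> locally u (fun t => P t v).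
Proof.
  intros [d Hd]. exists d. intros t Ht. apply Hd; [exact Ht|].
  rewrite Rminus_diag, Rabs_R0. apply cond_pos.
Qed.

Lemma locally_2d_2 (P : R -> R -> Prop) u v :
  locally_2d P u v -> locally v (fun t => P u t).
Proof.
  intros [d Hd]. exists d. intros t Ht. apply Hd; [|exact Ht].
  rewrite Rminus_diag, Rabs_R0. apply cond_pos.
Qed.

Lemma Ck_ext n D f g :
  open2 D -> (forall u v, D u v -> f u v = g u v) -> Ck n D f -> Ck n D g.
Proof.
  intros HD Heq.
  assert (Hloc : forall u v, D u v -> locally_2d (fun u v => f u v = g u v) u v).
  { intros u v H. apply locally_2d_impl with (2 := HD u v H).
    apply locally_2d_forall. apply Heq. }
  destruct n as [|n]; intros [Hc Hd]; split.
  - intros u v H. now apply continuity_2d_pt_ext_loc with f; auto.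
  - easy.
  - intros u v H. now apply continuity_2d_pt_ext_loc with f; auto.
  - destruct Hd as [fu [fv [H1 [H2 H3]]]]. exists fu, fv.
    split; [|split; [|exact H3]]; intros u v H.
    + apply is_derive_ext_loc with (fun t => f t v); [|now apply H1].
      apply (locally_2d_1 (fun u v => f u v = g u v)). now apply Hloc.
    + apply is_derive_ext_loc with (fun t => f u t); [|now apply H2].
      apply (locally_2d_2 (fun u v => f u v = g u v)). now apply Hloc.
Qed.

Lemma Ck_pred n D f : Ck (S n) D f -> Ck n D f.
Proof.
  revert f. induction n as [|n IH]; intros f [Hc Hd]; [now split|].
  split; [easy|]. destruct Hd as [fu [fv [H1 [H2 [H3 H4]]]]].
  exists fu, fv. split; [easy|split; [easy|split; now apply IH]].
Qed.

Lemma Ck_sub n (D D' : R -> R -> Prop) f :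
  (forall u v, D' u v -> D u v) -> Ck n D f -> Ck n D' f.
Proof.
  intros HD. revert f. induction n as [|n IH]; intros f [Hc Hd];
    (split; [now auto|]); [easy|].
  destruct Hd as [fu [fv [H1 [H2 [H3 H4]]]]].
  exists fu, fv. split4; auto.
Qed.

Lemma Ck_const n D c : Ck n D (fun _ _ => c).
Proof.
  revert c. induction n as [|n IH]; intros c;
    (split; [intros; apply continuity_2d_pt_const|]); [easy|].
  exists (fun _ _ => 0), (fun _ _ => 0).
  split4; auto; intros; apply @is_derive_const.
Qed.

Lemma Ck_fst n D : Ck n D (fun u _ => u).
Proof.
  destruct n; (split; [intros; apply continuity_2d_pt_id1|]); [easy|].
  exists (fun _ _ => 1), (fun _ _ => 0).
  split4; try apply Ck_const; intros;
    [apply @is_derive_id|apply @is_derive_const].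
Qed.

Lemma Ck_snd n D : Ck n D (fun _ v => v).
Proof.
  destruct n; (split; [intros; apply continuity_2d_pt_id2|]); [easy|].
  exists (fun _ _ => 0), (fun _ _ => 1).
  split4; try apply Ck_const; intros;
    [apply @is_derive_const|apply @is_derive_id].
Qed.

Lemma Ck_add n D f g :
  Ck n D f -> Ck n D g -> Ck n D (fun u v => f u v + g u v).
Proof.
  revert f g. induction n as [|n IH]; intros f g [Hf Hf'] [Hg Hg'];
    (split; [intros; apply continuity_2d_pt_plus; auto|]); [easy|].
  destruct Hf' as [fu [fv [F1 [F2 [F3 F4]]]]].
  destruct Hg' as [gu [gv [G1 [G2 [G3 G4]]]]].
  exists (fun u v => fu u v + gu u v), (fun u v => fv u v + gv u v).
  split4; auto; intros u v H.
  - apply (derive_add (fun t => f t v) (fun t => g t v)); auto.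
  - apply (derive_add (fun t => f u t) (fun t => g u t)); auto.
Qed.

Lemma Ck_mul n D f g :
  Ck n D f -> Ck n D g -> Ck n D (fun u v => f u v * g u v).
Proof.
  revert f g. induction n as [|n IH]; intros f g Cf Cg;
    assert (Cf' := Cf); assert (Cg' := Cg);
    destruct Cf as [Hf Hf']; destruct Cg as [Hg Hg'];
    (split; [intros; apply continuity_2d_pt_mult; auto|]); [easy|].
  apply Ck_pred in Cf'. apply Ck_pred in Cg'.
  destruct Hf' as [fu [fv [F1 [F2 [F3 F4]]]]].
  destruct Hg' as [gu [gv [G1 [G2 [G3 G4]]]]].
  exists (fun u v => fu u v * g u v + f u v * gu u v),
         (fun u v => fv u v * g u v + f u v * gv u v).
  split4; try (apply Ck_add; auto); intros u v H.
  - apply (derive_mul (fun t => f t v) (fun t => g t v)); auto.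
  - apply (derive_mul (fun t => f u t) (fun t => g u t)); auto.
Qed.

Lemma Ck_opp n D f : open2 D -> Ck n D f -> Ck n D (fun u v => - f u v).
Proof.
  intros HD Hf. apply Ck_ext with (fun u v => (-1) * f u v); [easy| |].
  - intros; ring.
  - apply Ck_mul; [apply Ck_const|easy].
Qed.

Lemma Ck_minus n D f g : open2 D ->
  Ck n D f -> Ck n D g -> Ck n D (fun u v => f u v - g u v).
Proof. intros HD Hf Hg. apply Ck_add; [easy|now apply Ck_opp]. Qed.

Lemma Ck_inv n D f : open2 D -> (forall u v, D u v -> f u v <> 0) ->
  Ck n D f -> Ck n D (fun u v => / f u v).
Proof.
  intros HD Hnz. induction n as [|n IH]; intros Cf;
    assert (Cf' := Cf); destruct Cf as [Hf Hf'];
    (split; [intros; apply continuity_2d_pt_inv; auto|]); [easy|].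
  apply Ck_pred in Cf'.
  destruct Hf' as [fu [fv [F1 [F2 [F3 F4]]]]].
  exists (fun u v => - fu u v * (/ f u v * / f u v)),
         (fun u v => - fv u v * (/ f u v * / f u v)).
  split4; try (apply Ck_mul; [apply Ck_opp|apply Ck_mul]; auto);
    intros u v H.
  - eapply is_derive_value.
    { apply (derive_inv (fun t => f t v)); auto. }
    field. auto.
  - eapply is_derive_value.
    { apply (derive_inv (fun t => f u t)); auto. }
    field. auto.
Qed.

(** Continuity of one of the partial derivatives, with existence of the other,
    is what differentiability takes. *)
Lemma Ck_differentiable n D f fu fv u v :
  open2 D -> D u v ->
  (forall u v, D u v -> is_derive (fun t => f t v) u (fu u v)) ->
  (forall u v, D u v -> is_derive (fun t => f u t) v (fv u v)) ->
  Ck n D fu -> Ck n D fv ->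
  differentiable_pt_lim f u v (fu u v) (fv u v).
Proof.
  intros HD H F1 F2 F3 F4.
  apply filterdiff_differentiable_pt_lim.
  assert (h := is_derive_filterdiff f u v fu (fv u v)).
  assert (Hl := HD u v H).
  assert (h' : filterdiff (fun u0 => f (fst u0) (snd u0)) (locally (u, v))
    (fun u0 : R * R => plus (scal (fst u0) (fu u v)) (scal (snd u0) (fv u v)))).
  { apply h.
    - destruct Hl as [d Hd]. exists d. intros [x y] [Hx Hy]. simpl.
      apply F1. apply Hd; [exact Hx|exact Hy].
    - now apply F2.
    - apply continuity_2d_pt_filterlim. apply (Ck_continuity n D); auto. }
  exact h'.
Qed.

Lemma continuity_2d_pt_comp (f g1 g2 : R -> R -> R) u v :
  continuity_2d_pt f (g1 u v) (g2 u v) ->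
  continuity_2d_pt g1 u v -> continuity_2d_pt g2 u v ->
  continuity_2d_pt (fun u v => f (g1 u v) (g2 u v)) u v.
Proof.
  intros Hf H1 H2 e. destruct (Hf e) as [d Hd].
  apply locally_2d_impl with (2 := locally_2d_and _ _ _ _ (H1 d) (H2 d)).
  apply locally_2d_forall. intros x y [h1 h2]. now apply Hd.
Qed.

Lemma derive_chain_2d (f : R -> R -> R) (g1 g2 : R -> R) (x a b c1 c2 : R) :
  differentiable_pt_lim f (g1 x) (g2 x) a b ->
  is_derive g1 x c1 -> is_derive g2 x c2 ->
  is_derive (fun t => f (g1 t) (g2 t)) x (a * c1 + b * c2).
Proof.
  intros H H1 H2. apply is_derive_Reals.
  apply derivable_pt_lim_comp_2d; [easy| |]; now apply is_derive_Reals.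
Qed.

Lemma Ck_comp n D D' f g1 g2 : open2 D' ->
  (forall u v, D u v -> D' (g1 u v) (g2 u v)) ->
  Ck n D' f -> Ck n D g1 -> Ck n D g2 -> Ck n D (fun u v => f (g1 u v) (g2 u v)).
Proof.
  intros HD' Hg. revert f. induction n as [|n IH]; intros f Cf C1 C2;
    assert (C1' := C1); assert (C2' := C2); assert (Cf' := Cf);
    destruct Cf as [Hf Hf']; destruct C1 as [H1 H1']; destruct C2 as [H2 H2'];
    (split; [intros; apply continuity_2d_pt_comp; auto|]); [easy|].
  apply Ck_pred in C1'. apply Ck_pred in C2'.
  destruct Hf' as [fu [fv [F1 [F2 [F3 F4]]]]].
  destruct H1' as [au [av [A1 [A2 [A3 A4]]]]].
  destruct H2' as [bu [bv [B1 [B2 [B3 B4]]]]].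
  exists (fun u v => fu (g1 u v) (g2 u v) * au u v + fv (g1 u v) (g2 u v) * bu u v),
         (fun u v => fu (g1 u v) (g2 u v) * av u v + fv (g1 u v) (g2 u v) * bv u v).
  split4; try (apply Ck_add; apply Ck_mul; auto); intros u v H.
  - apply (derive_chain_2d f (fun t => g1 t v) (fun t => g2 t v)); auto.
    apply (Ck_differentiable n D'); auto.
  - apply (derive_chain_2d f (fun t => g1 u t) (fun t => g2 u t)); auto.
    apply (Ck_differentiable n D'); auto.
Qed.

Definition D1 (f : R -> R -> R) (u v : R) : R := Derive (fun t => f t v) u.
Definition D2 (f : R -> R -> R) (u v : R) : R := Derive (fun t => f u t) v.

Section Smooth.
Variables (D : R -> R -> Prop) (f : R -> R -> R).
Hypotheses (HD : open2 D) (Hf : smooth_on D f).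

Lemma smooth_derive1 u v : D u v -> is_derive (fun t => f t v) u (D1 f u v).
Proof.
  intros H. destruct (Hf 1%nat) as [_ [fu [fv [F1 _]]]].
  apply Derive_correct. exists (fu u v). now apply F1.
Qed.

Lemma smooth_derive2 u v : D u v -> is_derive (fun t => f u t) v (D2 f u v).
Proof.
  intros H. destruct (Hf 1%nat) as [_ [fu [fv [_ [F2 _]]]]].
  apply Derive_correct. exists (fv u v). now apply F2.
Qed.

Lemma smooth_D1 : smooth_on D (D1 f).
Proof.
  intros n. destruct (Hf (S n)) as [_ [fu [fv [F1 [F2 [F3 F4]]]]]].
  apply Ck_ext with fu; [easy| |easy].
  intros u v H. symmetry. apply is_derive_unique. now apply F1.
Qed.

Lemma smooth_D2 : smooth_on D (D2 f).
Proof.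
  intros n. destruct (Hf (S n)) as [_ [fu [fv [F1 [F2 [F3 F4]]]]]].
  apply Ck_ext with fv; [easy| |easy].
  intros u v H. symmetry. apply is_derive_unique. now apply F2.
Qed.

Lemma smooth_continuity u v : D u v -> continuity_2d_pt f u v.
Proof. apply (Ck_continuity 0); auto. Qed.

Lemma smooth_differentiable u v :
  D u v -> differentiable_pt_lim f u v (D1 f u v) (D2 f u v).
Proof.
  intros H. apply (Ck_differentiable 0 D); auto.
  - apply smooth_derive1.
  - apply smooth_derive2.
  - apply smooth_D1.
  - apply smooth_D2.
Qed.

End Smooth.

Lemma Ck_ex_diff n D f u v : open2 D -> Ck n D f -> D u v -> ex_diff_n f n u v.
Proof.
  intros HD. revert f u v. induction n as [|n IH]; intros f u v [Hc Hd] H;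
    (split; [now auto|]); [easy|].
  destruct Hd as [fu [fv [F1 [F2 [F3 F4]]]]].
  split; [exists (fu u v); auto|]. split; [exists (fv u v); auto|].
  split; (apply IH; [|easy]).
  - apply Ck_ext with fu; [easy| |easy].
    intros x y h. symmetry. apply is_derive_unique. now apply F1.
  - apply Ck_ext with fv; [easy| |easy].
    intros x y h. symmetry. apply is_derive_unique. now apply F2.
Qed.

Lemma ex_diff_Ck n (D : R -> R -> Prop) f :
  (forall u v, D u v -> ex_diff_n f n u v) -> Ck n D f.
Proof.
  revert f. induction n as [|n IH]; intros f H;
    (split; [intros u v h; now destruct (H u v h)|]); [easy|].
  exists (D1 f), (D2 f). split4.
  - intros u v h. apply Derive_correct. apply (H u v h).
  - intros u v h. apply Derive_correct. apply (H u v h).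
  - apply IH. intros u v h. apply (H u v h).
  - apply IH. intros u v h. apply (H u v h).
Qed.

Lemma smooth_on_smooth_at D f q : open2 D ->
  smooth_on D f -> D (fst q) (snd q) -> smooth_at (fun p => f (fst p) (snd p)) q.
Proof. intros HD Hf H n. now apply (Ck_ex_diff n D f). Qed.

Lemma smooth_at_smooth_on (D : R -> R -> Prop) (f : R * R -> R) :
  (forall u v, D u v -> smooth_at f (u, v)) -> smooth_on D (fun u v => f (u, v)).
Proof. intros H n. apply ex_diff_Ck. intros u v h. apply (H u v h). Qed.

(** Functions of one variable are treated as functions of two that do not depend
    on the second one, so that they inherit the closure properties of [Ck]. *)
Definition Ck1 (n : nat) (I : R -> Prop) (f : R -> R) : Prop :=
  Ck n (fun u _ => I u) (fun u _ => f u).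

Definition open1 (I : R -> Prop) : Prop := open2 (fun u _ => I u).

Lemma continuity_2d_pt_1d (f : R -> R) u v :
  continuity_2d_pt (fun u _ => f u) u v <-> continuity_pt f u.
Proof.
  split; intros H.
  - apply continuity_pt_eps. intros e He.
    destruct (H (mkposreal e He)) as [d Hd]. exists d.
    split; [apply cond_pos|]. intros y Hy. apply (Hd y v); [easy|].
    rewrite Rminus_diag, Rabs_R0. apply cond_pos.
  - apply (continuity_1d_2d_pt_comp f (fun u _ => u)); [easy|].
    apply continuity_2d_pt_id1.
Qed.

Lemma Ck1_zero (I : R -> Prop) f :
  (forall x, I x -> continuity_pt f x) -> Ck1 0 I f.
Proof. intros H. split; [|easy]. intros u v h. apply continuity_2d_pt_1d; auto. Qed.

Lemma Ck1_succ n (I : R -> Prop) f f' :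
  (forall x, I x -> is_derive f x (f' x)) -> Ck1 n I f' -> Ck1 (S n) I f.
Proof.
  intros Hd Hf. split.
  - intros u v h. apply continuity_2d_pt_1d.
    apply is_derive_continuity_pt with (f' u); auto.
  - exists (fun u _ => f' u), (fun _ _ => 0). split4; auto.
    + intros. apply @is_derive_const.
    + apply Ck_const.
Qed.

Lemma Ck1_continuity n (I : R -> Prop) f x :
  Ck1 n I f -> I x -> continuity_pt f x.
Proof.
  intros H Hx. apply (continuity_2d_pt_1d f x 0).
  apply (Ck_continuity n (fun u _ => I u)); auto.
Qed.

Lemma Ck1_derive n (I : R -> Prop) f : open1 I -> Ck1 (S n) I f ->
  (forall x, I x -> is_derive f x (Derive f x)) /\ Ck1 n I (Derive f).
Proof.
  intros HI [_ [fu [fv [F1 [F2 [F3 F4]]]]]]. split.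
  - intros x Hx. apply Derive_correct. exists (fu x 0). now apply (F1 x 0).
  - unfold Ck1. apply Ck_ext with fu; [easy| |easy].
    intros u v h. symmetry. apply is_derive_unique. now apply (F1 u v).
Qed.

(** * Averages *)

(** [avg 0 k x] is the mean of [k] between 0 and [x]; it inverts
    [u |-> (x u)'], the singular operator of the profile equation.  The
    higher moments appear as its derivatives. *)
Definition avg (j : nat) (m : R -> R) (x : R) : R :=
  RInt (fun t => t ^ j * m (t * x)) 0 1.

Definition star (I : R -> Prop) : Prop :=
  forall x t, I x -> 0 <= t <= 1 -> I (t * x).

Lemma avg_integrable (I : R -> Prop) j m x : star I ->
  (forall y, I y -> continuity_pt m y) -> I x ->
  ex_RInt (fun t => t ^ j * m (t * x)) 0 1.
Proof.
  intros HI Hm Hx. apply ex_RInt_Reals_1, continuity_implies_RiemannInt; [lra|].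
  intros t Ht. apply continuity_pt_mult.
  - apply derivable_continuous_pt, derivable_pt_pow.
  - apply (continuity_pt_comp (fun t => t * x) m).
    + apply continuity_pt_mult; [apply continuity_pt_id|].
      apply continuity_pt_const. now intros ? ?.
    + apply Hm, HI; [easy|lra].
Qed.

Lemma RInt_bound (f g h : R -> R) V : ex_RInt f 0 1 -> ex_RInt g 0 1 ->
  is_RInt h 0 1 V -> (forall t, 0 <= t <= 1 -> Rabs (f t - g t) <= h t) ->
  Rabs (RInt f 0 1 - RInt g 0 1) <= V.
Proof.
  intros Hf Hg Hh H.
  apply (norm_RInt_le (fun t => f t - g t) h 0 1 _ _ ltac:(lra) H); [|easy].
  apply (is_RInt_minus f g); now apply (@RInt_correct R_CompleteNormedModule).
Qed.

Lemma avg_continuity (I : R -> Prop) j m x : open1 I -> star I ->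
  (forall y, I y -> continuity_pt m y) -> I x -> continuity_pt (avg j m) x.
Proof.
  intros HO HI Hm Hx. apply continuity_pt_eps. intros e He.
  destruct (uniform_continuity_2d_1d (fun t y => t ^ j * m (t * y)) 0 1 x) with
    (eps := mkposreal (e / 2) ltac:(lra)) as [d Hd].
  { intros t Ht. apply continuity_2d_pt_mult.
    - apply (continuity_2d_pt_1d (fun t => t ^ j)).
      apply derivable_continuous_pt, derivable_pt_pow.
    - apply (continuity_1d_2d_pt_comp m (fun t y => t * y)).
      + now apply Hm, HI.
      + apply continuity_2d_pt_mult;
          [apply continuity_2d_pt_id1|apply continuity_2d_pt_id2]. }
  destruct (HO x 0 Hx) as [d2 Hd2].
  exists (Rmin d d2). split; [apply Rmin_pos; apply cond_pos|].
  intros y Hy. rmin d d2.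
  assert (Iy : I y).
  { apply (Hd2 y 0); [lra|]. rewrite Rminus_diag, Rabs_R0. apply cond_pos. }
  apply Rle_lt_trans with (e / 2); [|lra].
  apply (RInt_bound _ _ (fun _ => e / 2)).
  - now apply (avg_integrable I).
  - now apply (avg_integrable I).
  - eapply eq_ind; [apply (@is_RInt_const R_NormedModule)|].
    unfold scal; simpl; unfold mult; simpl. lra.
  - intros t Ht. assert (Hy' := Rabs_def2 _ _ Hy). simpl in Hd.
    apply Rlt_le, Hd; try lra. rewrite Rminus_diag, Rabs_R0. apply cond_pos.
Qed.

(** Differentiation under the integral sign; the inner derivative of [m (t x)]
    is a factor [t], which raises the moment. *)
Lemma avg_derive (I : R -> Prop) j m m' x : open1 I -> star I ->
  (forall y, I y -> is_derive m y (m' y)) ->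
  (forall y, I y -> continuity_pt m' y) -> I x ->
  is_derive (avg j m) x (avg (S j) m' x).
Proof.
  intros HO HI Hm Hm' Hx.
  assert (Hmc : forall y, I y -> continuity_pt m y).
  { intros y Hy. apply is_derive_continuity_pt with (m' y); auto. }
  assert (Hf : forall y t, I (t * y) ->
    is_derive (fun z => t ^ j * m (t * z)) y (t ^ S j * m' (t * y))).
  { intros y t Hy. eapply is_derive_value.
    { apply (derive_mul (fun _ => t ^ j) (fun z => m (t * z)) y 0 (m' (t * y) * t)).
      - apply @is_derive_const.
      - apply (derive_chain m (fun z => t * z)); [now apply Hm|].
        auto_derive; [easy|ring]. }
    simpl. ring. }
  assert (HIl : locally x I).
  { apply (locally_2d_1 (fun u _ => I u) x 0). now apply HO. }
  replace (avg (S j) m' x) with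
    (RInt (fun t => Derive (fun z => t ^ j * m (t * z)) x) 0 1).
  - apply (is_derive_RInt_param (fun z t => t ^ j * m (t * z)) 0 1 x).
    + revert HIl. apply filter_imp. intros y Hy t. rewrite Rmin_left, Rmax_right by lra.
      intros Ht. exists (t ^ S j * m' (t * y)). now apply Hf, HI.
    + intros t. rewrite Rmin_left, Rmax_right by lra. intros Ht.
      apply continuity_2d_pt_ext_loc with (fun u v => v ^ S j * m' (v * u)).
      * assert (Hl : locally_2d (fun u v => I (v * u)) x t).
        { assert (Hc : continuity_2d_pt (fun u v => v * u) x t).
          { apply continuity_2d_pt_mult;
              [apply continuity_2d_pt_id2|apply continuity_2d_pt_id1]. }
          destruct (HO (t * x) 0 (HI x t Hx Ht)) as [d Hd].
          destruct (Hc d) as [d' Hd']. exists d'. intros u v Hu Hv.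
          apply (Hd (v * u) 0); [now apply Hd'|].
          rewrite Rminus_diag, Rabs_R0. apply cond_pos. }
        revert Hl. apply locally_2d_impl, locally_2d_forall.
        intros u v Huv. symmetry. now apply is_derive_unique, Hf.
      * apply continuity_2d_pt_mult.
        -- apply (continuity_1d_2d_pt_comp (fun v => v ^ S j) (fun _ v => v)).
           ++ apply derivable_continuous_pt, derivable_pt_pow.
           ++ apply continuity_2d_pt_id2.
        -- apply (continuity_1d_2d_pt_comp m' (fun u v => v * u)).
           ++ now apply Hm', HI.
           ++ apply continuity_2d_pt_mult;
                [apply continuity_2d_pt_id2|apply continuity_2d_pt_id1].
    + revert HIl. apply filter_imp. intros y Hy. now apply (avg_integrable I).
  - apply RInt_ext. rewrite Rmin_left, Rmax_right by lra. intros t Ht.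
    apply is_derive_unique, Hf, HI; [easy|lra].
Qed.

Lemma Ck1_avg n (I : R -> Prop) j m : open1 I -> star I ->
  Ck1 n I m -> Ck1 n I (avg j m).
Proof.
  intros HO HI. revert j m. induction n as [|n IH]; intros j m Hm.
  - apply Ck1_zero. intros x Hx. apply (avg_continuity I); auto.
    intros y Hy. now apply (Ck1_continuity 0 I).
  - destruct (Ck1_derive n I m HO Hm) as [Hd Hm'].
    apply Ck1_succ with (avg (S j) (Derive m)); [|now apply IH].
    intros x Hx. apply (avg_derive I); auto.
    intros y Hy. now apply (Ck1_continuity n I).
Qed.

(** The substitution [s = t x] in the moment. *)
Lemma avg_moment (I : R -> Prop) j m x : open1 I -> star I ->
  (forall y, I y -> continuity_pt m y) -> I x ->
  is_derive (fun y => y ^ S j * avg j m y) x (x ^ j * m x).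
Proof.
  intros HO HI Hm Hx.
  assert (Hc : forall y, I y -> continuous (fun s => s ^ j * m s) y).
  { intros y Hy. apply continuity_pt_filterlim, continuity_pt_mult; [|auto].
    apply derivable_continuous_pt, derivable_pt_pow. }
  assert (H : forall y, I y -> is_RInt (fun s => s ^ j * m s) 0 y (y ^ S j * avg j m y)).
  { intros y Hy.
    assert (Hseg : forall s, Rmin 0 y <= s <= Rmax 0 y -> I s).
    { intros s Hs. destruct (Req_dec y 0) as [->|Hy0].
      - rewrite Rmin_left, Rmax_left in Hs by lra. now replace s with 0 by lra.
      - replace s with (s / y * y) by (field; easy). apply HI; [easy|].
        destruct (Rlt_dec 0 y).
        + rewrite Rmin_left, Rmax_right in Hs by lra.
          split; [apply Rdiv_le_0_compat; lra|].
          apply Rmult_le_reg_r with y; [easy|]. unfold Rdiv.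
          rewrite Rmult_assoc, Rinv_l; lra.
        + rewrite Rmin_right, Rmax_left in Hs by lra.
          replace (s / y) with ((- s) / (- y)) by (field; easy).
          split; [apply Rdiv_le_0_compat; lra|].
          apply Rmult_le_reg_r with (- y); [lra|]. unfold Rdiv.
          rewrite Rmult_assoc, Rinv_l; lra. }
    assert (Hex : ex_RInt (fun s => s ^ j * m s) 0 y).
    { apply (@ex_RInt_continuous R_CompleteNormedModule). auto. }
    apply (@RInt_correct R_CompleteNormedModule) in Hex.
    replace (y ^ S j * avg j m y) with (RInt (fun s => s ^ j * m s) 0 y); [easy|].
    assert (Hs : is_RInt (fun t => y * ((y * t + 0) ^ j * m (y * t + 0))) 0 1
              (RInt (fun s => s ^ j * m s) 0 y)).
    { apply (is_RInt_comp_lin (fun s => s ^ j * m s)).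
      replace (y * 0 + 0) with 0 by ring. now replace (y * 1 + 0) with y by ring. }
    assert (Ha : is_RInt (fun t => y ^ S j * (t ^ j * m (t * y))) 0 1
              (y ^ S j * avg j m y)).
    { apply (is_RInt_scal (fun t => t ^ j * m (t * y)) 0 1 (y ^ S j)).
      apply (@RInt_correct R_CompleteNormedModule). now apply (avg_integrable I). }
    rewrite <- (is_RInt_unique _ _ _ _ Hs), <- (is_RInt_unique _ _ _ _ Ha).
    apply RInt_ext. intros t _. simpl.
    rewrite Rplus_0_r, Rpow_mult_distr, (Rmult_comm t y). ring. }
  apply (is_derive_RInt (fun s => s ^ j * m s) _ 0 x); [|auto].
  assert (HIl : locally x I).
  { apply (locally_2d_1 (fun u _ => I u) x 0). now apply HO. }
  revert HIl. apply filter_imp. intros y Hy. now apply H.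
Qed.

Lemma avg_1_zero m : avg 1 m 0 = m 0 / 2.
Proof.
  unfold avg. rewrite (RInt_ext _ (fun t => t * m 0)).
  - apply is_RInt_unique.
    replace (m 0 / 2) with (minus (1 ^ 2 / 2 * m 0) (0 ^ 2 / 2 * m 0)).
    + apply (is_RInt_derive (fun t => t ^ 2 / 2 * m 0) (fun t => t * m 0)).
      * intros t _. auto_derive; [easy|]. field.
      * intros t _. apply continuity_pt_filterlim, continuity_pt_mult;
          [apply continuity_pt_id|]. apply continuity_pt_const. now intros ? ?.
    + unfold minus, plus, opp; simpl. field.
  - intros t _. rewrite Rmult_0_r. simpl. ring.
Qed.

(** Multiplication by [x] gains a derivative in the average; this is what makes
    the solution of the singular equation smooth at 0. *)
Lemma avg_gain_derive (I : R -> Prop) m x : open1 I -> star I ->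
  (forall y, I y -> continuity_pt m y) -> I x ->
  is_derive (fun y => y * avg 1 m y) x (m x - avg 1 m x).
Proof.
  intros HO HI Hm Hx. destruct (Req_dec x 0) as [->|Hx0].
  - apply is_derive_Reals. intros e He.
    destruct (proj1 (continuity_pt_eps _ _) (avg_continuity I 1 m 0 HO HI Hm Hx) e He)
      as [d [Hd Hd']].
    exists (mkposreal d Hd). intros h Hh0 Hh. simpl in Hh.
    replace (((0 + h) * avg 1 m (0 + h) - 0 * avg 1 m 0) / h - (m 0 - avg 1 m 0))
      with (avg 1 m h - avg 1 m 0).
    + apply Hd'. now rewrite Rminus_0_r.
    + rewrite Rplus_0_l, avg_1_zero. field. easy.
  - apply (derive_ext_near (fun y => y ^ 2 * avg 1 m y * / y) _ x _ (Rabs x)).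
    + now apply Rabs_pos_lt.
    + intros y Hy. assert (y <> 0).
      { intros ->. unfold Rminus in Hy. rewrite Rplus_0_l, Rabs_Ropp in Hy. lra. }
      field. easy.
    + eapply is_derive_value.
      { apply (derive_mul (fun y => y ^ 2 * avg 1 m y) (fun y => / y)).
        - now apply (avg_moment I 1).
        - apply (derive_inv (fun y => y)); [apply derive_id|easy]. }
      field. easy.
Qed.

(** ** The singular initial value problem *)

Lemma is_RInt_exp (s l : R) : 0 < l ->
  is_RInt (fun t => s * exp (l * (t * s))) 0 1 ((exp (l * s) - 1) / l).
Proof.
  intros Hl.
  replace ((exp (l * s) - 1) / l) with
    (minus (exp (l * (1 * s)) / l) (exp (l * (0 * s)) / l)).
  - apply (is_RInt_derive (fun t => exp (l * (t * s)) / l)).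
    + intros t _. auto_derive; [easy|]. field. lra.
    + intros t _. apply continuity_pt_filterlim, derivable_continuous_pt.
      exists (s * (l * s) * exp (l * (t * s))). apply is_derive_Reals.
      auto_derive; [easy|]. ring.
  - unfold minus, plus, opp; simpl.
    rewrite Rmult_1_l, Rmult_0_l, Rmult_0_r, exp_0. field. lra.
Qed.

Lemma continuity_avg0_id (f : R -> R) :
  continuity f -> continuity (fun s => s * avg 0 f s).
Proof.
  intros Hf s. apply continuity_pt_mult; [apply continuity_pt_id|].
  apply (avg_continuity (fun _ => True)); try easy.
  - intros u v _. now apply locally_2d_forall.
Qed.

Lemma avg_zero j x : avg j (fun _ => 0) x = 0.
Proof.
  unfold avg. rewrite (RInt_ext _ (fun _ => 0)).
  - rewrite RInt_const. apply Rmult_0_r.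
  - intros t _. apply Rmult_0_r.
Qed.

Definition lipschitz2 (L : R) (m : R -> R -> R) : Prop :=
  forall x y x' y', Rabs (m x y - m x' y') <= L * (Rabs (x - x') + Rabs (y - y')).

Lemma lipschitz2_continuity L m (f g : R -> R) : lipschitz2 L m ->
  continuity f -> continuity g -> continuity (fun s => m (f s) (g s)).
Proof.
  intros HL Hf Hg s. apply continuity_pt_eps. intros e He.
  assert (HL0 : 0 < 2 * (Rabs L + 1)) by (assert (h := Rabs_pos L); lra).
  assert (He' : 0 < e / (2 * (Rabs L + 1))) by now apply Rdiv_lt_0_compat.
  destruct (proj1 (continuity_pt_eps _ _) (Hf s) _ He') as [d1 [Hd1 H1]].
  destruct (proj1 (continuity_pt_eps _ _) (Hg s) _ He') as [d2 [Hd2 H2]].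
  exists (Rmin d1 d2). split; [now apply Rmin_pos|]. intros y Hy.
  rmin d1 d2.
  specialize (H1 y ltac:(lra)). specialize (H2 y ltac:(lra)).
  eapply Rle_lt_trans; [apply HL|].
  set (e' := e / (2 * (Rabs L + 1))) in *.
  assert (He2 : e = e' * (2 * (Rabs L + 1))) by (unfold e'; field; lra).
  assert (h3 := Rabs_pos (f y - f s)). assert (h4 := Rabs_pos (g y - g s)).
  assert (h5 := Rle_abs L). nra.
Qed.

(** The unknown is [psi = phi'].  On the right it occurs only through its
    primitive [phi] or with a factor [s], and averages of such terms are small
    against a steep exponential weight [exp (l |s|)].  So the map is a
    contraction, although [avg] itself does not make its argument small near
    0. *)
Lemma singular_ivp (A : R -> R) (m : R -> R -> R) (L z0 : R) :
  (forall x x', Rabs (A x - A x') <= L * Rabs (x - x')) -> lipschitz2 L m ->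
  exists psi : R -> R, continuity psi /\
    let phi := fun s => z0 + s * avg 0 psi s in
    forall s, avg 0 (fun s => A (phi s) + s * m (phi s) (psi s)) s = psi s.
Proof.
  intros HA Hm.
  assert (HL : 0 <= L).
  { assert (h := HA 1 0). assert (h' := Rabs_pos (A 1 - A 0)).
    rewrite Rminus_0_r, Rabs_R1 in h. lra. }
  set (phi := fun (f : R -> R) s => z0 + s * avg 0 f s).
  set (k := fun (f : R -> R) s => A (phi f s) + s * m (phi f s) (f s)).
  set (l := 6 * L + 1).
  set (w := fun s => exp (l * Rabs s)).
  assert (Hl : 1 <= l) by (unfold l; lra).
  assert (Hw : forall s, 0 < w s) by (intros; apply exp_pos).
  assert (HwM : forall s t, 0 <= t <= 1 -> w (t * s) <= w s).
  { intros s t Ht. unfold w.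
    assert (Rabs (t * s) <= Rabs s).
    { rewrite Rabs_mult, (Rabs_pos_eq t) by lra. assert (h := Rabs_pos s). nra. }
    destruct (Req_dec (Rabs (t * s)) (Rabs s)) as [->|]; [lra|].
    apply Rlt_le, exp_increasing. nra. }
  assert (Hphi : forall f, continuity f -> continuity (phi f)).
  { intros f Hf. unfold phi. apply (continuity_plus (fun _ => z0)).
    - apply continuity_const. now intros ? ?.
    - now apply continuity_avg0_id. }
  assert (HAc : forall f, continuity f -> continuity (fun s => A (f s))).
  { intros f Hf. apply (lipschitz2_continuity L (fun x _ => A x) f f); auto.
    intros x y x' y'. eapply Rle_trans; [apply HA|].
    assert (h := Rabs_pos (y - y')). nra. }
  assert (Hk : forall f, continuity f -> continuity (k f)).
  { intros f Hf. unfold k. apply (continuity_plus (fun s => A (phi f s))).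
    - now apply HAc, Hphi.
    - apply (continuity_mult (fun s => s)).
      + apply derivable_continuous, derivable_id.
      + apply (lipschitz2_continuity L m); auto. }
  assert (Hstar : star (fun _ => True)) by easy.
  assert (Hopen : open1 (fun _ => True)).
  { intros u v _. now apply locally_2d_forall. }
  assert (Hint : forall f s, continuity f ->
    ex_RInt (fun t => t ^ 0 * f (t * s)) 0 1).
  { intros f s Hf. apply (avg_integrable (fun _ => True)); auto. }
  (* the distance of the primitives *)
  assert (Hdphi : forall f g d, continuity f -> continuity g ->
    (forall s, Rabs (f s - g s) <= d * w s) ->
    forall s, Rabs (phi f s - phi g s) <= d * (w s - 1) / l).
  { intros f g d Hf Hg Hd s. unfold phi.
    replace (z0 + s * avg 0 f s - (z0 + s * avg 0 g s)) with
      (s * (avg 0 f s - avg 0 g s)) by ring.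
    rewrite Rabs_mult.
    destruct (Req_dec s 0) as [->|Hs0].
    { rewrite Rabs_R0, Rmult_0_l. unfold w. rewrite Rabs_R0, Rmult_0_r, exp_0.
      right. field. lra. }
    assert (Hs : 0 < Rabs s) by now apply Rabs_pos_lt.
    apply Rmult_le_reg_l with (/ Rabs s); [now apply Rinv_0_lt_compat|].
    rewrite <- Rmult_assoc, Rinv_l, Rmult_1_l by lra.
    replace (/ Rabs s * (d * (w s - 1) / l)) with
      (scal (/ Rabs s * d) ((w s - 1) / l)) by
      (unfold scal; simpl; unfold mult; simpl; field; lra).
    unfold avg. eapply RInt_bound; auto.
    { apply (is_RInt_scal (fun t => Rabs s * exp (l * (t * Rabs s)))).
      apply (is_RInt_exp (Rabs s) l). lra. }
    intros t Ht. simpl. rewrite !Rmult_1_l.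
    eapply Rle_trans; [apply Hd|]. unfold w.
    rewrite Rabs_mult, (Rabs_pos_eq t) by lra.
    unfold scal; simpl; unfold mult; simpl. right. field. lra. }
  destruct (contraction_fixed_point w continuity (fun f => avg 0 (k f))
              (fun _ => 0) (Rabs (A z0) + Rabs (m z0 0))) as [psi [Hc [He _]]].
  - intros f Hf s. apply (avg_continuity (fun _ => True)); auto.
    intros y _. now apply Hk.
  - intros f g d Hf Hg Hd s.
    assert (Hd0 : 0 <= d).
    { specialize (Hd 0). assert (h := Rabs_pos (f 0 - g 0)).
      assert (h' := Hw 0). nra. }
    specialize (Hdphi f g d Hf Hg Hd).
    apply Rle_trans with (scal (L * d / l * w s) (1 - 0) +
      scal (2 * L * d) ((w s - 1) / l)).
    + unfold avg. eapply RInt_bound; auto.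
      { apply (is_RInt_plus (fun _ => L * d / l * w s)
          (fun t => scal (2 * L * d) (Rabs s * exp (l * (t * Rabs s))))).
        - eapply eq_ind; [apply (@is_RInt_const R_NormedModule)|].
          unfold scal; simpl; unfold mult; simpl; ring.
        - apply (is_RInt_scal (fun t => Rabs s * exp (l * (t * Rabs s)))).
          apply (is_RInt_exp (Rabs s) l). lra. }
      intros t Ht. simpl pow. rewrite !Rmult_1_l.
      unfold plus, scal; simpl; unfold mult; simpl.
      replace (exp (l * (t * Rabs s))) with (w (t * s)) by
        (unfold w; rewrite Rabs_mult, (Rabs_pos_eq t) by lra; easy).
      assert (Hts : Rabs (t * s) <= Rabs s).
      { rewrite Rabs_mult, (Rabs_pos_eq t) by lra. assert (h := Rabs_pos s). nra. }
      assert (Hwt := HwM s t Ht). assert (Hw0 := Hw (t * s)).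
       assert (Hts0 := Rabs_pos (t * s)).
      generalize (Hd (t * s)) (Hdphi (t * s)). clear Hd Hdphi.
      generalize dependent (t * s). intros r Hr Hwr Hwr0 Hr0 Hd Hdphi.
      unfold k.
      replace (A (phi f r) + r * m (phi f r) (f r) -
               (A (phi g r) + r * m (phi g r) (g r))) with
        ((A (phi f r) - A (phi g r)) +
          r * (m (phi f r) (f r) - m (phi g r) (g r))) by ring.
      eapply Rle_trans; [apply Rabs_triang|]. rewrite Rabs_mult.
      assert (h1 := HA (phi f r) (phi g r)).
      set (p := Rabs (phi f r - phi g r)) in *. set (q := Rabs (f r - g r)) in *.
      assert (Hdl : 0 <= d / l <= d).
      { split; [apply Rdiv_le_0_compat; lra|].
        apply Rmult_le_reg_r with l; [lra|]. unfold Rdiv.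
        rewrite Rmult_assoc, Rinv_l by lra. nra. }
      assert (Hpq : p + q <= 2 * d * w r) by nra.
      apply Rplus_le_compat.
      * apply Rle_trans with (1 := h1).
        replace (L * d / l * w s) with (L * (d / l * w s)) by (field; lra).
        apply Rmult_le_compat_l; [easy|]. nra.
      * apply Rle_trans with (Rabs r * (L * (p + q))).
        { apply Rmult_le_compat_l; easy. }
        apply Rle_trans with (Rabs r * (L * (2 * d * w r))).
        { apply Rmult_le_compat_l; [easy|]. now apply Rmult_le_compat_l. }
        replace (2 * L * d * (Rabs s * w r)) with (Rabs s * (L * (2 * d * w r))) by ring.
        apply Rmult_le_compat_r; [|easy].
        apply Rmult_le_pos; [easy|]. nra.
    + unfold scal; simpl; unfold mult; simpl.
      apply Rmult_le_reg_r with l; [lra|].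
      replace ((L * d / l * w s * (1 - 0) + 2 * L * d * ((w s - 1) / l)) * l) with
        (3 * L * d * w s - 2 * L * d) by (field; lra).
      assert (h := Hw s). assert (0 <= L * d) by nra. assert (0 <= d * w s) by nra.
      unfold l. nra.
  - intros s f Hs Hf x. apply continuity_pt_eps. intros e He.
    set (B := exp (l * (Rabs x + 1))).
    set (D := Rabs (A z0) + Rabs (m z0 0)) in *.
    destruct (half_pow_small (2 * D * B) (e / 3) ltac:(lra)) as [n Hn].
    destruct (proj1 (continuity_pt_eps _ _) (Hs n x) (e / 3) ltac:(lra))
      as [d [Hd Hd']].
    exists (Rmin d 1). split; [apply Rmin_pos; lra|]. intros y Hy.
    rmin d 1.
    specialize (Hd' y ltac:(lra)).
    assert (HD : 0 <= D).
    { unfold D. assert (h := Rabs_pos (A z0)). assert (h' := Rabs_pos (m z0 0)). lra. }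
    assert (HB : forall y, Rabs (y - x) < 1 -> Rabs (s n y - f y) < e / 3).
    { intros r Hr. eapply Rle_lt_trans; [apply Hf|].
      assert (Hwr : w r <= B).
      { unfold w, B. apply Rlt_le, exp_increasing.
        assert (h := Rabs_triang (r - x) x).
        replace (r - x + x) with r in h by ring. nra. }
      assert (h := half_pow_pos n). assert (0 <= 2 * D * (/ 2) ^ n) by nra.
      eapply Rle_lt_trans; [|apply Hn]. nra. }
    assert (h3 := HB y ltac:(lra)).
    assert (h4 := HB x ltac:(rewrite Rminus_diag, Rabs_R0; lra)).
    apply Rabs_def2 in h3, h4, Hd'. apply Rabs_def1; lra.
  - apply continuity_const. now intros ? ?.
  - intros s.
    assert (H0 : forall r, phi (fun _ => 0) r = z0).
    { intros r. unfold phi.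
      rewrite avg_zero. ring. }
    replace (avg 0 (k (fun _ => 0)) s - 0) with
      (avg 0 (k (fun _ => 0)) s - avg 0 (fun _ => 0) s).
    2:{ now rewrite avg_zero. }
    unfold avg. eapply (RInt_bound _ _ (fun _ => (Rabs (A z0) + Rabs (m z0 0)) * w s)).
    + apply Hint, Hk. apply continuity_const. now intros ? ?.
    + apply (Hint (fun _ => 0) s). apply continuity_const. now intros ? ?.
    + eapply eq_ind; [apply (@is_RInt_const R_NormedModule)|].
      unfold scal; simpl; unfold mult; simpl; ring.
    + intros t Ht. simpl. rewrite !Rmult_1_l, Rminus_0_r.
      unfold k. rewrite H0.
      eapply Rle_trans; [apply Rabs_triang|]. rewrite Rabs_mult.
      assert (Hr : Rabs (t * s) <= w (t * s) /\ 1 <= w (t * s)).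
      { unfold w. assert (h := Rabs_pos (t * s)).
        assert (h' := exp_ineq1_le (l * Rabs (t * s))). nra. }
      assert (h := HwM s t Ht). assert (h1 := Rabs_pos (A z0)).
      assert (h2 := Rabs_pos (m z0 0)). nra.
  - exists psi. split; [easy|]. exact He.
Qed.

(** * The profile in the variable [r^2] *)

Definition force (x : R) : R := (1 - x) / x ^ 2.

(** [force = - potential' / 2]. *)
Definition potential (x : R) : R := 2 / x + 2 * ln x.

Lemma ln_le_sub (x : R) : 0 < x -> ln x <= x - 1.
Proof.
  intros Hx. assert (h := exp_ineq1_le (ln x)). rewrite exp_ln in h; lra.
Qed.

Lemma ln_le_half (x : R) : 0 < x -> ln x <= x / 2.
Proof.
  intros Hx. replace x with (2 * (x / 2)) at 1 by field.
  rewrite ln_mult by lra.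
  assert (h1 := ln_le_sub 2 ltac:(lra)). assert (h2 := ln_le_sub (x / 2) ltac:(lra)).
  lra.
Qed.

Lemma potential_ge_inv (x : R) : 0 < x -> / x <= potential x.
Proof.
  intros Hx. unfold potential. assert (h := Rinv_0_lt_compat x Hx).
  assert (h' := ln_le_half (/ x) h). rewrite ln_Rinv in h' by easy. lra.
Qed.

Lemma potential_ge_2 (x : R) : 0 < x -> 2 <= potential x.
Proof.
  intros Hx. unfold potential. assert (h := Rinv_0_lt_compat x Hx).
  assert (h' := ln_le_sub (/ x) h). rewrite ln_Rinv in h' by easy. lra.
Qed.

Lemma potential_1 : potential 1 = 2.
Proof. unfold potential. rewrite ln_1. field. Qed.

Lemma potential_derive (x : R) : 0 < x ->
  is_derive potential x (- (2 * force x)).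
Proof.
  intros Hx. unfold potential, force. auto_derive; [lra|]. field. lra.
Qed.

(** ** Truncation *)

Definition clamp (a b x : R) : R := Rmax a (Rmin b x).

Lemma clamp_bounds a b x : a <= b -> a <= clamp a b x <= b.
Proof.
  intros H. unfold clamp, Rmax, Rmin. destruct Rle_dec; destruct Rle_dec; lra.
Qed.

Lemma clamp_id a b x : a <= x <= b -> clamp a b x = x.
Proof.
  intros H. unfold clamp. rewrite Rmin_right, Rmax_right by lra. easy.
Qed.

Lemma clamp_lipschitz a b x y : a <= b ->
  Rabs (clamp a b x - clamp a b y) <= Rabs (x - y).
Proof.
  intros H. unfold clamp, Rmax, Rmin, Rabs.
  destruct (Rle_dec b x), (Rle_dec b y);
    repeat destruct Rle_dec; repeat destruct Rcase_abs; lra.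
Qed.

Section Truncated.
Variables a b : R.
Hypotheses (Ha : 0 < a) (Ha1 : a < 1) (Hb1 : 1 < b).

(** The truncations are bounded and globally Lipschitz, as [singular_ivp]
    requires.  [tbound] bounds the truncated force, and by [psi_bounded] the
    solution does not exceed it either, so that the truncation of the second
    argument of [tdamp] is inactive. *)
Definition tforce (x : R) : R := force (clamp a b x).
Definition tbound : R := / a ^ 2 + / a.
Definition tlip : R := (2 / a + 1) / a ^ 2.
Definition tdamp (x y : R) : R :=
  let y := clamp (- tbound) tbound y in 2 * y ^ 2 * (tforce x - y).

Lemma tbound_pos : 0 < tbound.
Proof.
  unfold tbound. assert (h := Rinv_0_lt_compat a Ha).
  assert (h' := Rinv_0_lt_compat (a ^ 2) ltac:(nra)). lra.
Qed.

Lemma force_inv x : 0 < x -> force x = (/ x) ^ 2 - / x.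
Proof. intros H. unfold force. field. lra. Qed.

Lemma tforce_bound x : Rabs (tforce x) <= tbound.
Proof.
  unfold tforce, tbound. assert (h := clamp_bounds a b x ltac:(lra)).
  rewrite force_inv by lra.
  assert (h1 : 0 < / clamp a b x) by (apply Rinv_0_lt_compat; lra).
  assert (h2 : / clamp a b x <= / a) by (apply Rinv_le_contravar; lra).
  replace (/ a ^ 2) with ((/ a) ^ 2) by (field; lra).
  apply Rabs_le. simpl. nra.
Qed.

Lemma tforce_lipschitz x y : Rabs (tforce x - tforce y) <= tlip * Rabs (x - y).
Proof.
  unfold tforce, tlip. assert (hx := clamp_bounds a b x ltac:(lra)).
  assert (hy := clamp_bounds a b y ltac:(lra)).
  assert (h := clamp_lipschitz a b x y ltac:(lra)).
  rewrite !force_inv by lra. set (s := clamp a b x) in *. set (t := clamp a b y) in *.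
  assert (hs : 0 < / s <= / a).
  { split; [apply Rinv_0_lt_compat; lra|apply Rinv_le_contravar; lra]. }
  assert (ht : 0 < / t <= / a).
  { split; [apply Rinv_0_lt_compat; lra|apply Rinv_le_contravar; lra]. }
  replace ((/ s) ^ 2 - / s - ((/ t) ^ 2 - / t)) with
    ((/ s * / t) * (1 - / s - / t) * (s - t)) by (field; lra).
  rewrite !Rabs_mult, (Rabs_pos_eq (/ s)), (Rabs_pos_eq (/ t)) by lra.
  assert (h3 : Rabs (1 - / s - / t) <= 2 / a + 1).
  { apply Rabs_le. unfold Rdiv. lra. }
  replace ((2 / a + 1) / a ^ 2) with ((/ a * / a) * (2 / a + 1)) by (field; lra).
  apply Rmult_le_compat; [| |apply Rmult_le_compat|easy].
  - apply Rmult_le_pos; [nra|apply Rabs_pos].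
  - apply Rabs_pos.
  - nra.
  - apply Rabs_pos.
  - nra.
  - easy.
Qed.

Lemma tlip_pos : 0 <= tlip.
Proof.
  unfold tlip. apply Rdiv_le_0_compat; [|nra].
  assert (h := Rinv_0_lt_compat a Ha). lra.
Qed.

Lemma tdamp_lipschitz :
  lipschitz2 (tlip + 2 * tbound ^ 2 * tlip + 10 * tbound ^ 2) tdamp.
Proof.
  intros x y x' y'. unfold tdamp. assert (hM := tbound_pos). assert (hL := tlip_pos).
  assert (h1 := clamp_bounds (- tbound) tbound y ltac:(lra)).
  assert (h2 := clamp_bounds (- tbound) tbound y' ltac:(lra)).
  assert (h3 := clamp_lipschitz (- tbound) tbound y y' ltac:(lra)).
  assert (h4 := tforce_lipschitz x x'). assert (h5 := tforce_bound x').
  set (s := clamp _ _ y) in *. set (t := clamp _ _ y') in *.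
  set (M := tbound) in *. set (L := tlip) in *.
  set (g := tforce x) in *. set (g' := tforce x') in *.
  apply Rabs_le_inv in h5.
  replace (2 * s ^ 2 * (g - s) - 2 * t ^ 2 * (g' - t)) with
    (2 * s ^ 2 * (g - g') +
      2 * ((s + t) * g' - (s ^ 2 + s * t + t ^ 2)) * (s - t)) by ring.
  eapply Rle_trans; [apply Rabs_triang|].
  rewrite (Rabs_mult (2 * s ^ 2)), (Rabs_mult (2 * (_ - _))).
  assert (h6 : Rabs (2 * s ^ 2) <= 2 * M ^ 2).
  { rewrite Rabs_pos_eq by nra. nra. }
  assert (h7 : Rabs (2 * ((s + t) * g' - (s ^ 2 + s * t + t ^ 2))) <= 10 * M ^ 2).
  { assert (k1 : Rabs s <= M) by (apply Rabs_le; lra).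
    assert (k2 : Rabs t <= M) by (apply Rabs_le; lra).
    assert (k3 : Rabs g' <= M) by (apply Rabs_le; lra).
    replace (2 * ((s + t) * g' - (s ^ 2 + s * t + t ^ 2))) with
      (2 * (s * g') + (2 * (t * g') - 2 * (s * s) - 2 * (s * t) - 2 * (t * t))) by ring.
    assert (P : forall p q, Rabs p <= M -> Rabs q <= M -> - M ^ 2 <= p * q <= M ^ 2).
    { intros p q Hp Hq. apply Rabs_le_inv. rewrite Rabs_mult. simpl.
      rewrite Rmult_1_r. apply Rmult_le_compat; auto using Rabs_pos. }
    assert (p1 := P _ _ k1 k3). assert (p2 := P _ _ k2 k3).
    assert (p3 := P _ _ k1 k1). assert (p4 := P _ _ k1 k2). assert (p5 := P _ _ k2 k2).
    apply Rabs_le. lra. }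
  assert (h8 := Rabs_pos (x - x')). assert (h9 := Rabs_pos (y - y')).
  assert (h10 : Rabs (2 * s ^ 2) * Rabs (g - g') <= 2 * M ^ 2 * (L * Rabs (x - x'))).
  { apply Rmult_le_compat; auto using Rabs_pos. }
  assert (h11 : Rabs (2 * ((s + t) * g' - (s ^ 2 + s * t + t ^ 2))) * Rabs (s - t)
            <= 10 * M ^ 2 * Rabs (y - y')).
  { apply Rmult_le_compat; auto using Rabs_pos. }
  assert (0 <= L * Rabs (x - x') /\ 0 <= L * Rabs (y - y')) by (split; nra).
  nra.
Qed.

Lemma tforce_continuity x : continuity_pt tforce x.
Proof.
  apply (lipschitz2_continuity tlip (fun x _ => tforce x) (fun s => s) (fun s => s)).
  - intros u v u' v'. eapply Rle_trans; [apply tforce_lipschitz|].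
    assert (h := tlip_pos). assert (h' := Rabs_pos (v - v')).
    apply Rmult_le_compat_l; lra.
  - apply derivable_continuous, derivable_id.
  - apply derivable_continuous, derivable_id.
Qed.

Definition tpotential (x : R) : R := RInt (fun t => - (2 * tforce t)) 1 x.

Lemma tpotential_derive x : is_derive tpotential x (- (2 * tforce x)).
Proof.
  assert (Hc : forall y, continuous (fun t => - (2 * tforce t)) y).
  { intros y. apply continuity_pt_filterlim.
    apply (continuity_pt_opp (fun t => 2 * tforce t)).
    apply (continuity_pt_scal tforce), tforce_continuity. }
  apply (is_derive_RInt (fun t => - (2 * tforce t)) tpotential 1 x); [|apply Hc].
  apply filter_forall. intros y. apply (@RInt_correct R_CompleteNormedModule).
  apply (@ex_RInt_continuous R_CompleteNormedModule). auto.
Qed.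

Lemma tforce_id x : a <= x <= b -> tforce x = force x.
Proof. intros H. unfold tforce. now rewrite clamp_id. Qed.

Lemma tpotential_potential x : a <= x <= b ->
  tpotential x = potential x - potential 1.
Proof.
  intros Hx. apply is_RInt_unique.
  assert (Hin : forall y, Rmin 1 x <= y <= Rmax 1 x -> a <= y <= b).
  { intros y. unfold Rmin, Rmax. destruct Rle_dec; lra. }
  apply is_RInt_ext with (fun t => - (2 * force t)).
  - intros t Ht. rewrite tforce_id; [easy|]. apply Hin. lra.
  - apply (is_RInt_derive potential).
    + intros t Ht. apply potential_derive. specialize (Hin t Ht). lra.
    + intros t Ht. specialize (Hin t Ht). apply continuity_pt_filterlim.
      unfold force. apply is_derive_continuity_pt with
        (- (2 * (- 1 / t ^ 2 - 2 * (1 - t) / t ^ 3))).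
      auto_derive; [nra|]. field. lra.
Qed.

(** Sublevel sets of the truncated potential do not see the truncation. *)
Lemma tpotential_confines (e x : R) :
  e < potential a -> e < potential b -> tpotential x <= e - potential 1 -> a < x < b.
Proof.
  intros Hea Heb Hx. split; apply Rnot_le_lt; intros Hn.
  - assert (h : tpotential a <= tpotential x).
    { apply (nonincreasing_of_derive tpotential (fun x => - (2 * tforce x))).
      - easy.
      - apply continuity_pt_right, (is_derive_continuity_pt _ _ _ (tpotential_derive x)).
      - intros; apply tpotential_derive.
      - intros y Hy. unfold tforce, force, clamp.
        rewrite Rmin_right, Rmax_left by lra.
        assert (0 < (1 - a) / a ^ 2) by (apply Rdiv_lt_0_compat; nra). lra. }
    rewrite tpotential_potential in h by lra. lra.
  - assert (h : - tpotential x <= - tpotential b).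
    { apply (nonincreasing_of_derive (fun x => - tpotential x)
               (fun x => 2 * tforce x)).
      - easy.
      - apply continuity_pt_right, (continuity_pt_opp tpotential).
        apply (is_derive_continuity_pt _ _ _ (tpotential_derive b)).
      - intros y Hy. eapply is_derive_value;
          [apply derive_opp, tpotential_derive|]. ring.
      - intros y Hy. unfold tforce, force, clamp.
        rewrite Rmin_left, Rmax_right by lra.
        assert (0 < (b - 1) / b ^ 2) by (apply Rdiv_lt_0_compat; nra).
        replace ((1 - b) / b ^ 2) with (- ((b - 1) / b ^ 2)) by (field; lra). lra. }
    rewrite (tpotential_potential b) in h by lra. lra.
Qed.

End Truncated.

Lemma derive_pos_part_sqr (x : R) :
  is_derive (fun y => Rmax y 0 ^ 2) x (2 * Rmax x 0).
Proof.
  apply is_derive_Reals. intros e He. exists (mkposreal e He). intros h Hh Hhe.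
  simpl in Hhe.
  replace ((Rmax (x + h) 0 ^ 2 - Rmax x 0 ^ 2) / h - 2 * Rmax x 0) with
    ((Rmax (x + h) 0 ^ 2 - Rmax x 0 ^ 2 - 2 * Rmax x 0 * h) / h) by (field; easy).
  unfold Rdiv. rewrite Rabs_mult, Rabs_inv.
  assert (Hh' := Rabs_pos_lt h Hh).
  apply Rle_lt_trans with (Rabs h ^ 2 * / Rabs h); 
    [|replace (Rabs h ^ 2 * / Rabs h) with (Rabs h) by (field; lra); easy].
  apply Rmult_le_compat_r; [apply Rlt_le, Rinv_0_lt_compat; easy|].
  rewrite pow2_abs. apply Rabs_le.
  unfold Rmax. destruct (Rle_dec (x + h) 0), (Rle_dec x 0); nra.
Qed.

(** The square of the positive part of [u] is differentiable, and it does not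
    increase. *)
Lemma barrier (u u' : R -> R) : u 0 <= 0 -> (forall x, is_derive u x (u' x)) ->
  (forall x, 0 < x -> 0 < u x -> u' x <= 0) -> forall x, 0 <= x -> u x <= 0.
Proof.
  intros H0 Hd Hn x Hx.
  assert (Hs : forall y, is_derive (fun y => Rmax (u y) 0 ^ 2) y
                 (2 * Rmax (u y) 0 * u' y)).
  { intros y. apply (derive_chain (fun y => Rmax y 0 ^ 2) u); [|easy].
    apply derive_pos_part_sqr. }
  assert (h : Rmax (u x) 0 ^ 2 <= Rmax (u 0) 0 ^ 2).
  { apply (nonincreasing_of_derive (fun y => Rmax (u y) 0 ^ 2) _ 0 x Hx) with
      (2 := fun y _ => Hs y).
    - apply continuity_pt_right, (is_derive_continuity_pt _ _ _ (Hs 0)).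
    - intros y Hy. specialize (Hn y ltac:(lra)). unfold Rmax.
      destruct Rle_dec; nra. }
  rewrite (Rmax_right (u 0)) in h by easy. unfold Rmax in h.
  destruct Rle_dec; nra.
Qed.

Lemma avg_0_at_0 m : avg 0 m 0 = m 0.
Proof.
  unfold avg. rewrite (RInt_ext _ (fun _ => m 0)).
  - rewrite RInt_const. unfold scal; simpl; unfold mult; simpl. ring.
  - intros t _. rewrite Rmult_0_r. apply Rmult_1_l.
Qed.

(** [z(r) = phi(r^2)] solves the profile equation iff [psi = phi'] solves the
    equation below, which is regular in [x = r^2] up to the factor [x] on the
    left.  Note that it extends to small negative [x]. *)
Definition entire_solution (z0 c : R) (phi psi : R -> R) : Prop :=
  (forall n, Ck1 n (fun x => c < x) phi) /\ (forall n, Ck1 n (fun x => c < x) psi) /\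
  phi 0 = z0 /\
  (forall x, c < x -> is_derive phi x (psi x)) /\
  (forall x, c < x -> 0 < phi x) /\
  (forall x, c < x -> x * Derive psi x =
     force (phi x) / 2 - psi x + 2 * x * psi x ^ 2 * (force (phi x) - psi x)).

(** ** Existence *)

Definition tsource (a b : R) (phi psi : R -> R) (s : R) : R :=
  tforce a b (phi s) / 2 + s * tdamp a b (phi s) (psi s).

Lemma everything_open : open1 (fun _ => True).
Proof. intros u v _. now apply locally_2d_forall. Qed.

Lemma truncated_solution (a b z0 : R) : 0 < a -> a < 1 -> 1 < b ->
  exists phi psi, continuity psi /\ phi 0 = z0 /\
    (forall x, is_derive phi x (psi x)) /\
    (forall x, continuity_pt (tsource a b phi psi) x) /\
    (forall x, psi x = avg 0 (tsource a b phi psi) x) /\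
    forall x, is_derive (fun s => s * psi s) x (tsource a b phi psi x).
Proof.
  intros Ha Ha1 Hb1. set (M := tbound a).
  set (L := tlip a + 2 * M ^ 2 * tlip a + 10 * M ^ 2).
  assert (HtL : lipschitz2 L (tdamp a b)) by now apply tdamp_lipschitz.
  destruct (singular_ivp (fun x => tforce a b x / 2) (tdamp a b) L z0) as [psi [Hc Heq]].
  { intros x x'. replace (tforce a b x / 2 - tforce a b x' / 2) with
      ((tforce a b x - tforce a b x') / 2) by field.
    unfold Rdiv. rewrite Rabs_mult, (Rabs_pos_eq (/ 2)) by lra.
    assert (h := tforce_lipschitz a b Ha Ha1 Hb1 x x').
    assert (h1 := tlip_pos a Ha). assert (h2 := Rabs_pos (x - x')). unfold L.
    assert (0 <= M ^ 2 * Rabs (x - x')) by nra. nra. }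
  { exact HtL. }
  set (phi := fun s => z0 + s * avg 0 psi s) in *.
  change (forall s, avg 0 (tsource a b phi psi) s = psi s) in Heq.
  assert (Hstar : star (fun _ => True)) by easy. assert (HO := everything_open).
  assert (Hmean : forall m x, (forall y, continuity_pt m y) ->
    is_derive (fun s => s * avg 0 m s) x (m x)).
  { intros m x Hm. apply derive_ext with (fun y => y ^ 1 * avg 0 m y);
      [intros; now rewrite pow_1|].
    eapply is_derive_value; [apply (avg_moment (fun _ => True)); auto|]. simpl. ring. }
  assert (Hphi : forall x, is_derive phi x (psi x)).
  { intros x. unfold phi. eapply is_derive_value.
    - apply (derive_add (fun _ => z0)); [apply derive_const|now apply Hmean].
    - ring. }
  assert (Hkc : forall x, continuity_pt (tsource a b phi psi) x).
  { intros x. assert (Hphic : continuity phi).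
    { intros y. apply (is_derive_continuity_pt _ _ _ (Hphi y)). }
    unfold tsource. cont.
    - apply (continuity_pt_comp phi (tforce a b)); [easy|]. now apply tforce_continuity.
    - now apply (lipschitz2_continuity L (tdamp a b) phi psi). }
  exists phi, psi. split; [easy|]. split; [unfold phi; ring|]. split; [easy|].
  split; [easy|]. split; [now intros; rewrite Heq|].
  intros x. apply derive_ext with (fun s => s * avg 0 (tsource a b phi psi) s);
    [intros; now rewrite Heq|]. now apply Hmean.
Qed.

Section Estimates.
Variables a b z0 : R.
Hypotheses (Ha : 0 < a) (Ha1 : a < 1) (Hb1 : 1 < b).
Variables phi psi : R -> R.
Hypotheses (Hc : continuity psi) (H0 : phi 0 = z0)
  (Hphi : forall x, is_derive phi x (psi x))
  (Hspsi : forall x, is_derive (fun s => s * psi s) x (tsource a b phi psi x)).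

Let M := tbound a.
Let G := tforce a b.
Let k := tsource a b phi psi.

Lemma tsource_untruncated x : - M <= psi x <= M ->
  k x = G (phi x) / 2 + x * (2 * psi x ^ 2 * (G (phi x) - psi x)).
Proof.
  intros Hx. unfold k, tsource, tdamp. fold M. now rewrite clamp_id.
Qed.

Lemma psi_derive x : x <> 0 -> is_derive psi x ((k x - psi x) / x).
Proof.
  intros Hx. apply (derive_ext_near (fun s => s * psi s * / s) psi x _ (Rabs x)).
  - now apply Rabs_pos_lt.
  - intros y Hy. assert (y <> 0).
    { intros ->. unfold Rminus in Hy. rewrite Rplus_0_l, Rabs_Ropp in Hy. lra. }
    field. easy.
  - eapply is_derive_value.
    { apply (derive_mul (fun s => s * psi s) (fun s => / s)); [apply Hspsi|].
      apply (derive_inv (fun y => y)); [apply derive_id|easy]. }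
    unfold k. field. easy.
Qed.

(** [x (psi - M)] decreases where [psi > M], and symmetrically. *)
Lemma psi_bounded x : psi 0 = G z0 / 2 -> 0 <= x -> - M <= psi x <= M.
Proof.
  intros Hpsi0 Hx. assert (HM : 0 < M) by now apply tbound_pos.
  assert (HG : forall x, - M <= G x <= M).
  { intros y. now apply Rabs_le_inv, tforce_bound. }
  destruct (Req_dec x 0) as [->|Hx0]; [specialize (HG z0); lra|].
  assert (h1 : x * psi x - M * x <= 0).
  { apply (barrier (fun x => x * psi x - M * x) (fun x => k x - M)); try lra.
    - intros y. apply derive_sub; [apply Hspsi|]. derive; ring.
    - intros y Hy Hu. assert (Hpy : M < psi y) by nra.
      unfold k, tsource, tdamp. fold M. unfold clamp. rewrite Rmin_left, Rmax_right by lra.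
      fold (G (phi y)). specialize (HG (phi y)).
      assert (y * (2 * M ^ 2 * (G (phi y) - M)) <= 0).
      { assert (0 <= y * M ^ 2) by nra. nra. }
      lra. }
  assert (h2 : - (x * psi x) - M * x <= 0).
  { apply (barrier (fun x => - (x * psi x) - M * x) (fun x => - k x - M)); try lra.
    - intros y. apply derive_sub; [apply derive_opp, Hspsi|]. derive; ring.
    - intros y Hy Hu. assert (Hpy : psi y < - M) by nra.
      unfold k, tsource, tdamp. fold M. unfold clamp. rewrite Rmin_right, Rmax_left by lra.
      fold (G (phi y)). specialize (HG (phi y)).
      assert (0 <= y * (2 * (- M) ^ 2 * (G (phi y) - - M))).
      { assert (0 <= y * M ^ 2) by nra. nra. }
      lra. }
  split; nra.
Qed.

(** The energy [ln (1 + z'^2) / 2 + potential z] of the profile, in the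
    variable [x = r^2], where [z'^2 = 4 x psi^2].  It decreases because of the
    friction term. *)
Lemma energy_bound x : (forall y, 0 <= y -> - M <= psi y <= M) -> 0 <= x ->
  ln (1 + 4 * x * psi x ^ 2) / 2 + tpotential a b (phi x) <= tpotential a b z0.
Proof.
  intros Hb Hx. set (W := tpotential a b).
  set (E := fun x => ln (1 + 4 * x * psi x ^ 2) / 2 + W (phi x)).
  assert (h : E x <= E 0).
  { apply (nonincreasing_of_derive E (fun x => - 2 * psi x ^ 2) 0 x Hx).
    - apply continuity_pt_right. unfold E. cont.
      + apply (continuity_pt_comp (fun x => 1 + 4 * x * psi x ^ 2) ln); [now cont|].
        rewrite Rmult_0_r, Rmult_0_l, Rplus_0_r.
        apply derivable_continuous_pt. exists (/ 1). apply derivable_pt_lim_ln. lra.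
      + apply (is_derive_continuity_pt _ _ (- (2 * G (phi 0)) * psi 0)).
        apply (derive_chain W phi); [now apply tpotential_derive|easy].
    - intros y Hy. assert (0 <= y * psi y ^ 2).
      { apply Rmult_le_pos; [lra|apply pow2_ge_0]. }
      unfold E. derive.
      + apply (derive_chain ln (fun x => 1 + 4 * x * psi x ^ 2)).
        * apply is_derive_ln. lra.
        * derive_step. apply psi_derive. lra.
      + apply (derive_chain W phi); [now apply tpotential_derive|easy].
      + rewrite tsource_untruncated by (apply Hb; lra). unfold G. simpl. field. split; nra.
    - intros y Hy. assert (h := pow2_ge_0 (psi y)). lra. }
  unfold E in h. rewrite Rmult_0_r, Rmult_0_l, Rplus_0_r, ln_1, H0 in h. lra.
Qed.

End Estimates.

(** A solution of the averaged equation gains one derivative at a time. *)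
Lemma averaged_solution_smooth (I : R -> Prop) (phi psi : R -> R) : open1 I -> star I ->
  continuity psi -> (forall x, is_derive phi x (psi x)) -> (forall x, I x -> phi x <> 0) ->
  (forall x, I x -> psi x =
     avg 0 (fun s => force (phi s) / 2 + s * (2 * psi s ^ 2 * (force (phi s) - psi s))) x) ->
  forall n, Ck1 n I psi.
Proof.
  intros HI HIs Hc Hphi Hphip Heq.
  set (F := fun s => / phi s * / phi s - / phi s).
  set (A := fun s => / 2 * F s). set (m := fun s => 2 * (psi s * psi s) * (F s - psi s)).
  assert (Hphic : forall x, continuity_pt phi x).
  { intros x. apply (is_derive_continuity_pt _ _ _ (Hphi x)). }
  assert (HFc : forall y, I y -> continuity_pt F y).
  { intros y Hy. unfold F. cont. }
  assert (Hdec : forall x, I x -> psi x = avg 0 A x + x * avg 1 m x).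
  { intros x Hx. rewrite Heq by easy.
    assert (H1 := avg_integrable I 0 A x HIs).
    assert (H2 := avg_integrable I 1 m x HIs).
    apply is_RInt_unique.
    apply is_RInt_ext with (fun t => plus (t ^ 0 * A (t * x)) (scal x (t ^ 1 * m (t * x)))).
    - rewrite Rmin_left, Rmax_right by lra. intros t Ht.
      assert (h := Hphip (t * x) (HIs x t Hx ltac:(lra))).
      unfold plus, scal; simpl; unfold mult; simpl. unfold A, m, F, force. field. easy.
    - apply (is_RInt_plus (fun t => t ^ 0 * A (t * x))).
      + apply (@RInt_correct R_CompleteNormedModule), H1; [|easy].
        intros y Hy. unfold A. cont.
      + apply (is_RInt_scal (fun t => t ^ 1 * m (t * x))).
        apply (@RInt_correct R_CompleteNormedModule), H2; [|easy].
        intros y Hy. unfold m. cont. }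
  induction n as [|n IH].
  - apply Ck1_zero. intros; apply Hc.
  - assert (Hph : Ck1 (S n) I phi) by (apply (Ck1_succ n I phi psi); auto).
    assert (HF : Ck1 (S n) I F).
    { assert (Hi : Ck (S n) (fun u _ => I u) (fun u _ => / phi u)) by (apply Ck_inv; auto).
      apply (Ck_minus (S n)); [easy|now apply (Ck_mul (S n))|exact Hi]. }
    assert (Hm : Ck1 n I m).
    { apply (Ck_mul n (fun u _ => I u) (fun s _ => 2 * (psi s * psi s))
        (fun s _ => F s - psi s)).
      - apply (Ck_mul n); [apply Ck_const|now apply Ck_mul].
      - apply (Ck_minus n); [easy|now apply (Ck_pred n)|exact IH]. }
    apply (Ck_ext (S n) _ (fun u _ => avg 0 A u + u * avg 1 m u)); [easy| |].
    + intros u _ Hu. now rewrite Hdec.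
    + apply (Ck_add (S n)).
      * apply Ck1_avg; [easy|easy|]. now apply (Ck_mul (S n)); [apply Ck_const|].
      * apply (Ck1_succ n I (fun y => y * avg 1 m y) (fun y => m y - avg 1 m y)).
        -- intros x Hx. apply (avg_gain_derive I); auto.
           intros y Hy. now apply (Ck1_continuity n I).
        -- apply (Ck_minus n); [easy|exact Hm|now apply Ck1_avg].
Qed.

(** The truncation levels are chosen beyond the sublevel set of the initial
    energy, so the solution of the truncated problem never reaches them. *)
Lemma entire_solution_exists (z0 : R) : 0 < z0 ->
  exists c phi psi B, c < 0 /\ entire_solution z0 c phi psi /\
    forall x, 0 <= x -> / B < phi x < B /\ 4 * x * psi x ^ 2 <= B ^ 2.
Proof.
  intros Hz0. set (V := potential z0).
  assert (HV : 2 <= V) by now apply potential_ge_2.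
  set (a := / (V + 1)). set (b := exp V).
  assert (Ha : 0 < a) by (apply Rinv_0_lt_compat; lra).
  assert (HVb : V + 1 <= b) by (unfold b; assert (h := exp_ineq1_le V); lra).
  assert (Ha1 : a < 1).
  { unfold a. rewrite <- Rinv_1. apply Rinv_1_lt_contravar; lra. }
  assert (Hb1 : 1 < b) by lra.
  assert (HVa : V < potential a).
  { apply Rlt_le_trans with (/ a); [|now apply potential_ge_inv].
    unfold a. rewrite Rinv_inv. lra. }
  assert (HVb' : V < potential b).
  { unfold potential, b. rewrite ln_exp.
    assert (0 < 2 / exp V) by (apply Rdiv_lt_0_compat; [lra|apply exp_pos]). lra. }
  assert (Haz : a < z0 < b).
  { split.
    - unfold a. rewrite <- (Rinv_inv z0). apply Rinv_0_lt_contravar.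
      + now apply Rinv_0_lt_compat.
      + assert (h := potential_ge_inv z0 Hz0). unfold V. lra.
    - unfold b. rewrite <- (exp_ln z0) at 1 by easy. apply exp_increasing.
      unfold V, potential. assert (0 < 2 / z0) by (apply Rdiv_lt_0_compat; lra).
      destruct (Rle_dec (ln z0) 0); [unfold V, potential in HV; lra|lra]. }
  set (M := tbound a). set (W := tpotential a b).
  assert (HM : 0 < M) by now apply tbound_pos.
  destruct (truncated_solution a b z0 Ha Ha1 Hb1)
    as [phi [psi [Hc [Hphi0 [Hphi [Hkc [Heq Hspsi]]]]]]].
  assert (Hpsi0 : psi 0 = tforce a b z0 / 2).
  { rewrite Heq, avg_0_at_0. unfold tsource. rewrite Hphi0. ring. }
  assert (Hup : forall x, 0 <= x -> - M <= psi x <= M).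
  { intros x Hx. now apply (psi_bounded a b z0 Ha Ha1 Hb1 phi psi Hspsi). }
  assert (HEn : forall x, 0 <= x ->
    ln (1 + 4 * x * psi x ^ 2) / 2 + W (phi x) <= V - 2).
  { intros x Hx. replace (V - 2) with (tpotential a b z0)
      by (rewrite tpotential_potential, potential_1 by lra; easy).
    now apply (energy_bound a b z0 Ha Ha1 Hb1 phi psi Hc Hphi0 Hphi Hspsi). }
  assert (Hpos : forall x, 0 <= x -> 0 <= 4 * x * psi x ^ 2).
  { intros x Hx. nra. }
  assert (Hin : forall x, 0 <= x -> a < phi x < b).
  { intros x Hx. apply (tpotential_confines a b Ha Ha1 Hb1 V); [easy|easy|].
    rewrite potential_1. specialize (HEn x Hx). fold W.
    assert (0 <= ln (1 + 4 * x * psi x ^ 2)).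
    { rewrite <- ln_1. apply ln_le; [lra|]. specialize (Hpos x Hx). lra. }
    lra. }
  assert (Hp : forall x, 0 <= x -> 4 * x * psi x ^ 2 <= b ^ 2).
  { intros x Hx. specialize (HEn x Hx). specialize (Hin x Hx). specialize (Hpos x Hx).
    assert (0 <= W (phi x)).
    { unfold W. rewrite tpotential_potential by lra. rewrite potential_1.
      assert (h := potential_ge_2 (phi x) ltac:(lra)). lra. }
    replace (b ^ 2) with (exp (2 * V)).
    2:{ unfold b. simpl. rewrite Rmult_1_r, <- exp_plus. f_equal. ring. }
    apply Rle_trans with (1 + 4 * x * psi x ^ 2); [lra|].
    rewrite <- (exp_ln (1 + 4 * x * psi x ^ 2)) by lra.
    apply Rlt_le, exp_increasing. lra. }
  (* by continuity the truncation remains inactive slightly to the left of 0 *)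
  assert (Hcc : exists c, c < 0 /\ forall x, c < x -> a < phi x < b /\ - M <= psi x <= M).
  { destruct (proj1 (continuity_pt_eps _ _) (is_derive_continuity_pt _ _ _ (Hphi 0))
      (Rmin (z0 - a) (b - z0))) as [d1 [Hd1 H1]]; [apply Rmin_pos; lra|].
    destruct (proj1 (continuity_pt_eps _ _) (Hc 0) (M / 2)) as [d2 [Hd2 H2]]; [lra|].
    exists (- Rmin d1 d2). split; [assert (h := Rmin_pos _ _ Hd1 Hd2); lra|].
    intros x Hx. destruct (Rle_dec 0 x) as [h|h]; [now auto|].
    rmin d1 d2. rmin (z0 - a) (b - z0).
    specialize (H1 x ltac:(rewrite Rminus_0_r, Rabs_left; lra)).
    specialize (H2 x ltac:(rewrite Rminus_0_r, Rabs_left; lra)).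
    rewrite Hphi0 in H1. rewrite Hpsi0 in H2. apply Rabs_def2 in H1, H2.
    assert (h5 := Rabs_le_inv _ _ (tforce_bound a b Ha Ha1 Hb1 z0)). fold M in h5. lra. }
  destruct Hcc as [c [Hc0 Hcc]].
  exists c, phi, psi, b. split; [easy|].
  assert (HI : open1 (fun x => c < x)).
  { intros u v Hu. exists (mkposreal (u - c) ltac:(lra)).
    intros x y Hx _. simpl in Hx. apply Rabs_def2 in Hx. lra. }
  assert (HIs : star (fun x => c < x)).
  { intros x t Hx Ht. destruct (Rle_dec 0 x); nra. }
  assert (Hk : forall x, c < x -> tsource a b phi psi x =
    force (phi x) / 2 + x * (2 * psi x ^ 2 * (force (phi x) - psi x))).
  { intros x Hx. destruct (Hcc x Hx) as [h1 h2].
    rewrite (tsource_untruncated a b phi psi x h2), tforce_id by lra. easy. }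
  assert (Hsm : forall n, Ck1 n (fun x => c < x) psi).
  { apply (averaged_solution_smooth _ phi psi HI HIs Hc Hphi).
    - intros x Hx. destruct (Hcc x Hx). lra.
    - intros x Hx. rewrite Heq. apply RInt_ext.
      rewrite Rmin_left, Rmax_right by lra. intros t Ht.
      now rewrite Hk by (apply HIs; [easy|lra]). }
  split.
  - split; [|split; [exact Hsm|split; [easy|split; [auto|split]]]].
    + intros [|n]; [|now apply (Ck1_succ n _ phi psi); auto].
      apply Ck1_zero. intros x _. apply (is_derive_continuity_pt _ _ _ (Hphi x)).
    + intros x Hx. destruct (Hcc x Hx). lra.
    + intros x Hx.
      assert (Hd : tsource a b phi psi x = psi x + x * Derive psi x).
      { rewrite <- (is_derive_unique _ _ _ (Hspsi x)). apply is_derive_unique.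
        derive; [now apply (Ck1_derive 0 _ psi HI (Hsm 1%nat))|ring]. }
      rewrite Hk in Hd by easy. lra.
  - intros x Hx. split; [|now apply Hp]. destruct (Hin x Hx) as [h1 h2]. split; [|easy].
    apply Rle_lt_trans with a; [|easy]. unfold a.
    apply Rinv_le_contravar; [lra|easy].
Qed.

(** * Uniqueness of the profile *)

Definition profile_rhs (r z p : R) : R := (1 + p ^ 2) * (2 * force z - p / r).

Lemma force_lipschitz (m x y : R) : 0 < m -> m <= x -> m <= y ->
  Rabs (force x - force y) <= (/ m) ^ 2 * (2 / m + 1) * Rabs (x - y).
Proof.
  intros Hm Hx Hy. rewrite !force_inv by lra.
  replace ((/ x) ^ 2 - / x - ((/ y) ^ 2 - / y)) with
    ((/ x * / y) * (1 - / x - / y) * (x - y)) by (field; lra).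
  assert (hx : 0 < / x <= / m).
  { split; [apply Rinv_0_lt_compat; lra|apply Rinv_le_contravar; lra]. }
  assert (hy : 0 < / y <= / m).
  { split; [apply Rinv_0_lt_compat; lra|apply Rinv_le_contravar; lra]. }
  rewrite !Rabs_mult, (Rabs_pos_eq (/ x)), (Rabs_pos_eq (/ y)) by lra.
  apply Rmult_le_compat_r; [apply Rabs_pos|].
  apply Rmult_le_compat; [nra|apply Rabs_pos|simpl; nra|].
  apply Rabs_le. unfold Rdiv. lra.
Qed.

Lemma force_bound (m x : R) : 0 < m -> m <= x -> Rabs (force x) <= (/ m) ^ 2 + / m.
Proof.
  intros Hm Hx. rewrite force_inv by lra.
  assert (hx : 0 < / x <= / m).
  { split; [apply Rinv_0_lt_compat; lra|apply Rinv_le_contravar; lra]. }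
  apply Rabs_le. simpl. nra.
Qed.

(** Two solutions with the same initial data, possibly at the singular radius
    0, agree: the singular terms contribute
    [-(p - q) (p (1 + p^2) - q (1 + q^2)) / r <= 0] to the derivative of
    [(z - w)^2 + (p - q)^2], because [p (1 + p^2)] is increasing. *)
Lemma profile_ode_unique (z p w q : R -> R) (r1 r2 : R) :
  0 <= r1 <= r2 ->
  right_continuous z r1 -> right_continuous p r1 ->
  right_continuous w r1 -> right_continuous q r1 ->
  (forall r, r1 < r <= r2 -> is_derive z r (p r)) ->
  (forall r, r1 < r <= r2 -> is_derive p r (profile_rhs r (z r) (p r))) ->
  (forall r, r1 < r <= r2 -> is_derive w r (q r)) ->
  (forall r, r1 < r <= r2 -> is_derive q r (profile_rhs r (w r) (q r))) ->
  (forall r, r1 <= r <= r2 -> 0 < z r) -> (forall r, r1 <= r <= r2 -> 0 < w r) ->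
  z r1 = w r1 -> p r1 = q r1 -> z r2 = w r2.
Proof.
  intros Hr Cz Cp Cw Cq Dz Dp Dw Dq Pz Pw E1 E2.
  assert (B : forall f df, right_continuous f r1 ->
    (forall r, r1 < r <= r2 -> is_derive f r (df r)) ->
    exists lo hi, forall x, r1 <= x <= r2 -> f lo <= f x <= f hi /\
      r1 <= lo <= r2 /\ r1 <= hi <= r2).
  { intros f df Hf Hd. apply right_continuous_bounds; [lra|easy|].
    intros x Hx. apply (is_derive_continuity_pt f x (df x)); auto. }
  destruct (B z _ Cz Dz) as [zl [zh Bz]]. destruct (B w _ Cw Dw) as [wl [wh Bw]].
  destruct (B p _ Cp Dp) as [pl [ph Bp]]. destruct (B q _ Cq Dq) as [ql [qh Bq]].
  set (m := Rmin (z zl) (w wl)).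
  assert (Hm : 0 < m).
  { apply Rmin_pos; [apply Pz|apply Pw]; [apply (Bz r1)|apply (Bw r1)]; lra. }
  assert (Mz : forall r, r1 <= r <= r2 -> m <= z r).
  { intros r Hr'. apply Rle_trans with (z zl); [apply Rmin_l|]. now apply Bz. }
  assert (Mw : forall r, r1 <= r <= r2 -> m <= w r).
  { intros r Hr'. apply Rle_trans with (w wl); [apply Rmin_r|]. now apply Bw. }
  set (K := Rabs (p pl) + Rabs (p ph) + Rabs (q ql) + Rabs (q qh)).
  assert (Kp : forall r, r1 <= r <= r2 -> Rabs (p r) <= K).
  { intros r Hr'. destruct (Bp r Hr') as [h _]. unfold K.
    assert (h1 := Rabs_pos (p pl)). assert (h2 := Rabs_pos (p ph)).
    assert (h3 := Rabs_pos (q ql)). assert (h4 := Rabs_pos (q qh)).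
    assert (h5 := Rle_abs (p ph)). assert (h6 := Rle_abs (- p pl)).
    rewrite Rabs_Ropp in h6. apply Rabs_le. lra. }
  assert (Kq : forall r, r1 <= r <= r2 -> Rabs (q r) <= K).
  { intros r Hr'. destruct (Bq r Hr') as [h _]. unfold K.
    assert (h1 := Rabs_pos (p pl)). assert (h2 := Rabs_pos (p ph)).
    assert (h3 := Rabs_pos (q ql)). assert (h4 := Rabs_pos (q qh)).
    assert (h5 := Rle_abs (q qh)). assert (h6 := Rle_abs (- q ql)).
    rewrite Rabs_Ropp in h6. apply Rabs_le. lra. }
  assert (HK : 0 <= K) by (eapply Rle_trans; [apply Rabs_pos|apply (Kp r1); lra]).
  set (G := (/ m) ^ 2 + / m). set (L := (/ m) ^ 2 * (2 / m + 1)).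
  assert (Him := Rinv_0_lt_compat m Hm).
  assert (HG : 0 <= G) by (unfold G; simpl; nra).
  assert (HL : 0 <= L) by (unfold L, Rdiv; simpl; nra).
  set (Q := fun r => (z r - w r) ^ 2 + (p r - q r) ^ 2).
  set (C := 1 + 2 * (1 + K ^ 2) * L + 8 * K * G).
  assert (HQ : Q r2 <= 0).
  { apply (gronwall_zero Q (fun r => 2 * (z r - w r) * (p r - q r) +
      2 * (p r - q r) * (profile_rhs r (z r) (p r) - profile_rhs r (w r) (q r)))
      C r1 r2); [lra| | | |].
    - apply right_continuous_clamp. apply right_continuous_clamp in Cz, Cp, Cw, Cq.
      unfold Q. cont.
    - intros r Hr'. unfold Q. derive; auto. simpl. ring.
    - intros r Hr'. unfold Q, profile_rhs.
      assert (h1 := force_lipschitz m (z r) (w r) Hm (Mz r ltac:(lra)) (Mw r ltac:(lra))).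
      assert (h2 := force_bound m (w r) Hm (Mw r ltac:(lra))).
      fold L in h1. fold G in h2.
      assert (h3 := Kp r ltac:(lra)). assert (h4 := Kq r ltac:(lra)).
      set (d := z r - w r) in *. set (e := p r - q r) in *.
      set (gz := force (z r)) in *. set (gw := force (w r)) in *.
      set (x := p r) in *. set (y := q r) in *.
      replace (2 * d * e + 2 * e * ((1 + x ^ 2) * (2 * gz - x / r)
                - (1 + y ^ 2) * (2 * gw - y / r))) with
        (2 * d * e + 4 * (1 + x ^ 2) * (e * (gz - gw)) + 4 * ((x + y) * gw) * e ^ 2
           - 2 * (e ^ 2 * (1 + x ^ 2 + x * y + y ^ 2)) * / r)
        by (unfold e; field; lra).
      assert (h5 : 0 <= 2 * (e ^ 2 * (1 + x ^ 2 + x * y + y ^ 2)) * / r).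
      { apply Rmult_le_pos; [|apply Rlt_le, Rinv_0_lt_compat; lra].
        assert (0 <= 1 + x ^ 2 + x * y + y ^ 2) by nra. nra. }
      assert (h6 : (x + y) * gw <= 2 * K * G).
      { apply Rle_trans with (1 := Rle_abs _). rewrite Rabs_mult.
        apply Rmult_le_compat; auto using Rabs_pos.
        apply Rle_trans with (1 := Rabs_triang _ _). lra. }
      assert (h7 : e * (gz - gw) <= L * ((d ^ 2 + e ^ 2) / 2)).
      { apply Rle_trans with (1 := Rle_abs _). rewrite Rabs_mult.
        apply Rle_trans with (Rabs e * (L * Rabs d)).
        - apply Rmult_le_compat_l; auto using Rabs_pos.
        - rewrite <- (pow2_abs d), <- (pow2_abs e).
          assert (0 <= (Rabs d - Rabs e) ^ 2) by apply pow2_ge_0. nra. }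
      assert (h8 : 1 + x ^ 2 <= 1 + K ^ 2).
      { rewrite <- (pow2_abs x). assert (h := Rabs_pos x). nra. }
      assert (h9 : (1 + x ^ 2) * (e * (gz - gw)) <= (1 + K ^ 2) * (L * ((d ^ 2 + e ^ 2) / 2))).
      { apply Rle_trans with ((1 + x ^ 2) * (L * ((d ^ 2 + e ^ 2) / 2))).
        - apply Rmult_le_compat_l; [nra|easy].
        - apply Rmult_le_compat_r; [nra|easy]. }
      assert (h10 : (x + y) * gw * e ^ 2 <= 2 * K * G * (d ^ 2 + e ^ 2)).
      { assert (0 <= K * G) by nra.
        assert (0 <= K * G * d ^ 2) by (apply Rmult_le_pos; [easy|apply pow2_ge_0]).
        apply Rle_trans with (2 * K * G * e ^ 2); [|lra].
        apply Rmult_le_compat_r; [apply pow2_ge_0|easy]. }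
      assert (h11 : 2 * d * e <= d ^ 2 + e ^ 2).
      { assert (h := pow2_ge_0 (d - e)). lra. }
      unfold C. lra.
    - unfold Q. rewrite E1, E2. lra. }
  apply Rminus_diag_uniq. exact (sum_sqr_le_0 _ _ HQ).
Qed.

(** ** The maximal profile *)

Lemma derivative_on_right_continuous b f g :
  derivative_on b f g -> right_continuous f 0.
Proof.
  intros [H _] e He.
  destruct (H (fun y => Rabs (y - g 0) < 1)) as [d Hd].
  { exists (mkposreal 1 ltac:(lra)). intros y Hy. exact Hy. }
  set (M := Rabs (g 0) + 1).
  assert (HM : 0 < M) by (assert (h := Rabs_pos (g 0)); unfold M; lra).
  exists (Rmin d (e / M)). split.
  { apply Rmin_pos; [apply cond_pos|now apply Rdiv_lt_0_compat]. }
  intros x Hx. rmin d (e / M).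
  assert (Hq : Rabs ((f x - f 0) / x - g 0) < 1).
  { apply Hd; [|lra]. change (Rabs (x - 0) < d). rewrite Rminus_0_r, Rabs_pos_eq; lra. }
  assert (Hq' : Rabs ((f x - f 0) / x) < M).
  { assert (h := Rabs_triang_inv ((f x - f 0) / x) (g 0)). unfold M. lra. }
  replace (f x - f 0) with ((f x - f 0) / x * x) by (field; lra).
  rewrite Rabs_mult, (Rabs_pos_eq x) by lra.
  apply Rlt_le_trans with (M * (e / M)); [|right; field; lra].
  apply Rmult_le_0_lt_compat; try lra. apply Rabs_pos.
Qed.

Lemma derive_right_quotient (f : R -> R) l : is_derive f 0 l ->
  filterlim (fun r => (f r - f 0) / r) (at_right 0) (locally l).
Proof.
  intros H P [e He]. apply is_derive_Reals in H.
  destruct (H e (cond_pos e)) as [d Hd]. exists d. intros y Hy Hy0.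
  change (Rabs (y - 0) < d) in Hy. rewrite Rminus_0_r in Hy.
  apply He. specialize (Hd y ltac:(lra)). rewrite Rplus_0_l in Hd. now apply Hd.
Qed.

Lemma profile_solution_ode z0 b z : profile_solution z0 b z ->
  exists p, derivative_on b z p /\ right_continuous p 0 /\ z 0 = z0 /\ p 0 = 0 /\
    forall r, 0 < r -> Rbar_lt r b -> is_derive p r (profile_rhs r (z r) (p r)).
Proof.
  intros [_ [_ [p [z'' [H1 [H2 [H3 [H4 H5]]]]]]]]. exists p.
  split; [easy|]. split; [now apply derivative_on_right_continuous with b z''|].
  split; [easy|]. split; [easy|].
  intros r Hr Hrb. eapply is_derive_value; [now apply H2|].
  specialize (H5 r Hr Hrb). unfold profile_rhs, force.
  assert (0 < 1 + p r ^ 2) by nra.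
  replace (2 * ((1 - z r) / z r ^ 2)) with (z'' r / (1 + p r ^ 2) + p r / r).
  field. split; lra.
Qed.

(** At [r = 0] the uniqueness statement only asks for continuity from the right
    of [z] and [z'], which the one-sided derivatives provide. *)
Lemma profile_solution_unique z0 b c z w :
  profile_solution z0 b z -> profile_solution z0 c w -> Rbar_le b c -> agree_on b z w.
Proof.
  intros Hz Hw Hbc r Hr Hrb.
  assert (Hlt : forall s, s <= r -> Rbar_lt s b /\ Rbar_lt s c).
  { intros s Hs. split.
    - apply Rbar_le_lt_trans with r; easy.
    - apply Rbar_lt_le_trans with b; [apply Rbar_le_lt_trans with r; easy|easy]. }
  destruct (profile_solution_ode _ _ _ Hz) as [p [Z1 [Z2 [Z3 [Z4 Z5]]]]].
  destruct (profile_solution_ode _ _ _ Hw) as [q [W1 [W2 [W3 [W4 W5]]]]].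
  apply (profile_ode_unique z p w q 0 r); try easy.
  - now apply derivative_on_right_continuous with b p.
  - now apply derivative_on_right_continuous with c q.
  - intros s Hs. apply Z1; [lra|]. now apply Hlt.
  - intros s Hs. apply Z5; [lra|]. now apply Hlt.
  - intros s Hs. apply W1; [lra|]. now apply Hlt.
  - intros s Hs. apply W5; [lra|]. now apply Hlt.
  - intros s Hs. apply Hz; [lra|]. now apply Hlt.
  - intros s Hs. apply Hw; [lra|]. now apply Hlt.
  - now rewrite Z3, W3.
  - now rewrite Z4, W4.
Qed.

Section Entire.
Variables (z0 c : R) (phi psi : R -> R).
Hypotheses (Hc : c < 0) (HE : entire_solution z0 c phi psi).

Let z (r : R) := phi (r ^ 2).
Let p (r : R) := 2 * r * psi (r ^ 2).

Lemma sqr_domain r : c < r ^ 2.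
Proof. assert (h := pow2_ge_0 r). lra. Qed.

Lemma open1_gt : open1 (fun x => c < x).
Proof.
  intros u v Hu. exists (mkposreal (u - c) ltac:(lra)).
  intros x y Hx _. simpl in Hx. apply Rabs_def2 in Hx. lra.
Qed.

Lemma derive_sqr_comp (f : R -> R) r l : is_derive f (r ^ 2) l ->
  is_derive (fun r => f (r ^ 2)) r (l * (2 * r)).
Proof.
  intros H. apply (derive_chain f (fun r => r ^ 2)); [easy|].
  auto_derive; [easy|ring].
Qed.

Lemma entire_derive_z r : is_derive z r (p r).
Proof.
  destruct HE as [_ [_ [_ [H _]]]].
  eapply is_derive_value; [apply derive_sqr_comp, H, sqr_domain|]. unfold p. ring.
Qed.

Lemma entire_derive_p r :
  is_derive p r (2 * psi (r ^ 2) + 4 * r ^ 2 * Derive psi (r ^ 2)).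
Proof.
  destruct HE as [_ [H _]].
  unfold p. derive.
  - apply derive_sqr_comp.
    apply (proj1 (Ck1_derive 0 _ psi open1_gt (H 1%nat))), sqr_domain.
  - ring.
Qed.

Lemma entire_rhs r : r <> 0 ->
  2 * psi (r ^ 2) + 4 * r ^ 2 * Derive psi (r ^ 2) = profile_rhs r (z r) (p r).
Proof.
  intros Hr. destruct HE as [_ [_ [_ [_ [_ H]]]]].
  specialize (H (r ^ 2) (sqr_domain r)).
  replace (4 * r ^ 2 * Derive psi (r ^ 2)) with (4 * (r ^ 2 * Derive psi (r ^ 2))) by ring.
  rewrite H. unfold profile_rhs, p. fold (z r). field. easy.
Qed.

Lemma entire_derive_p_rhs r : r <> 0 -> is_derive p r (profile_rhs r (z r) (p r)).
Proof.
  intros Hr. eapply is_derive_value; [apply entire_derive_p|]. now apply entire_rhs.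
Qed.

Lemma entire_psi_0 : psi 0 = force z0 / 2.
Proof.
  destruct HE as [_ [_ [H0 [_ [_ H]]]]]. specialize (H 0 Hc). rewrite H0 in H. lra.
Qed.

Lemma entire_derivative_on b : derivative_on b z p /\
  derivative_on b p (fun r => 2 * psi (r ^ 2) + 4 * r ^ 2 * Derive psi (r ^ 2)).
Proof.
  split; split.
  - apply derive_right_quotient, entire_derive_z.
  - intros; apply entire_derive_z.
  - apply (derive_right_quotient p), entire_derive_p.
  - intros; apply entire_derive_p.
Qed.

Lemma entire_z_pos r : 0 < z r.
Proof. apply HE, sqr_domain. Qed.

Lemma entire_z_0 : z 0 = z0.
Proof. unfold z. rewrite pow_i by lia. apply HE. Qed.

Lemma entire_profile_solution : profile_solution z0 p_infty z.
Proof.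
  split; [easy|]. split; [intros; apply entire_z_pos|].
  exists p, (fun r => 2 * psi (r ^ 2) + 4 * r ^ 2 * Derive psi (r ^ 2)).
  split; [apply entire_derivative_on|]. split; [apply entire_derivative_on|].
  split; [apply entire_z_0|]. split; [unfold p; ring|].
  intros r Hr _. rewrite entire_rhs by lra. unfold profile_rhs, force.
  assert (h := entire_z_pos r). assert (h' := pow2_ge_0 (p r)).
  field. repeat split; lra.
Qed.

Lemma entire_maximal : maximal_profile z0 p_infty z.
Proof.
  split; [apply entire_profile_solution|]. intros d w _ _. now destruct d.
Qed.

Lemma maximal_profile_entire b w : maximal_profile z0 b w ->
  b = p_infty /\ forall r, 0 <= r -> w r = z r.
Proof.
  intros [Hw Hmax].
  assert (Ha : agree_on b w z).
  { apply (profile_solution_unique z0 b p_infty); [easy|apply entire_profile_solution|now destruct b]. }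
  assert (Hb : b = p_infty).
  { specialize (Hmax p_infty z entire_profile_solution).
    assert (h : Rbar_le p_infty b).
    { apply Hmax. replace (Rbar_min b p_infty) with b by now destruct b. exact Ha. }
    now destruct b. }
  split; [easy|]. intros r Hr. apply Ha; [easy|]. now rewrite Hb.
Qed.

End Entire.

(** * Oscillation *)

Section Oscillation.
Variables (z p : R -> R) (B : R).
Hypotheses
  (Hz : forall r, 0 < r -> is_derive z r (p r))
  (Hp : forall r, 0 < r -> is_derive p r (profile_rhs r (z r) (p r)))
  (HzB : forall r, 0 < r -> / B < z r < B)
  (HpB : forall r, 0 < r -> p r ^ 2 <= B ^ 2)
  (HB : 1 < B).

(** If [z - 1] had no zero, the logarithmic derivative [- p / (z - 1)] would
    satisfy a Riccati inequality [v' >= k (1 + v^2)] and blow up in finite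
    time. *)
Lemma profile_crosses R0 : exists r, R0 < r /\ z r = 1.
Proof.
  apply NNPP. intros Hn.
  assert (Hne : forall r, R0 < r -> z r - 1 <> 0).
  { intros r Hr He. apply Hn. exists r. split; [easy|lra]. }
  set (k := / (2 * B ^ 2)).
  assert (Hk : 0 < k) by (apply Rinv_0_lt_compat; nra).
  set (r0 := Rmax (R0 + 1) ((1 + B ^ 2) * B)).
  assert (Hr0 : R0 < r0 /\ (1 + B ^ 2) * B <= r0).
  { assert (h1 := Rmax_l (R0 + 1) ((1 + B ^ 2) * B)).
    assert (h2 := Rmax_r (R0 + 1) ((1 + B ^ 2) * B)). unfold r0. lra. }
  assert (Hr00 : 1 < r0) by nra.
  set (v := fun r => - p r / (z r - 1)).
  set (dv := fun r => (1 + p r ^ 2) * (2 / z r ^ 2 - v r / r) + v r ^ 2).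
  assert (Hv : forall r, r0 <= r -> is_derive v r (dv r)).
  { intros r Hr. specialize (Hne r ltac:(lra)). specialize (HzB r ltac:(lra)).
    assert (0 < / B) by (apply Rinv_0_lt_compat; lra).
    unfold v. derive; [apply Hp; lra|apply Hz; lra|easy|].
    unfold dv, v, profile_rhs, force. field. repeat split; lra. }
  assert (Hric : forall r, r0 <= r -> k * (1 + v r ^ 2) <= dv r).
  { intros r Hr. unfold dv. destruct (HzB r ltac:(lra)) as [h1 h2].
    assert (h3 := HpB r ltac:(lra)).
    assert (hB : 0 < / B) by (apply Rinv_0_lt_compat; lra).
    assert (h4 : 2 / B ^ 2 <= 2 / z r ^ 2).
    { apply Rmult_le_compat_l; [lra|]. apply Rinv_le_contravar; [nra|].
      apply pow_incr; lra. }
    assert (h5 : (1 + p r ^ 2) * (v r / r) <= Rabs (v r) / B).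
    { apply Rle_trans with ((1 + B ^ 2) * (Rabs (v r) / r)).
      - apply Rle_trans with ((1 + p r ^ 2) * (Rabs (v r) / r)).
        + apply Rmult_le_compat_l; [assert (h := pow2_ge_0 (p r)); lra|].
          apply Rmult_le_compat_r; [apply Rlt_le, Rinv_0_lt_compat; lra|apply Rle_abs].
        + apply Rmult_le_compat_r; [|lra].
          apply Rmult_le_pos; [apply Rabs_pos|apply Rlt_le, Rinv_0_lt_compat; lra].
      - replace ((1 + B ^ 2) * (Rabs (v r) / r)) with (Rabs (v r) * ((1 + B ^ 2) / r))
          by (field; lra).
        apply Rmult_le_compat_l; [apply Rabs_pos|].
        apply Rmult_le_reg_r with (r * B); [nra|].
        replace ((1 + B ^ 2) / r * (r * B)) with ((1 + B ^ 2) * B) by (field; lra).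
        replace (/ B * (r * B)) with r by (field; lra). lra. }
    assert (h6 : Rabs (v r) / B <= v r ^ 2 / 2 + / B ^ 2 / 2).
    { rewrite <- (pow2_abs (v r)). replace (/ B ^ 2) with ((/ B) ^ 2) by (field; lra).
      assert (h := pow2_ge_0 (Rabs (v r) - / B)). unfold Rdiv. nra. }
    assert (h7 : 0 < / B ^ 2 <= 1).
    { split; [apply Rinv_0_lt_compat; nra|]. rewrite <- Rinv_1.
      apply Rinv_le_contravar; nra. }
    assert (h8 : k = / B ^ 2 / 2) by (unfold k; field; lra).
    assert (h9 := pow2_ge_0 (p r)).
    rewrite h8. unfold Rdiv in h4. assert (0 <= p r ^ 2 * (2 / z r ^ 2)).
    { apply Rmult_le_pos; [easy|]. unfold Rdiv. lra. }
    unfold Rdiv in *. nra. }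
  set (T := PI / k).
  assert (HT : 0 < T) by (apply Rdiv_lt_0_compat; [apply PI_RGT_0|easy]).
  assert (Hat : forall r, r0 <= r ->
    is_derive (fun r => k * r - atan (v r)) r (k - / (1 + v r ^ 2) * dv r)).
  { intros r Hr. derive; [apply (derive_chain atan v); [apply is_derive_atan|now apply Hv]|].
    unfold Rsqr. field. nra. }
  assert (h : k * (r0 + T) - atan (v (r0 + T)) <= k * r0 - atan (v r0)).
  { apply (nonincreasing_of_derive (fun r => k * r - atan (v r))
      (fun r => k - / (1 + v r ^ 2) * dv r)); [lra| | |].
    - apply continuity_pt_right, (is_derive_continuity_pt _ _ _ (Hat r0 ltac:(lra))).
    - intros r Hr. apply Hat. lra.
    - intros r Hr. specialize (Hric r ltac:(lra)).
      assert (h := pow2_ge_0 (v r)).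
      assert (h' : 0 < / (1 + v r ^ 2)) by (apply Rinv_0_lt_compat; lra).
      apply Rmult_le_compat_l with (r := / (1 + v r ^ 2)) in Hric; [|lra].
      replace (/ (1 + v r ^ 2) * (k * (1 + v r ^ 2))) with k in Hric by (field; lra).
      lra. }
  assert (h1 := atan_bound (v r0)). assert (h2 := atan_bound (v (r0 + T))).
  assert (h3 : k * T = PI) by (unfold T; field; lra). lra.
Qed.

(** Away from the axis the equation is regular, so the solution [z = 1] is
    unique backwards as well. *)
Lemma profile_constant_backwards r0 r1 : 0 < r0 <= r1 ->
  z r1 = 1 -> p r1 = 0 -> z r0 = 1.
Proof.
  intros Hr E1 E2.
  set (Q := fun r => (z r - 1) ^ 2 + p r ^ 2).
  set (dQ := fun r => 2 * (z r - 1) * p r + 2 * p r * profile_rhs r (z r) (p r)).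
  set (C := 1 + 2 * (1 + B ^ 2) * B ^ 2 + 2 * (1 + B ^ 2) / r0).
  assert (HQ : forall r, 0 < r -> is_derive Q r (dQ r)).
  { intros r Hr'. unfold Q. derive; auto. unfold dQ. simpl. ring. }
  assert (Hrev : forall s, 0 <= s <= r1 - r0 ->
    is_derive (fun s => Q (r1 - s)) s (- dQ (r1 - s))).
  { intros s Hs. eapply is_derive_value.
    { apply (derive_chain Q (fun s => r1 - s)); [apply HQ; lra|derive_step]. }
    ring. }
  assert (h : Q (r1 - (r1 - r0)) <= 0).
  { apply (gronwall_zero (fun s => Q (r1 - s)) (fun s => - dQ (r1 - s)) C 0 (r1 - r0));
      [lra| | | |].
    - apply continuity_pt_right, (is_derive_continuity_pt _ _ _ (Hrev 0 ltac:(lra))).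
    - intros s Hs. apply Hrev. lra.
    - intros s Hs. set (r := r1 - s). assert (Hr' : r0 <= r <= r1) by (unfold r; lra).
      unfold dQ, Q, profile_rhs. destruct (HzB r ltac:(lra)) as [h1 h2].
      assert (h3 := HpB r ltac:(lra)).
      assert (hB : 0 < / B) by (apply Rinv_0_lt_compat; lra).
      assert (hz : / z r <= B).
      { rewrite <- (Rinv_inv B). apply Rinv_le_contravar; lra. }
      assert (hz0 : 0 < / z r) by (apply Rinv_0_lt_compat; lra).
      set (y := z r - 1) in *. set (x := p r) in *.
      replace (force (z r)) with (- (y * (/ z r) ^ 2)) by (unfold force, y; field; lra).
      replace (- (2 * y * x + 2 * x * ((1 + x ^ 2) * (2 * - (y * (/ z r) ^ 2) - x / r)))) with
        (2 * (- (y * x)) + 4 * (1 + x ^ 2) * (/ z r) ^ 2 * (x * y) + 2 * (1 + x ^ 2) * / r * x ^ 2)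
        by (field; lra).
      assert (h4 : (/ z r) ^ 2 <= B ^ 2) by (apply pow_incr; lra).
      assert (h5 : / r <= / r0) by (apply Rinv_le_contravar; lra).
      assert (h6 : 0 < / r) by (apply Rinv_0_lt_compat; lra).
      assert (h7 : 0 <= x ^ 2) by apply pow2_ge_0.
      assert (h8 : 0 <= y ^ 2) by apply pow2_ge_0.
      assert (h9 : x * y <= (y ^ 2 + x ^ 2) / 2 /\ - (y * x) <= (y ^ 2 + x ^ 2) / 2).
      { assert (0 <= (x - y) ^ 2) by apply pow2_ge_0.
        assert (0 <= (x + y) ^ 2) by apply pow2_ge_0. split; nra. }
      set (S := y ^ 2 + x ^ 2) in *.
      assert (h10 : (1 + x ^ 2) * (/ z r) ^ 2 <= (1 + B ^ 2) * B ^ 2).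
      { apply Rmult_le_compat; try lra. apply pow2_ge_0. }
      assert (h11 : 0 <= (1 + x ^ 2) * (/ z r) ^ 2).
      { apply Rmult_le_pos; [lra|apply pow2_ge_0]. }
      assert (h12 : (1 + x ^ 2) * / r <= (1 + B ^ 2) * / r0).
      { apply Rmult_le_compat; lra. }
      assert (h13 : 0 <= (1 + x ^ 2) * / r) by (apply Rmult_le_pos; lra).
      assert (h14 : x ^ 2 <= S) by (unfold S; lra).
      assert (h15 : (1 + x ^ 2) * (/ z r) ^ 2 * (x * y) <= (1 + B ^ 2) * B ^ 2 * (S / 2)).
      { apply Rle_trans with ((1 + x ^ 2) * (/ z r) ^ 2 * (S / 2)).
        - apply Rmult_le_compat_l; lra.
        - apply Rmult_le_compat_r; lra. }
      unfold C, Rdiv. unfold Rdiv in h15. nra.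
    - rewrite Rminus_0_r. unfold Q. rewrite E1, E2. lra. }
  replace (r1 - (r1 - r0)) with r0 in h by ring.
  apply Rminus_diag_uniq. exact (sum_sqr_le_0 _ _ h).
Qed.

Hypothesis (Hnc : exists r0, 0 < r0 /\ forall r, 0 < r < r0 -> z r <> 1).

(** A zero of [z - 1] beyond [R0] is simple, since otherwise [z] would be 1 up to
    the axis; so [z - 1] takes both signs next to it. *)
Lemma profile_both_sides R0 : 0 <= R0 ->
  (exists r, R0 < r /\ 1 < z r) /\ (exists r, R0 < r /\ z r < 1).
Proof.
  intros HR0. destruct (profile_crosses R0) as [r1 [Hr1 E1]].
  assert (Hp1 : p r1 <> 0).
  { intros E2. destruct Hnc as [r0 [Hr0 Hn]].
    set (s := Rmin (r0 / 2) r1). rmin (r0 / 2) r1.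
    assert (0 < s) by (apply Rmin_pos; lra).
    apply (Hn s); [unfold s in *; lra|].
    apply (profile_constant_backwards s r1); [unfold s in *; lra|easy|easy]. }
  assert (Hd := Hz r1 ltac:(lra)). apply is_derive_Reals in Hd.
  destruct (Hd (Rabs (p r1) / 2)) as [d Hd'].
  { assert (h := Rabs_pos_lt _ Hp1). lra. }
  set (h := Rmin (d / 2) ((r1 - R0) / 2)).
  assert (Hh1 := Rmin_l (d / 2) ((r1 - R0) / 2)).
  assert (Hh2 := Rmin_r (d / 2) ((r1 - R0) / 2)).
  assert (Hd0 := cond_pos d).
  assert (Hh : 0 < h) by (apply Rmin_pos; lra). fold h in Hh1, Hh2.
  assert (Q1 := Hd' h ltac:(lra) ltac:(rewrite Rabs_pos_eq; lra)).
  assert (Q2 := Hd' (- h) ltac:(lra) ltac:(rewrite Rabs_Ropp, Rabs_pos_eq; lra)).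
  rewrite E1 in Q1, Q2. apply Rabs_def2 in Q1, Q2.
  set (a1 := (z (r1 + h) - 1) / h) in *. set (a2 := (z (r1 + - h) - 1) / - h) in *.
  assert (A1 : z (r1 + h) = 1 + a1 * h) by (unfold a1; field; lra).
  assert (A2 : z (r1 + - h) = 1 - a2 * h) by (unfold a2; field; lra).
  destruct (Rlt_le_dec 0 (p r1)) as [Hs|Hs].
  - rewrite Rabs_pos_eq in Q1, Q2 by lra.
    split; [exists (r1 + h)|exists (r1 + - h)]; (split; [lra|]); nra.
  - rewrite Rabs_left in Q1, Q2 by lra.
    split; [exists (r1 + - h)|exists (r1 + h)]; (split; [lra|]); nra.
Qed.

Lemma profile_continuity r : 0 < r -> continuity_pt z r.
Proof. intros Hr. apply (is_derive_continuity_pt z r (p r)). now apply Hz. Qed.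

Lemma locally_between (a b x : R) (P : R -> Prop) : a < x < b ->
  (forall y, a <= y <= b -> P y) -> locally x P.
Proof.
  intros Hx HP. exists (mkposreal (Rmin (x - a) (b - x)) ltac:(apply Rmin_pos; lra)).
  intros y Hy. apply HP.
  rmin (x - a) (b - x).
  apply Rabs_def2 in Hy. unfold minus, plus, opp in Hy. simpl in Hy. lra.
Qed.

(** The maximum is taken between two later points below 1 that enclose a point
    above 1. *)
Lemma profile_local_max R0 : 0 <= R0 ->
  exists a, R0 < a /\ 1 < z a /\ locally a (fun r => z r <= z a).
Proof.
  intros HR0. destruct (profile_both_sides R0 HR0) as [_ [s1 [H1 Z1]]].
  destruct (profile_both_sides s1 ltac:(lra)) as [[s2 [H2 Z2]] _].
  destruct (profile_both_sides s2 ltac:(lra)) as [_ [s3 [H3 Z3]]].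
  destruct (continuity_ab_maj z s1 s3 ltac:(lra)) as [a [Ha Ha']].
  { intros. apply profile_continuity. lra. }
  assert (h := Ha s2 ltac:(lra)).
  assert (a <> s1) by (intros ->; lra). assert (a <> s3) by (intros ->; lra).
  exists a. split; [lra|]. split; [lra|].
  apply (locally_between s1 s3); [lra|]. auto.
Qed.

Lemma profile_local_min R0 : 0 <= R0 ->
  exists a, R0 < a /\ z a < 1 /\ locally a (fun r => z a <= z r).
Proof.
  intros HR0. destruct (profile_both_sides R0 HR0) as [[s1 [H1 Z1]] _].
  destruct (profile_both_sides s1 ltac:(lra)) as [_ [s2 [H2 Z2]]].
  destruct (profile_both_sides s2 ltac:(lra)) as [[s3 [H3 Z3]] _].
  destruct (continuity_ab_min z s1 s3 ltac:(lra)) as [a [Ha Ha']].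
  { intros. apply profile_continuity. lra. }
  assert (h := Ha s2 ltac:(lra)).
  assert (a <> s1) by (intros ->; lra). assert (a <> s3) by (intros ->; lra).
  exists a. split; [lra|]. split; [lra|].
  apply (locally_between s1 s3); [lra|]. auto.
Qed.

Lemma profile_alternates : exists a : nat -> R,
  0 < a O /\ (forall n, a n < a (S n)) /\ is_lim_seq a p_infty /\
  (forall n, Nat.Even n -> 1 < z (a n) /\ locally (a n) (fun r => z r <= z (a n))) /\
  (forall n, Nat.Odd n -> z (a n) < 1 /\ locally (a n) (fun r => z (a n) <= z r)) /\
  (forall n, exists r : R, a n < r < a (S n) /\ z r = 1).
Proof.
  assert (Hnext : forall (e : bool) (x : R), exists a, 0 <= x -> x + 1 < a /\
    if e then 1 < z a /\ locally a (fun r => z r <= z a)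
    else z a < 1 /\ locally a (fun r => z a <= z r)).
  { intros e x. destruct (Rle_dec 0 x) as [Hx|Hx]; [|now exists 0].
    destruct e.
    - destruct (profile_local_max (x + 1)) as [a Ha]; [lra|]. now exists a.
    - destruct (profile_local_min (x + 1)) as [a Ha]; [lra|]. now exists a. }
  set (next := fun e x =>
    proj1_sig (constructive_indefinite_description _ (Hnext e x))).
  assert (Hnx : forall e x, 0 <= x -> x + 1 < next e x /\
    if e then 1 < z (next e x) /\ locally (next e x) (fun r => z r <= z (next e x))
    else z (next e x) < 1 /\ locally (next e x) (fun r => z (next e x) <= z r)).
  { intros e x. unfold next. destruct constructive_indefinite_description. easy. }
  set (a := fix a (n : nat) := match n with
            | O => next true 0 | S n => next (Nat.even (S n)) (a n) end).
  assert (Hpos : forall n, 0 <= a n).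
  { induction n as [|n IH]; [destruct (Hnx true 0); simpl; lra|].
    destruct (Hnx (Nat.even (S n)) (a n) IH) as [h _].
    change (a (S n)) with (next (Nat.even (S n)) (a n)). lra. }
  assert (Hstep : forall n, a n + 1 < a (S n)).
  { intros n. now apply (Hnx (Nat.even (S n)) (a n)). }
  assert (Hkind : forall n, if Nat.even n then
      1 < z (a n) /\ locally (a n) (fun r => z r <= z (a n))
      else z (a n) < 1 /\ locally (a n) (fun r => z (a n) <= z r)).
  { intros [|n]; [now apply (Hnx true 0); lra|].
    now apply (Hnx (Nat.even (S n)) (a n)). }
  assert (Hgt : forall n, INR n < a n).
  { induction n as [|n IH]; [destruct (Hnx true 0); simpl; lra|].
    rewrite S_INR. specialize (Hstep n). lra. }
  exists a. split; [destruct (Hnx true 0); simpl; lra|].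
  split; [intros n; specialize (Hstep n); lra|].
  split.
  { apply is_lim_seq_le_p_loc with INR; [|apply is_lim_seq_INR].
    exists 0%nat. intros n _. specialize (Hgt n). lra. }
  split; [|split].
  - intros n Hn. apply Nat.even_spec in Hn. specialize (Hkind n). now rewrite Hn in Hkind.
  - intros n Hn. apply Nat.odd_spec in Hn. specialize (Hkind n).
    rewrite <- Nat.negb_even in Hn. now destruct (Nat.even n).
  - intros n. assert (H1 := Hkind n). assert (H2 := Hkind (S n)).
    rewrite Nat.even_succ, <- Nat.negb_even in H2. specialize (Hstep n).
    assert (Hsgn : (z (a n) - 1) * (z (a (S n)) - 1) < 0).
    { destruct (Nat.even n); cbn [negb] in H2; destruct H1 as [H1 _], H2 as [H2 _]; nra. }
    assert (Hc : forall x, a n <= x <= a (S n) -> continuity_pt (fun r => z r - 1) x).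
    { intros x Hx. cont. apply profile_continuity.
      specialize (Hgt n). assert (h := pos_INR n). lra. }
    assert (Hn0 : z (a n) - 1 <> 0) by (intros h; rewrite h in Hsgn; lra).
    assert (HI : exists x, a n <= x <= a (S n) /\ z x - 1 = 0).
    { destruct (Rlt_le_dec (z (a n) - 1) 0) as [hs|hs].
      - destruct (Ranalysis5.IVT_interv (fun r => z r - 1) (a n) (a (S n)) Hc)
          as [x [Hx1 Hx2]]; [lra|easy|nra|]. now exists x.
      - destruct (Ranalysis5.IVT_interv (fun r => - (z r - 1)) (a n) (a (S n)))
          as [x [Hx1 Hx2]]; [|lra|nra|nra|exists x; split; [easy|lra]].
        intros x Hx. apply (continuity_pt_opp (fun r => z r - 1)). now apply Hc. }
    destruct HI as [x [Hx Hx0]]. exists x. split; [|lra].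
    assert (x <> a n) by (intros ->; rewrite Hx0 in Hsgn; lra).
    assert (x <> a (S n)) by (intros ->; rewrite Hx0 in Hsgn; lra). lra.
Qed.

End Oscillation.

(** ** Consequences for the profile *)

Lemma derivative_on_ext b f g df : (forall r, 0 <= r -> f r = g r) ->
  derivative_on b f df -> derivative_on b g df.
Proof.
  intros E [H1 H2]. split.
  - apply filterlim_ext_loc with (fun r => (f r - f 0) / r); [|easy].
    exists (mkposreal 1 Rlt_0_1). intros r _ Hr. rewrite !E by lra. easy.
  - intros r Hr Hrb. apply is_derive_ext_loc with f; [|now apply H2].
    apply (locally_between 0 (r + 1)); [lra|]. intros y Hy. now apply E.
Qed.

Section Profile.
Variables (z0 c B : R) (phi psi w : R -> R).
Hypotheses (Hc : c < 0) (HE : entire_solution z0 c phi psi)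
  (HB : forall x, 0 <= x -> / B < phi x < B /\ 4 * x * psi x ^ 2 <= B ^ 2)
  (Hw : forall r, 0 <= r -> w r = phi (r ^ 2)).

Let p (r : R) := 2 * r * psi (r ^ 2).

Lemma profile_derivative_on b : derivative_on b w p /\
  derivative_on b p (fun r => 2 * psi (r ^ 2) + 4 * r ^ 2 * Derive psi (r ^ 2)).
Proof.
  destruct (entire_derivative_on z0 c phi psi Hc HE b) as [H1 H2]. split; [|exact H2].
  apply derivative_on_ext with (2 := H1). intros r Hr. now rewrite Hw.
Qed.

Lemma profile_second_derivative_0 :
  2 * psi (0 ^ 2) + 4 * 0 ^ 2 * Derive psi (0 ^ 2) = force z0.
Proof.
  replace (0 ^ 2) with 0 by ring. rewrite (entire_psi_0 z0 c phi psi Hc HE). field.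
Qed.

Lemma profile_convex b : 0 < z0 < 1 -> strictly_convex_at_0 b w.
Proof.
  intros Hz. destruct (profile_derivative_on b) as [H1 H2].
  eexists. eexists. split; [exact H1|]. split; [exact H2|].
  cbv beta. rewrite profile_second_derivative_0. apply Rdiv_lt_0_compat; nra.
Qed.

Lemma profile_concave b : 1 < z0 -> strictly_concave_at_0 b w.
Proof.
  intros Hz. destruct (profile_derivative_on b) as [H1 H2].
  eexists. eexists. split; [exact H1|]. split; [exact H2|].
  cbv beta. rewrite profile_second_derivative_0. unfold force.
  assert (0 < (z0 - 1) / z0 ^ 2) by (apply Rdiv_lt_0_compat; nra).
  replace ((1 - z0) / z0 ^ 2) with (- ((z0 - 1) / z0 ^ 2)) by (field; lra). lra.
Qed.

Lemma profile_constant r : z0 = 1 -> 0 <= r -> w r = 1.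
Proof.
  intros Hz Hr. rewrite Hw by easy.
  apply (profile_solution_unique z0 p_infty p_infty (fun r => phi (r ^ 2)) (fun _ => 1));
    try easy.
  - now apply (entire_profile_solution z0 c phi psi).
  - split; [easy|]. split; [intros; lra|]. exists (fun _ => 0), (fun _ => 0).
    assert (Hd : forall k, derivative_on p_infty (fun _ => k) (fun _ => 0)).
    { intros k. split; [|intros; apply @is_derive_const].
      apply (derive_right_quotient (fun _ => k)), @is_derive_const. }
    split; [apply Hd|]. split; [apply Hd|]. split; [easy|]. split; [easy|].
    intros s Hs _. field. lra.
Qed.

Lemma profile_oscillates : oscillates_around_H1 z0 w.
Proof.
  split; [|intros Hz r Hr; now apply profile_constant].
  intros Hz.
  assert (HB1 : 1 < B).
  { destruct (HB 0 (Rle_refl 0)) as [[h1 h2] _].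
    assert (h3 : 0 < phi 0) by (apply HE; lra).
    assert (h4 : / B * B = 1) by (apply Rinv_l; lra). nra. }
  assert (Hsq : forall r, 0 <= r ^ 2) by (intros; apply pow2_ge_0).
  apply (profile_alternates w p B).
  - intros r Hr. now apply (profile_derivative_on p_infty).
  - intros r Hr. rewrite Hw by lra. apply (entire_derive_p_rhs z0 c phi psi Hc HE). lra.
  - intros r Hr. rewrite Hw by lra. now apply HB.
  - intros r Hr. destruct (HB (r ^ 2) (Hsq r)) as [_ h]. unfold p. lra.
  - exact HB1.
  - assert (Hcont := is_derive_continuity_pt _ _ _ (entire_derive_z z0 c phi psi Hc HE 0)).
    destruct (proj1 (continuity_pt_eps _ _) Hcont (Rabs (z0 - 1))) as [d [Hd H]].
    { apply Rabs_pos_lt. lra. }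
    exists d. split; [easy|]. intros r Hr E. rewrite Hw in E by lra.
    specialize (H r ltac:(rewrite Rminus_0_r, Rabs_pos_eq; lra)).
    rewrite (entire_z_0 z0 c phi psi HE), E, Rabs_minus_sym in H. lra.
Qed.

End Profile.

(** * The inverse function theorem in the plane *)

Definition box (a b d u v : R) : Prop := Rabs (u - a) < d /\ Rabs (v - b) < d.

Lemma box_open a b d : open2 (box a b d).
Proof.
  intros u v [Hu Hv].
  exists (mkposreal (Rmin (d - Rabs (u - a)) (d - Rabs (v - b)))
            ltac:(apply Rmin_pos; lra)).
  intros x y Hx Hy. simpl in Hx, Hy.
  rmin (d - Rabs (u - a)) (d - Rabs (v - b)).
  assert (h3 := Rabs_triang (x - u) (u - a)). assert (h4 := Rabs_triang (y - v) (v - b)).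
  replace (x - u + (u - a)) with (x - a) in h3 by ring.
  replace (y - v + (v - b)) with (y - b) in h4 by ring. split; lra.
Qed.

Lemma box_center a b d : 0 < d -> box a b d a b.
Proof. intros Hd. split; rewrite Rminus_diag, Rabs_R0; easy. Qed.

Lemma box_le a b d d' u v : d <= d' -> box a b d u v -> box a b d' u v.
Proof. intros H [h1 h2]. split; lra. Qed.

Lemma locally_2d_box (P : R -> R -> Prop) a b :
  locally_2d P a b <-> exists d, 0 < d /\ forall u v, box a b d u v -> P u v.
Proof.
  split.
  - intros [d Hd]. exists d. split; [apply cond_pos|]. intros u v [h1 h2]. now apply Hd.
  - intros [d [Hd H]]. exists (mkposreal d Hd). intros u v h1 h2. now apply H.
Qed.

Lemma mean_value_le (f df : R -> R) (k x y : R) :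
  (forall t, Rmin x y <= t <= Rmax x y -> is_derive f t (df t)) ->
  (forall t, Rmin x y <= t <= Rmax x y -> Rabs (df t) <= k) ->
  Rabs (f y - f x) <= k * Rabs (y - x).
Proof.
  intros Hd Hk. destruct (MVT_gen f x y df) as [c [Hc1 Hc2]].
  - intros t Ht. apply Hd. lra.
  - intros t Ht. apply (is_derive_continuity_pt f t (df t)), Hd. lra.
  - rewrite Hc2, Rabs_mult. apply Rmult_le_compat_r; [apply Rabs_pos|now apply Hk].
Qed.

Lemma between_box a d x y t : Rabs (x - a) < d -> Rabs (y - a) < d ->
  Rmin x y <= t <= Rmax x y -> Rabs (t - a) < d.
Proof.
  intros Hx Hy Ht. apply Rabs_def2 in Hx, Hy. apply Rabs_def1;
    unfold Rmin, Rmax in Ht; destruct Rle_dec; lra.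
Qed.

Lemma box_lipschitz a b d k H :
  smooth_on (box a b d) H ->
  (forall u v, box a b d u v -> Rabs (D1 H u v) <= k /\ Rabs (D2 H u v) <= k) ->
  forall x y x' y', box a b d x y -> box a b d x' y' ->
    Rabs (H x y - H x' y') <= k * (Rabs (x - x') + Rabs (y - y')).
Proof.
  intros HH Hk x y x' y' [Hx Hy] [Hx' Hy'].
  replace (H x y - H x' y') with ((H x y - H x' y) + (H x' y - H x' y')) by ring.
  eapply Rle_trans; [apply Rabs_triang|]. rewrite Rmult_plus_distr_l.
  apply Rplus_le_compat.
  - apply (mean_value_le (fun t => H t y) (fun t => D1 H t y)).
    + intros t Ht. apply (smooth_derive1 (box a b d)); [easy|].
      split; [now apply (between_box a d x' x)|easy].
    + intros t Ht. apply Hk. split; [now apply (between_box a d x' x)|easy].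
  - apply (mean_value_le (fun t => H x' t) (fun t => D2 H x' t)).
    + intros t Ht. apply (smooth_derive2 (box a b d)); [easy|].
      split; [easy|now apply (between_box b d y' y)].
    + intros t Ht. apply Hk. split; [easy|now apply (between_box b d y' y)].
Qed.

Definition jacobian (F1 F2 : R -> R -> R) (u v : R) : R :=
  D1 F1 u v * D2 F2 u v - D2 F1 u v * D1 F2 u v.

Lemma smooth_on_jacobian D F1 F2 : open2 D ->
  smooth_on D F1 -> smooth_on D F2 -> smooth_on D (jacobian F1 F2).
Proof.
  intros HD H1 H2 n. apply Ck_minus; [easy| |]; apply Ck_mul;
    apply smooth_D1 || apply smooth_D2; easy.
Qed.

Lemma locally_2d_small (f : R -> R -> R) u v e : 0 < e ->
  continuity_2d_pt f u v -> f u v = 0 ->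
  locally_2d (fun x y => Rabs (f x y) <= e) u v.
Proof.
  intros He Hc H0. apply locally_2d_impl with (2 := Hc (mkposreal e He)).
  apply locally_2d_forall. intros x y h. simpl in h. rewrite H0, Rminus_0_r in h. lra.
Qed.

(** Newton's map with frozen derivative, [p |-> p - A (F p - q)] with
    [A = DF(p0)^-1], is a contraction near [p0] whose fixed point is the
    preimage of [q]. *)
Lemma local_inverse D F1 F2 x0 y0 : open2 D ->
  smooth_on D F1 -> smooth_on D F2 -> D x0 y0 -> jacobian F1 F2 x0 y0 <> 0 ->
  exists d e C (G1 G2 : R -> R -> R), 0 < d /\ 0 < e /\
    (forall x y, box x0 y0 d x y -> D x y /\ jacobian F1 F2 x y <> 0) /\
    (forall x y x' y', box x0 y0 d x y -> box x0 y0 d x' y' ->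
       Rabs (x - x') + Rabs (y - y') <=
       C * (Rabs (F1 x y - F1 x' y') + Rabs (F2 x y - F2 x' y'))) /\
    (forall u v, box (F1 x0 y0) (F2 x0 y0) e u v ->
       box x0 y0 d (G1 u v) (G2 u v) /\
       F1 (G1 u v) (G2 u v) = u /\ F2 (G1 u v) (G2 u v) = v).
Proof.
  intros HD S1 S2 H0 HJ.
  set (J := jacobian F1 F2 x0 y0) in *.
  set (a11 := D2 F2 x0 y0 / J). set (a12 := - D2 F1 x0 y0 / J).
  set (a21 := - D1 F2 x0 y0 / J). set (a22 := D1 F1 x0 y0 / J).
  set (lin := fun k1 k2 c1 c2 x y => k1 * x + k2 * y - (c1 * F1 x y + c2 * F2 x y)).
  assert (Sl : forall k1 k2 c1 c2, smooth_on D (lin k1 k2 c1 c2)).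
  { intros k1 k2 c1 c2 n. apply Ck_minus; [easy| |]; apply Ck_add; apply Ck_mul;
      auto; apply Ck_const || apply Ck_fst || apply Ck_snd. }
  assert (Dl : forall k1 k2 c1 c2,
    D1 (lin k1 k2 c1 c2) x0 y0 = k1 - (c1 * D1 F1 x0 y0 + c2 * D1 F2 x0 y0) /\
    D2 (lin k1 k2 c1 c2) x0 y0 = k2 - (c1 * D2 F1 x0 y0 + c2 * D2 F2 x0 y0)).
  { intros k1 k2 c1 c2. unfold lin. split; apply is_derive_unique; derive.
    - now apply (smooth_derive1 D F1).
    - now apply (smooth_derive1 D F2).
    - ring.
    - now apply (smooth_derive2 D F1).
    - now apply (smooth_derive2 D F2).
    - ring. }
  set (H1 := lin 1 0 a11 a12). set (H2 := lin 0 1 a21 a22).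
  assert (E : (D1 H1 x0 y0 = 0 /\ D2 H1 x0 y0 = 0) /\ (D1 H2 x0 y0 = 0 /\ D2 H2 x0 y0 = 0)).
  { unfold H1, H2. destruct (Dl 1 0 a11 a12) as [-> ->]. destruct (Dl 0 1 a21 a22) as [-> ->].
    unfold a11, a12, a21, a22, J, jacobian. repeat split; field; easy. }
  assert (Hd : exists d, 0 < d /\ forall x y, box x0 y0 d x y ->
    D x y /\ jacobian F1 F2 x y <> 0 /\
    (Rabs (D1 H1 x y) <= / 4 /\ Rabs (D2 H1 x y) <= / 4) /\
    (Rabs (D1 H2 x y) <= / 4 /\ Rabs (D2 H2 x y) <= / 4)).
  { apply locally_2d_box. apply locally_2d_and; [now apply HD|].
    apply locally_2d_and.
    { apply continuity_2d_pt_neq_0; [|easy].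
      apply (smooth_continuity D); [|easy]. now apply smooth_on_jacobian. }
    apply locally_2d_and; apply locally_2d_and; apply locally_2d_small; try apply E; try lra;
      apply (smooth_continuity D); try easy; apply smooth_D1 || apply smooth_D2; easy || apply Sl. }
  destruct Hd as [d [Hd Hbox]].
  assert (Lip : forall H, smooth_on D H ->
    (forall x y, box x0 y0 d x y -> Rabs (D1 H x y) <= / 4 /\ Rabs (D2 H x y) <= / 4) ->
    forall x y x' y', box x0 y0 d x y -> box x0 y0 d x' y' ->
    Rabs (H x y - H x' y') <= / 4 * (Rabs (x - x') + Rabs (y - y'))).
  { intros H SH HH. apply box_lipschitz; [|easy].
    intros n. apply (Ck_sub n D); [|easy]. intros x y h. now apply Hbox. }
  assert (Lip1 := Lip H1 (Sl _ _ _ _) ltac:(intros x y h; now apply Hbox)).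
  assert (Lip2 := Lip H2 (Sl _ _ _ _) ltac:(intros x y h; now apply Hbox)).
  set (N := Rabs a11 + Rabs a12 + Rabs a21 + Rabs a22 + 1).
  assert (HN : 1 <= N).
  { assert (h1 := Rabs_pos a11). assert (h2 := Rabs_pos a12).
    assert (h3 := Rabs_pos a21). assert (h4 := Rabs_pos a22). unfold N. lra. }
  assert (HNa : forall b1 b2 s t, Rabs b1 + Rabs b2 <= N ->
    Rabs (b1 * s + b2 * t) <= N * (Rabs s + Rabs t)).
  { intros b1 b2 s t Hb. eapply Rle_trans; [apply Rabs_triang|].
    rewrite !Rabs_mult. assert (h1 := Rabs_pos b1). assert (h2 := Rabs_pos b2).
    assert (h3 := Rabs_pos s). assert (h4 := Rabs_pos t). nra. }
  assert (HNa1 : Rabs a11 + Rabs a12 <= N).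
  { assert (h3 := Rabs_pos a21). assert (h4 := Rabs_pos a22). unfold N. lra. }
  assert (HNa2 : Rabs a21 + Rabs a22 <= N).
  { assert (h3 := Rabs_pos a11). assert (h4 := Rabs_pos a12). unfold N. lra. }
  set (e := d / (16 * N)).
  assert (He : 0 < e) by (apply Rdiv_lt_0_compat; lra).
  assert (HeN : N * (e + e) = d / 8) by (unfold e; field; lra).
  assert (HG : forall q : R * R, exists p : R * R,
    box (F1 x0 y0) (F2 x0 y0) e (fst q) (snd q) ->
    box x0 y0 d (fst p) (snd p) /\ F1 (fst p) (snd p) = fst q /\
    F2 (fst p) (snd p) = snd q).
  { intros [u v]. destruct (classic (box (F1 x0 y0) (F2 x0 y0) e u v)) as [[Hu Hv]|Hq];
      [|exists (0, 0); intros h; now elim Hq].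
    set (K := fun f : bool -> R => Rabs (f true - x0) <= d / 2 /\ Rabs (f false - y0) <= d / 2).
    set (Phi := fun (f : bool -> R) (t : bool) =>
      if t then H1 (f true) (f false) + (a11 * u + a12 * v)
      else H2 (f true) (f false) + (a21 * u + a22 * v)).
    set (f0 := fun t : bool => if t then x0 else y0).
    assert (HK : forall f, K f -> box x0 y0 d (f true) (f false)).
    { intros f [h1 h2]. split; lra. }
    assert (K0 : K f0).
    { split; simpl; rewrite Rminus_diag, Rabs_R0; lra. }
    assert (HP0 : forall t, Rabs (Phi f0 t - f0 t) <= d / 8 * 1).
    { intros t. rewrite Rmult_1_r. destruct t; simpl.
      - replace (H1 x0 y0 + (a11 * u + a12 * v) - x0) with
          (a11 * (u - F1 x0 y0) + a12 * (v - F2 x0 y0)) by (unfold H1, lin; ring).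
        eapply Rle_trans; [now apply HNa|]. rewrite <- HeN.
        apply Rmult_le_compat_l; lra.
      - replace (H2 x0 y0 + (a21 * u + a22 * v) - y0) with
          (a21 * (u - F1 x0 y0) + a22 * (v - F2 x0 y0)) by (unfold H2, lin; ring).
        eapply Rle_trans; [now apply HNa|]. rewrite <- HeN.
        apply Rmult_le_compat_l; lra. }
    assert (HPl : forall f g c, K f -> K g -> (forall t, Rabs (f t - g t) <= c * 1) ->
      forall t, Rabs (Phi f t - Phi g t) <= c / 2 * 1).
    { intros f g c Kf Kg Hfg t. assert (h1 := Hfg true). assert (h2 := Hfg false).
      destruct t; simpl.
      - replace (H1 (f true) (f false) + (a11 * u + a12 * v) -
          (H1 (g true) (g false) + (a11 * u + a12 * v))) with
          (H1 (f true) (f false) - H1 (g true) (g false)) by ring.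
        assert (h := Lip1 _ _ _ _ (HK f Kf) (HK g Kg)). lra.
      - replace (H2 (f true) (f false) + (a21 * u + a22 * v) -
          (H2 (g true) (g false) + (a21 * u + a22 * v))) with
          (H2 (f true) (f false) - H2 (g true) (g false)) by ring.
        assert (h := Lip2 _ _ _ _ (HK f Kf) (HK g Kg)). lra. }
    destruct (contraction_fixed_point (fun _ => 1) K Phi f0 (d / 8)) as [f [Kf [Hf _]]].
    - intros f Kf.
      assert (h : forall t, Rabs (f t - f0 t) <= d / 2 * 1).
      { intros t. destruct Kf as [k1 k2]. destruct t; simpl; lra. }
      assert (h' := HPl f f0 _ Kf K0 h).
      assert (T : forall t, Rabs (Phi f t - f0 t) <= d / 2).
      { intros t. replace (Phi f t - f0 t) with
          ((Phi f t - Phi f0 t) + (Phi f0 t - f0 t)) by ring.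
        eapply Rle_trans; [apply Rabs_triang|].
        specialize (h' t). specialize (HP0 t). lra. }
      split; [apply (T true)|apply (T false)].
    - exact HPl.
    - intros s f Ks Hs.
      assert (T : forall t, Rabs (f t - f0 t) <= d / 2).
      { intros t. apply Rnot_lt_le. intros Hlt.
        destruct (half_pow_small (2 * (d / 8)) (Rabs (f t - f0 t) - d / 2) ltac:(lra))
          as [n Hn].
        specialize (Hs n t). assert (Kst : Rabs (s n t - f0 t) <= d / 2).
        { destruct (Ks n). destruct t; simpl; lra. }
        assert (h : Rabs (f t - f0 t) <= Rabs (s n t - f t) + Rabs (s n t - f0 t)).
        { replace (f t - f0 t) with ((s n t - f0 t) - (s n t - f t)) by ring.
          eapply Rle_trans; [apply Rabs_triang|]. rewrite Rabs_Ropp. lra. }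
        lra. }
      split; [apply (T true)|apply (T false)].
    - exact K0.
    - exact HP0.
    - exists (f true, f false). intros _. simpl.
      assert (e1 := Hf true). assert (e2 := Hf false). simpl in e1, e2.
      unfold H1, lin in e1. unfold H2, lin in e2.
      set (X := F1 (f true) (f false)) in *. set (Y := F2 (f true) (f false)) in *.
      assert (e1' : a11 * (u - X) + a12 * (v - Y) = 0) by lra.
      assert (e2' : a21 * (u - X) + a22 * (v - Y) = 0) by lra.
      split; [now apply HK|].
      assert (i1 : u - X = D1 F1 x0 y0 * (a11 * (u - X) + a12 * (v - Y)) +
                           D2 F1 x0 y0 * (a21 * (u - X) + a22 * (v - Y))).
      { unfold a11, a12, a21, a22, J, jacobian. field. easy. }
      assert (i2 : v - Y = D1 F2 x0 y0 * (a11 * (u - X) + a12 * (v - Y)) +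
                           D2 F2 x0 y0 * (a21 * (u - X) + a22 * (v - Y))).
      { unfold a11, a12, a21, a22, J, jacobian. field. easy. }
      rewrite e1', e2' in i1, i2. lra. }
  set (G := fun q => proj1_sig (constructive_indefinite_description _ (HG q))).
  exists d, e, (4 * N), (fun u v => fst (G (u, v))), (fun u v => snd (G (u, v))).
  split; [easy|]. split; [easy|]. split; [|split].
  - intros x y h. now split; apply Hbox.
  - intros x y x' y' h h'.
    assert (l1 := Lip1 _ _ _ _ h h'). assert (l2 := Lip2 _ _ _ _ h h').
    assert (m1 := HNa a11 a12 (F1 x y - F1 x' y') (F2 x y - F2 x' y') HNa1).
    assert (m2 := HNa a21 a22 (F1 x y - F1 x' y') (F2 x y - F2 x' y') HNa2).
    set (n1 := Rabs (F1 x y - F1 x' y')) in *. set (n2 := Rabs (F2 x y - F2 x' y')) in *.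
    assert (k1 : Rabs (x - x') <= Rabs (H1 x y - H1 x' y') + N * (n1 + n2)).
    { replace (x - x') with ((H1 x y - H1 x' y') +
        (a11 * (F1 x y - F1 x' y') + a12 * (F2 x y - F2 x' y'))) at 1 by (unfold H1, lin; ring).
      eapply Rle_trans; [apply Rabs_triang|]. lra. }
    assert (k2 : Rabs (y - y') <= Rabs (H2 x y - H2 x' y') + N * (n1 + n2)).
    { replace (y - y') with ((H2 x y - H2 x' y') +
        (a21 * (F1 x y - F1 x' y') + a22 * (F2 x y - F2 x' y'))) at 1 by (unfold H2, lin; ring).
      eapply Rle_trans; [apply Rabs_triang|]. lra. }
    lra.
  - intros u v Hq. unfold G. destruct constructive_indefinite_description as [q Hq'].
    now apply Hq'.
Qed.

(** A Lipschitz right inverse of [F] is as smooth as [F]: it is differentiable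
    with derivative [DF^-1], and this formula is bootstrapped. *)
Lemma inverse_smooth D B F1 F2 (G1 G2 : R -> R -> R) C : open2 D -> open2 B ->
  smooth_on D F1 -> smooth_on D F2 ->
  (forall x y, D x y -> jacobian F1 F2 x y <> 0) ->
  (forall x y x' y', D x y -> D x' y' ->
     Rabs (x - x') + Rabs (y - y') <=
     C * (Rabs (F1 x y - F1 x' y') + Rabs (F2 x y - F2 x' y'))) ->
  (forall u v, B u v -> D (G1 u v) (G2 u v) /\
     F1 (G1 u v) (G2 u v) = u /\ F2 (G1 u v) (G2 u v) = v) ->
  smooth_on B G1 /\ smooth_on B G2.
Proof.
  intros HD HB S1 S2 HJ HC HG.
  set (j := fun u v => / jacobian F1 F2 (G1 u v) (G2 u v)).
  assert (Hlip : forall u v x y, B u v -> B x y ->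
    Rabs (G1 x y - G1 u v) + Rabs (G2 x y - G2 u v) <=
    2 * Rabs C * Rmax (Rabs (x - u)) (Rabs (y - v))).
  { intros u v x y Hu Hx. destruct (HG u v Hu) as [g1 [g2 g3]].
    destruct (HG x y Hx) as [k1 [k2 k3]].
    eapply Rle_trans; [now apply HC|]. rewrite g2, g3, k2, k3.
    assert (h1 := Rmax_l (Rabs (x - u)) (Rabs (y - v))).
    assert (h2 := Rmax_r (Rabs (x - u)) (Rabs (y - v))).
    assert (h3 := Rle_abs C). assert (h4 := Rabs_pos C).
    assert (h5 := Rabs_pos (x - u)). assert (h6 := Rabs_pos (y - v)). nra. }
  assert (Hdiff : forall u v, B u v ->
    differentiable_pt_lim G1 u v (D2 F2 (G1 u v) (G2 u v) * j u v)
      (- D2 F1 (G1 u v) (G2 u v) * j u v) /\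
    differentiable_pt_lim G2 u v (- D1 F2 (G1 u v) (G2 u v) * j u v)
      (D1 F1 (G1 u v) (G2 u v) * j u v)).
  { intros u v Huv. destruct (HG u v Huv) as [g1 [g2 g3]].
    assert (T1 := smooth_differentiable D F1 HD S1 _ _ g1).
    assert (T2 := smooth_differentiable D F2 HD S2 _ _ g1).
    specialize (HJ _ _ g1). unfold j.
    set (P := G1 u v) in *. set (Q := G2 u v) in *.
    set (A1 := D1 F1 P Q) in *. set (A2 := D2 F1 P Q) in *.
    set (B1 := D1 F2 P Q) in *. set (B2 := D2 F2 P Q) in *.
    assert (EJ : jacobian F1 F2 P Q = A1 * B2 - A2 * B1) by reflexivity.
    set (J := jacobian F1 F2 P Q) in *.
    set (N := Rabs A1 + Rabs A2 + Rabs B1 + Rabs B2 + 1).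
    assert (HN : Rabs A1 <= N /\ Rabs A2 <= N /\ Rabs B1 <= N /\ Rabs B2 <= N /\ 0 < N).
    { assert (h1 := Rabs_pos A1). assert (h2 := Rabs_pos A2).
      assert (h3 := Rabs_pos B1). assert (h4 := Rabs_pos B2). unfold N. lra. }
    assert (HJp := Rabs_pos_lt J HJ).
    set (C2 := 2 * Rabs C + 1).
    assert (HC2 : 0 < C2) by (assert (h := Rabs_pos C); unfold C2; lra).
    (* the linearized equations up to an error [eta |(du, dv)|] *)
    assert (key : forall eta, 0 < eta -> locally_2d (fun x y =>
      let dx := G1 x y - P in let dy := G2 x y - Q in
      let r := eta * Rmax (Rabs (x - u)) (Rabs (y - v)) in
      Rabs (x - u - (A1 * dx + A2 * dy)) <= r /\
      Rabs (y - v - (B1 * dx + B2 * dy)) <= r) u v).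
    { intros eta Heta.
      assert (He : 0 < eta / C2) by now apply Rdiv_lt_0_compat.
      assert (T := locally_2d_and _ _ _ _ (T1 (mkposreal _ He)) (T2 (mkposreal _ He))).
      destruct T as [d Hd]. destruct (HB u v Huv) as [d' Hd'].
      assert (Hd0 : 0 < Rmin d' (d / C2)).
      { apply Rmin_pos; [apply cond_pos|apply Rdiv_lt_0_compat; [apply cond_pos|easy]]. }
      exists (mkposreal _ Hd0). intros x y Hx Hy. simpl in Hx, Hy.
      rmin d' (d / C2).
      assert (Bxy : B x y) by (apply Hd'; lra).
      destruct (HG x y Bxy) as [_ [k2 k3]].
      assert (hl := Hlip u v x y Huv Bxy). fold P Q in hl.
      set (r := Rmax (Rabs (x - u)) (Rabs (y - v))) in *.
      assert (hr : 0 <= r < d / C2).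
      { split; [eapply Rle_trans; [apply Rabs_pos|apply Rmax_l]|].
        apply Rmax_lub_lt; lra. }
      assert (hl' : Rabs (G1 x y - P) + Rabs (G2 x y - Q) <= C2 * r).
      { unfold C2. lra. }
      assert (hd : C2 * r < d).
      { apply Rlt_le_trans with (C2 * (d / C2)); [apply Rmult_lt_compat_l; lra|].
        right. field. lra. }
      assert (p1 := Rabs_pos (G1 x y - P)). assert (p2 := Rabs_pos (G2 x y - Q)).
      destruct (Hd (G1 x y) (G2 x y)) as [t1 t2]; [lra|lra|].
      rewrite k2, g2 in t1. rewrite k3, g3 in t2. simpl in t1, t2.
      assert (hm : eta / C2 * Rmax (Rabs (G1 x y - P)) (Rabs (G2 x y - Q)) <= eta * r).
      { apply Rle_trans with (eta / C2 * (C2 * r)); [|right; field; lra].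
        apply Rmult_le_compat_l; [lra|]. apply Rmax_lub; lra. }
      simpl. split; [apply Rle_trans with (1 := t1)|apply Rle_trans with (1 := t2)]; easy. }
    assert (fin : forall (c1 c2 s t e1 e2 m : R), Rabs c1 <= N -> Rabs c2 <= N ->
      Rabs s <= m -> Rabs t <= m -> Rabs (c1 * s + c2 * t) <= 2 * N * m).
    { intros c1 c2 s t _ _ m h1 h2 h3 h4. eapply Rle_trans; [apply Rabs_triang|].
      rewrite !Rabs_mult.
      assert (Rabs c1 * Rabs s <= N * m) by (apply Rmult_le_compat; auto using Rabs_pos).
      assert (Rabs c2 * Rabs t <= N * m) by (apply Rmult_le_compat; auto using Rabs_pos).
      lra. }
    assert (Hgen : forall (eps : posreal), locally_2d (fun x y =>
      Rabs (G1 x y - P - (B2 * / J * (x - u) + - A2 * / J * (y - v))) <=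
        eps * Rmax (Rabs (x - u)) (Rabs (y - v)) /\
      Rabs (G2 x y - Q - (- B1 * / J * (x - u) + A1 * / J * (y - v))) <=
        eps * Rmax (Rabs (x - u)) (Rabs (y - v))) u v).
    { intros eps. set (eta := eps * Rabs J / (2 * N)).
      assert (Heta : 0 < eta).
      { apply Rdiv_lt_0_compat; [|lra]. apply Rmult_lt_0_compat; [apply cond_pos|easy]. }
      apply locally_2d_impl with (2 := key eta Heta). apply locally_2d_forall.
      intros x y [h1 h2]. set (r := Rmax (Rabs (x - u)) (Rabs (y - v))) in *.
      set (E1 := x - u - (A1 * (G1 x y - P) + A2 * (G2 x y - Q))) in *.
      set (E2 := y - v - (B1 * (G1 x y - P) + B2 * (G2 x y - Q))) in *.
      assert (HJi : forall X, Rabs X <= 2 * N * (eta * r) -> Rabs (/ J * X) <= eps * r).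
      { intros X HX. rewrite Rabs_mult, Rabs_inv.
        apply Rle_trans with (/ Rabs J * (2 * N * (eta * r))).
        - apply Rmult_le_compat_l; [apply Rlt_le, Rinv_0_lt_compat|]; easy.
        - right. unfold eta. field. lra. }
      split.
      - replace (G1 x y - P - (B2 * / J * (x - u) + - A2 * / J * (y - v))) with
          (/ J * (- B2 * E1 + A2 * E2)).
        + apply HJi, fin; auto; rewrite ?Rabs_Ropp; apply HN.
        + unfold E1, E2. rewrite EJ. field. now rewrite <- EJ.
      - replace (G2 x y - Q - (- B1 * / J * (x - u) + A1 * / J * (y - v))) with
          (/ J * (B1 * E1 + - A1 * E2)).
        + apply HJi, fin; auto; rewrite ?Rabs_Ropp; apply HN.
        + unfold E1, E2. rewrite EJ. field. now rewrite <- EJ. }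
    split; intros eps; (apply locally_2d_impl with (2 := Hgen eps);
      apply locally_2d_forall; intros x y h; apply h). }
  assert (Hpart : forall G a b u v, differentiable_pt_lim G u v a b ->
    is_derive (fun t => G t v) u a /\ is_derive (fun t => G u t) v b).
  { intros G a b u v h. split.
    - eapply is_derive_value.
      { apply (derive_chain_2d G (fun t => t) (fun _ => v) u a b 1 0 h);
          [apply @is_derive_id|apply @is_derive_const]. }
      ring.
    - eapply is_derive_value.
      { apply (derive_chain_2d G (fun _ => u) (fun t => t) v a b 0 1 h);
          [apply @is_derive_const|apply @is_derive_id]. }
      ring. }
  assert (Hcont : forall u v, B u v ->
    continuity_2d_pt G1 u v /\ continuity_2d_pt G2 u v).
  { intros u v Huv. destruct (Hdiff u v Huv) as [h1 h2].
    split; apply differentiable_continuity_pt; eexists; eexists; eassumption. }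
  assert (Hall : forall n, Ck n B G1 /\ Ck n B G2).
  { induction n as [|n [IH1 IH2]].
    - split; (split; [|easy]); intros u v Huv; now apply Hcont.
    - assert (Hco : forall f, smooth_on D f -> Ck n B (fun u v => f (G1 u v) (G2 u v))).
      { intros f Sf. apply (Ck_comp n B D); auto. intros u v Huv. now apply HG. }
      assert (Hj : Ck n B j).
      { apply Ck_inv; [easy| |].
        - intros u v Huv. apply HJ. now apply HG.
        - apply Hco. now apply smooth_on_jacobian. }
      split; (split; [intros u v Huv; now apply Hcont|]).
      + exists (fun u v => D2 F2 (G1 u v) (G2 u v) * j u v),
          (fun u v => - D2 F1 (G1 u v) (G2 u v) * j u v).
        split; [|split; [|split]].
        * intros u v Huv. apply (Hpart G1 _ _ u v (proj1 (Hdiff u v Huv))).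
        * intros u v Huv. apply (Hpart G1 _ _ u v (proj1 (Hdiff u v Huv))).
        * apply Ck_mul; [|easy]. now apply (Hco (D2 F2)), smooth_D2.
        * apply Ck_mul; [|easy]. apply Ck_opp; [easy|]. now apply (Hco (D2 F1)), smooth_D2.
      + exists (fun u v => - D1 F2 (G1 u v) (G2 u v) * j u v),
          (fun u v => D1 F1 (G1 u v) (G2 u v) * j u v).
        split; [|split; [|split]].
        * intros u v Huv. apply (Hpart G2 _ _ u v (proj2 (Hdiff u v Huv))).
        * intros u v Huv. apply (Hpart G2 _ _ u v (proj2 (Hdiff u v Huv))).
        * apply Ck_mul; [|easy]. apply Ck_opp; [easy|]. now apply (Hco (D1 F2)), smooth_D1.
        * apply Ck_mul; [|easy]. now apply (Hco (D1 F1)), smooth_D1. }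
  split; intros n; apply Hall.
Qed.

Theorem inverse_function D F1 F2 x0 y0 : open2 D ->
  smooth_on D F1 -> smooth_on D F2 -> D x0 y0 -> jacobian F1 F2 x0 y0 <> 0 ->
  exists d e (G1 G2 : R -> R -> R), 0 < d /\ 0 < e /\
    (forall x y, box x0 y0 d x y -> D x y) /\
    (forall x y, box x0 y0 d x y -> jacobian F1 F2 x y <> 0) /\
    (forall x y x' y', box x0 y0 d x y -> box x0 y0 d x' y' ->
       F1 x y = F1 x' y' -> F2 x y = F2 x' y' -> x = x' /\ y = y') /\
    (forall u v, box (F1 x0 y0) (F2 x0 y0) e u v ->
       box x0 y0 d (G1 u v) (G2 u v) /\
       F1 (G1 u v) (G2 u v) = u /\ F2 (G1 u v) (G2 u v) = v) /\
    smooth_on (box (F1 x0 y0) (F2 x0 y0) e) G1 /\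
    smooth_on (box (F1 x0 y0) (F2 x0 y0) e) G2.
Proof.
  intros HD S1 S2 H0 HJ.
  destruct (local_inverse D F1 F2 x0 y0 HD S1 S2 H0 HJ)
    as [d [e [C [G1 [G2 [Hd [He [HDb [HC HG]]]]]]]]].
  exists d, e, G1, G2. split; [easy|]. split; [easy|].
  split; [intros; now apply HDb|]. split; [intros; now apply HDb|]. split; [|split; [easy|]].
  - intros x y x' y' h h' E1 E2. specialize (HC x y x' y' h h').
    rewrite E1, E2, !Rminus_diag, !Rabs_R0 in HC.
    assert (p1 := Rabs_pos (x - x')). assert (p2 := Rabs_pos (y - y')).
    split; apply Rminus_diag_uniq; apply Rabs_eq_0; lra.
  - apply (inverse_smooth (box x0 y0 d) (box (F1 x0 y0) (F2 x0 y0) e) F1 F2 G1 G2 C); auto.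
    + apply box_open.
    + apply box_open.
    + intros n. apply (Ck_sub n D); [|easy]. intros; now apply HDb.
    + intros n. apply (Ck_sub n D); [|easy]. intros; now apply HDb.
    + intros; now apply HDb.
Qed.

(** * The equation of horo-shrinking graphs *)

Lemma D1_ext (D : R -> R -> Prop) f g u v : open2 D ->
  (forall u v, D u v -> f u v = g u v) -> D u v -> D1 f u v = D1 g u v.
Proof.
  intros HD He H. apply Derive_ext_loc.
  apply (locally_2d_1 (fun u v => f u v = g u v)).
  apply locally_2d_impl with (2 := HD u v H). now apply locally_2d_forall.
Qed.

Lemma D2_ext (D : R -> R -> Prop) f g u v : open2 D ->
  (forall u v, D u v -> f u v = g u v) -> D u v -> D2 f u v = D2 g u v.
Proof.
  intros HD He H. apply Derive_ext_loc.
  apply (locally_2d_2 (fun u v => f u v = g u v)).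
  apply locally_2d_impl with (2 := HD u v H). now apply locally_2d_forall.
Qed.

Lemma smooth_schwarz D f u v : open2 D -> smooth_on D f -> D u v ->
  D1 (D2 f) u v = D2 (D1 f) u v.
Proof.
  intros HD Hf H. apply (Schwarz f u v).
  - apply locally_2d_impl with (2 := HD u v H). apply locally_2d_forall.
    intros x y h. repeat split.
    + eexists; now apply (smooth_derive1 D).
    + eexists; now apply (smooth_derive2 D).
    + eexists; now apply (smooth_derive1 D (D2 f) (smooth_D2 D f HD Hf)).
    + eexists; now apply (smooth_derive2 D (D1 f) (smooth_D1 D f HD Hf)).
  - apply (smooth_continuity D (D1 (D2 f))); [|easy].
    now apply smooth_D1, smooth_D2.
  - apply (smooth_continuity D (D2 (D1 f))); [|easy].
    now apply smooth_D2, smooth_D1.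
Qed.

(** The equation [H = <N, d/dz>] for the graph of [h], with the upward normal and
    cleared of denominators. *)
Definition horo_graph_eq (h : R -> R -> R) (u v : R) : Prop :=
  D1 (D1 h) u v * (1 + D2 h u v ^ 2) - 2 * D1 (D2 h) u v * (D1 h u v * D2 h u v)
    + D2 (D2 h) u v * (1 + D1 h u v ^ 2)
  = 2 * force (h u v) * (1 + D1 h u v ^ 2 + D2 h u v ^ 2).

(** The mean curvature of a graph composed with a plane map with derivative
    [(a b; c d)] and second derivatives [a1 .. c3]: the latter contribute
    tangent vectors, the former a congruence, so both disappear. *)
Lemma graph_curvature_algebra
  (a b c d a1 a2 a3 c1 c2 c3 p q r s t z n : R) (x y : R) :
  a * d - b * c <> 0 -> z <> 0 ->
  let P : R3 := (x, y, z) in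
  let N : R3 := (- p * n, - q * n, n) in
  let Xu : R3 := (a, c, p * a + q * c) in
  let Xv : R3 := (b, d, p * b + q * d) in
  let Xuu : R3 := (a1, c1, (r * a + s * c) * a + p * a1 + ((s * a + t * c) * c + q * c1)) in
  let Xuv : R3 := (a2, c2, (r * a + s * c) * b + p * a2 + ((s * a + t * c) * d + q * c2)) in
  let Xvv : R3 := (a3, c3, (r * b + s * d) * b + p * a3 + ((s * b + t * d) * d + q * c3)) in
  let g := hyp P in
  let h11 := g (add3 Xuu (christoffel P Xu Xu)) N in
  let h12 := g (add3 Xuv (christoffel P Xu Xv)) N in
  let h22 := g (add3 Xvv (christoffel P Xv Xv)) N in
  (h11 * g Xv Xv - 2 * (h12 * g Xu Xv) + h22 * g Xu Xu)
    / (2 * (g Xu Xu * g Xv Xv - g Xu Xv ^ 2)) =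
  n * ((r * (1 + q ^ 2) - 2 * s * (p * q) + t * (1 + p ^ 2)) / (2 * (1 + p ^ 2 + q ^ 2))
       + / z).
Proof.
  intros HJ Hz. cbv zeta. unfold hyp, add3, christoffel, dot3, xc, yc, zc; simpl fst; simpl snd.
  assert (HW : 0 < 1 + p ^ 2 + q ^ 2) by nra.
  assert (Hdet : (a * a + c * c + (p * a + q * c) * (p * a + q * c)) *
     (b * b + d * d + (p * b + q * d) * (p * b + q * d)) -
     (a * b + c * d + (p * a + q * c) * (p * b + q * d)) ^ 2 =
     (a * d - b * c) ^ 2 * (1 + p ^ 2 + q ^ 2)) by ring.
  assert (Hd0 : (a * d - b * c) ^ 2 * (1 + p ^ 2 + q ^ 2) <> 0).
  { apply Rmult_integral_contrapositive_currified; [now apply pow_nonzero|lra]. }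
  field_simplify_eq.
  - ring.
  - split; [easy|]. split; [lra|]. intros h. apply Hd0. rewrite <- Hdet, <- h. ring.
Qed.

Section GraphChart.
Variables (D E : R -> R -> Prop) (F1 F2 h : R -> R -> R) (X : R * R -> R3).
Hypotheses
  (HD : open2 D) (HE : open2 E)
  (S1 : smooth_on D F1) (S2 : smooth_on D F2) (Sh : smooth_on E h)
  (HF : forall u v, D u v -> E (F1 u v) (F2 u v))
  (HX : forall u v, D u v -> X (u, v) = (F1 u v, F2 u v, h (F1 u v) (F2 u v))).

Lemma comp_D1 f u v : smooth_on E f -> D u v ->
  D1 (fun u v => f (F1 u v) (F2 u v)) u v =
  D1 f (F1 u v) (F2 u v) * D1 F1 u v + D2 f (F1 u v) (F2 u v) * D1 F2 u v.
Proof.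
  intros Sf H. apply is_derive_unique.
  apply (derive_chain_2d f (fun t => F1 t v) (fun t => F2 t v)).
  - apply (smooth_differentiable E); auto.
  - now apply (smooth_derive1 D).
  - now apply (smooth_derive1 D).
Qed.

Lemma comp_D2 f u v : smooth_on E f -> D u v ->
  D2 (fun u v => f (F1 u v) (F2 u v)) u v =
  D1 f (F1 u v) (F2 u v) * D2 F1 u v + D2 f (F1 u v) (F2 u v) * D2 F2 u v.
Proof.
  intros Sf H. apply is_derive_unique.
  apply (derive_chain_2d f (fun t => F1 u t) (fun t => F2 u t)).
  - apply (smooth_differentiable E); auto.
  - now apply (smooth_derive2 D).
  - now apply (smooth_derive2 D).
Qed.

Lemma smooth_comp f : smooth_on E f -> smooth_on D (fun u v => f (F1 u v) (F2 u v)).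
Proof. intros Sf n. apply (Ck_comp n D E); auto. Qed.

Lemma D1_sum_prod (f1 g1 f2 g2 : R -> R -> R) u v :
  smooth_on D f1 -> smooth_on D g1 -> smooth_on D f2 -> smooth_on D g2 -> D u v ->
  D1 (fun u v => f1 u v * g1 u v + f2 u v * g2 u v) u v =
  (D1 f1 u v * g1 u v + f1 u v * D1 g1 u v) + (D1 f2 u v * g2 u v + f2 u v * D1 g2 u v).
Proof.
  intros. apply is_derive_unique.
  apply derive_add; [apply (derive_mul (fun t => f1 t v) (fun t => g1 t v))
    |apply (derive_mul (fun t => f2 t v) (fun t => g2 t v))]; now apply (smooth_derive1 D).
Qed.

Lemma D2_sum_prod (f1 g1 f2 g2 : R -> R -> R) u v :
  smooth_on D f1 -> smooth_on D g1 -> smooth_on D f2 -> smooth_on D g2 -> D u v ->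
  D2 (fun u v => f1 u v * g1 u v + f2 u v * g2 u v) u v =
  (D2 f1 u v * g1 u v + f1 u v * D2 g1 u v) + (D2 f2 u v * g2 u v + f2 u v * D2 g2 u v).
Proof.
  intros. apply is_derive_unique.
  apply derive_add; [apply (derive_mul (fun t => f1 u t) (fun t => g1 u t))
    |apply (derive_mul (fun t => f2 u t) (fun t => g2 u t))]; now apply (smooth_derive2 D).
Qed.

Let Z u v := h (F1 u v) (F2 u v).

Lemma graph_pd u v : D u v ->
  let p := D1 h (F1 u v) (F2 u v) in let q := D2 h (F1 u v) (F2 u v) in
  let r := D1 (D1 h) (F1 u v) (F2 u v) in
  let s := D1 (D2 h) (F1 u v) (F2 u v) in
  let t := D2 (D2 h) (F1 u v) (F2 u v) in
  let a := D1 F1 u v in let b := D2 F1 u v in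
  let c := D1 F2 u v in let d := D2 F2 u v in
  let a1 := D1 (D1 F1) u v in let a2 := D1 (D2 F1) u v in let a3 := D2 (D2 F1) u v in
  let c1 := D1 (D1 F2) u v in let c2 := D1 (D2 F2) u v in let c3 := D2 (D2 F2) u v in
  pd 1 0 X (u, v) = (a, c, p * a + q * c) /\
  pd 0 1 X (u, v) = (b, d, p * b + q * d) /\
  pd 2 0 X (u, v) =
    (a1, c1, (r * a + s * c) * a + p * a1 + ((s * a + t * c) * c + q * c1)) /\
  pd 1 1 X (u, v) =
    (a2, c2, (r * a + s * c) * b + p * a2 + ((s * a + t * c) * d + q * c2)) /\
  pd 0 2 X (u, v) =
    (a3, c3, (r * b + s * d) * b + p * a3 + ((s * b + t * d) * d + q * c3)).
Proof.
  intros H. cbv zeta.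
  set (x := fun u v => xc (X (u, v))). set (y := fun u v => yc (X (u, v))).
  set (z := fun u v => zc (X (u, v))).
  assert (Ex : forall u v, D u v -> x u v = F1 u v).
  { intros u' v' h'. unfold x. now rewrite HX. }
  assert (Ey : forall u v, D u v -> y u v = F2 u v).
  { intros u' v' h'. unfold y. now rewrite HX. }
  assert (Ez : forall u v, D u v -> z u v = Z u v).
  { intros u' v' h'. unfold z. now rewrite HX. }
  assert (Ez1 : forall u v, D u v -> D1 z u v =
    D1 h (F1 u v) (F2 u v) * D1 F1 u v + D2 h (F1 u v) (F2 u v) * D1 F2 u v).
  { intros u' v' h'. rewrite (D1_ext D z Z) by auto. now apply comp_D1. }
  assert (Ez2 : forall u v, D u v -> D2 z u v =
    D1 h (F1 u v) (F2 u v) * D2 F1 u v + D2 h (F1 u v) (F2 u v) * D2 F2 u v).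
  { intros u' v' h'. rewrite (D2_ext D z Z) by auto. now apply comp_D2. }
  assert (P1 := smooth_D1 E h HE Sh). assert (P2 := smooth_D2 E h HE Sh).
  assert (A1 := smooth_D1 D F1 HD S1). assert (A2 := smooth_D2 D F1 HD S1).
  assert (B1 := smooth_D1 D F2 HD S2). assert (B2 := smooth_D2 D F2 HD S2).
  assert (Q1 := smooth_comp _ P1). assert (Q2 := smooth_comp _ P2).
  assert (Sw : D1 (D2 h) (F1 u v) (F2 u v) = D2 (D1 h) (F1 u v) (F2 u v)).
  { apply (smooth_schwarz E); auto. }
  split; [|split; [|split; [|split]]].
  - change (pd 1 0 X (u, v)) with (D1 x u v, D1 y u v, D1 z u v).
    rewrite Ez1, (D1_ext D x F1), (D1_ext D y F2) by auto. easy.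
  - change (pd 0 1 X (u, v)) with (D2 x u v, D2 y u v, D2 z u v).
    rewrite Ez2, (D2_ext D x F1), (D2_ext D y F2) by auto. easy.
  - change (pd 2 0 X (u, v)) with (D1 (D1 x) u v, D1 (D1 y) u v, D1 (D1 z) u v).
    rewrite (D1_ext D (D1 x) (D1 F1)), (D1_ext D (D1 y) (D1 F2)) by
      (auto; intros; apply (D1_ext D); auto).
    f_equal. rewrite (D1_ext D _ _ u v HD Ez1 H).
    rewrite (D1_sum_prod _ (D1 F1) _ (D1 F2)) by easy.
    rewrite (comp_D1 (D1 h)), (comp_D1 (D2 h)), <- Sw by easy. easy.
  - change (pd 1 1 X (u, v)) with (D1 (D2 x) u v, D1 (D2 y) u v, D1 (D2 z) u v).
    rewrite (D1_ext D (D2 x) (D2 F1)), (D1_ext D (D2 y) (D2 F2)) by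
      (auto; intros; apply (D2_ext D); auto).
    f_equal. rewrite (D1_ext D _ _ u v HD Ez2 H).
    rewrite (D1_sum_prod _ (D2 F1) _ (D2 F2)) by easy.
    rewrite (comp_D1 (D1 h)), (comp_D1 (D2 h)), <- Sw by easy. easy.
  - change (pd 0 2 X (u, v)) with (D2 (D2 x) u v, D2 (D2 y) u v, D2 (D2 z) u v).
    rewrite (D2_ext D (D2 x) (D2 F1)), (D2_ext D (D2 y) (D2 F2)) by
      (auto; intros; apply (D2_ext D); auto).
    f_equal. rewrite (D2_ext D _ _ u v HD Ez2 H).
    rewrite (D2_sum_prod _ (D2 F1) _ (D2 F2)) by easy.
    rewrite (comp_D2 (D1 h)), (comp_D2 (D2 h)), <- Sw by easy. easy.
Qed.

(** A normal vector of any length will do, as both sides of [H = <N, d/dz>] are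
    linear in [N]. *)
Lemma graph_mean_curvature u v (N : R3) : D u v ->
  jacobian F1 F2 u v <> 0 -> 0 < h (F1 u v) (F2 u v) ->
  hyp (X (u, v)) N (pd 1 0 X (u, v)) = 0 -> hyp (X (u, v)) N (pd 0 1 X (u, v)) = 0 ->
  zc N <> 0 ->
  (mean_curvature X N (u, v) = hyp (X (u, v)) N (0, 0, 1) <->
   horo_graph_eq h (F1 u v) (F2 u v)).
Proof.
  intros H HJ Hh N1 N2 N3.
  destruct (graph_pd u v H) as [E1 [E2 [E3 [E4 E5]]]]. cbv zeta in *.
  unfold mean_curvature, cov_uu, cov_uv, cov_vv, horo_graph_eq.
  rewrite E1 in N1. rewrite E2 in N2. rewrite E1, E2, E3, E4, E5.
  rewrite HX in * by easy. clear E1 E2 E3 E4 E5.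
  unfold jacobian in HJ.
  set (z := h (F1 u v) (F2 u v)) in *.
  set (p := D1 h (F1 u v) (F2 u v)) in *. set (q := D2 h (F1 u v) (F2 u v)) in *.
  set (a := D1 F1 u v) in *. set (b := D2 F1 u v) in *.
  set (c := D1 F2 u v) in *. set (d := D2 F2 u v) in *.
  destruct N as [[n1 n2] n]. simpl in N3.
  unfold hyp, dot3, xc, yc, zc in N1, N2. simpl in N1, N2. unfold zc in N3; simpl in N3.
  assert (M1 : n1 * a + n2 * c + n * (p * a + q * c) = 0).
  { apply (Rmult_eq_reg_r (/ (z * (z * 1)))); [|apply Rinv_neq_0_compat; nra].
    rewrite Rmult_0_l. exact N1. }
  assert (M2 : n1 * b + n2 * d + n * (p * b + q * d) = 0).
  { apply (Rmult_eq_reg_r (/ (z * (z * 1)))); [|apply Rinv_neq_0_compat; nra].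
    rewrite Rmult_0_l. exact N2. }
  assert (K1 : n1 = - p * n).
  { apply Rminus_diag_uniq, (Rmult_eq_reg_l (a * d - b * c)); [|easy].
    replace ((a * d - b * c) * (n1 - - p * n)) with
      (d * (n1 * a + n2 * c + n * (p * a + q * c)) -
       c * (n1 * b + n2 * d + n * (p * b + q * d))) by ring.
    rewrite M1, M2. ring. }
  assert (K2 : n2 = - q * n).
  { apply Rminus_diag_uniq, (Rmult_eq_reg_l (a * d - b * c)); [|easy].
    replace ((a * d - b * c) * (n2 - - q * n)) with
      (a * (n1 * b + n2 * d + n * (p * b + q * d)) -
       b * (n1 * a + n2 * c + n * (p * a + q * c))) by ring.
    rewrite M1, M2. ring. }
  subst n1 n2.
  rewrite graph_curvature_algebra by (easy || lra).
  unfold hyp, dot3, xc, yc, zc. simpl fst. simpl snd. unfold force.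
  set (W := 1 + p ^ 2 + q ^ 2). assert (HW : 0 < W) by (unfold W; nra).
  set (M := _ - _ + _). split; intros EQ.
  - assert (EQ' : M / (2 * W) + / z = / z ^ 2).
    { apply (Rmult_eq_reg_l n); [|easy]. rewrite EQ. field. lra. }
    replace M with ((M / (2 * W) + / z) * (2 * W) - 2 * W / z) by (field; lra).
    rewrite EQ'. field. lra.
  - rewrite EQ. field. lra.
Qed.

End GraphChart.

(** * Topology of surfaces *)

Lemma locally_pair_box (P : R * R -> Prop) (u v : R) :
  locally (u, v) P <-> exists d, 0 < d /\ forall x y, box u v d x y -> P (x, y).
Proof.
  rewrite <- (locally_2d_box (fun x y => P (x, y))), locally_2d_locally.
  split; apply filter_imp; now intros [x y].
Qed.

Lemma open_open2 (P : R * R -> Prop) : open P <-> open2 (fun u v => P (u, v)).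
Proof.
  split.
  - intros H u v h. apply locally_2d_box, locally_pair_box. now apply H.
  - intros H [u v] h. apply locally_pair_box, locally_2d_box. now apply (H u v).
Qed.

(** A continuous pair of functions sends a box into a given open set. *)
Lemma continuity_box (g1 g2 : R -> R -> R) (P : R -> R -> Prop) u v : open2 P ->
  continuity_2d_pt g1 u v -> continuity_2d_pt g2 u v -> P (g1 u v) (g2 u v) ->
  locally_2d (fun x y => P (g1 x y) (g2 x y)) u v.
Proof.
  intros HP H1 H2 H. destruct (HP _ _ H) as [d Hd].
  apply locally_2d_impl with (2 := locally_2d_and _ _ _ _ (H1 d) (H2 d)).
  apply locally_2d_forall. intros x y [h1 h2]. now apply Hd.
Qed.

Lemma is_open_ext {S : surface} (O O' : pt S -> Prop) :
  (forall x, O x <-> O' x) -> is_open O -> is_open O'.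
Proof.
  intros H HO i q [h1 h2]. apply H in h2.
  generalize (HO i q (conj h1 h2)). apply filter_imp.
  intros p [k1 k2]. split; [easy|now apply H].
Qed.

Lemma is_open_of_neighbourhoods {S : surface} (U : pt S -> Prop) :
  (forall x, U x -> exists O, is_open O /\ O x /\ forall y, O y -> U y) -> is_open U.
Proof.
  intros H i q [h1 h2]. destruct (H _ h2) as [O [HO [Hx HOU]]].
  generalize (HO i q (conj h1 Hx)). apply filter_imp.
  intros p [k1 k2]. split; auto.
Qed.

Section SurfaceTopology.
Context {S : surface}.
Hypothesis (HS : is_smooth_surface S).

Lemma dom_open (i : idx S) : open2 (fun u v => dom i (u, v)).
Proof. apply open_open2, HS. Qed.

Lemma par_injective (i : idx S) q p : dom i q -> dom i p -> par i q = par i p -> q = p.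
Proof. apply HS. Qed.

Lemma chart_at (x : pt S) : exists i u v, dom i (u, v) /\ par i (u, v) = x.
Proof.
  destruct HS as [_ [_ [[e He] _]]]. destruct (He x) as [n [[u v] H]]. now exists (e n), u, v.
Qed.

Lemma is_open_and (O O' : pt S -> Prop) : is_open O -> is_open O' ->
  is_open (fun x => O x /\ O' x).
Proof.
  intros H H' i q [h1 [h2 h3]].
  generalize (filter_and _ _ (H i q (conj h1 h2)) (H' i q (conj h1 h3))).
  apply filter_imp. tauto.
Qed.

(** A local expression of a smooth map of surfaces, with continuity spelled
    out: it sends a neighbourhood into a given neighbourhood. *)
Lemma smooth_map_local {R' : surface} (f : pt R' -> pt S) (i : idx R') (j : idx S)
  u v a b (V : R -> R -> Prop) : smooth_map f ->
  dom i (u, v) -> dom j (a, b) -> f (par i (u, v)) = par j (a, b) -> open2 V -> V a b ->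
  exists d (g1 g2 : R -> R -> R), 0 < d /\
    smooth_on (box u v d) g1 /\ smooth_on (box u v d) g2 /\ g1 u v = a /\ g2 u v = b /\
    forall x y, box u v d x y -> V (g1 x y) (g2 x y) /\
      dom j (g1 x y, g2 x y) /\ f (par i (x, y)) = par j (g1 x y, g2 x y).
Proof.
  intros Hf Hi Hj E HV HVa. destruct (Hf i j (u, v) (a, b) Hi Hj E) as [g Hg].
  apply locally_pair_box in Hg. destruct Hg as [d [Hd Hg]].
  set (g1 := fun x y => fst (g (x, y))). set (g2 := fun x y => snd (g (x, y))).
  assert (Eg : forall x y, g (x, y) = (g1 x y, g2 x y)).
  { intros x y. unfold g1, g2. now destruct (g (x, y)). }
  assert (S1 : smooth_on (box u v d) g1).
  { apply (smooth_at_smooth_on (box u v d) (fun q => fst (g q))). intros; now apply Hg. }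
  assert (S2 : smooth_on (box u v d) g2).
  { apply (smooth_at_smooth_on (box u v d) (fun q => snd (g q))). intros; now apply Hg. }
  assert (Hc := box_center u v d Hd).
  assert (Ec : (g1 u v, g2 u v) = (a, b)).
  { apply (par_injective j); [|easy|].
    - rewrite <- Eg. now apply Hg.
    - rewrite <- Eg, <- E. symmetry. now apply Hg. }
  injection Ec as E1 E2.
  assert (HVl : locally_2d (fun x y => V (g1 x y) (g2 x y)) u v).
  { apply continuity_box; [easy| | |now rewrite E1, E2].
    - now apply (smooth_continuity (box u v d)).
    - now apply (smooth_continuity (box u v d)). }
  apply locally_2d_box in HVl. destruct HVl as [d' [Hd' HVl]].
  rmin d d'.
  exists (Rmin d d'), g1, g2. split; [now apply Rmin_pos|].
  split; [|split; [|split; [easy|split; [easy|]]]].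
  - intros n. apply (Ck_sub n (box u v d)); [|easy]. intros x y. now apply box_le.
  - intros n. apply (Ck_sub n (box u v d)); [|easy]. intros x y. now apply box_le.
  - intros x y Hxy. split; [apply HVl; now apply (box_le u v (Rmin d d'))|].
    rewrite <- Eg. destruct (Hg x y) as [_ [_ h]]; [now apply (box_le u v (Rmin d d'))|easy].
Qed.

Lemma smooth_map_continuous {R' : surface} (f : pt R' -> pt S) (O : pt S -> Prop) :
  (forall i : idx R', open (dom i)) ->
  smooth_map f -> is_open O -> is_open (fun x => O (f x)).
Proof.
  intros HR Hf HO i. apply open_open2. intros u v [Hd Hq].
  destruct (chart_at (f (par i (u, v)))) as [j [a [b [Hj Ej]]]].
  destruct (smooth_map_local f i j u v a b (fun x y => dom j (x, y) /\ O (par j (x, y))) Hf Hd Hj)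
    as [d [g1 [g2 [Hd0 [_ [_ [_ [_ Hg]]]]]]]]; [easy| |now rewrite Ej|].
  { exact (proj1 (open_open2 (fun q => dom j q /\ O (par j q))) (HO j)). }
  destruct (proj1 (open_open2 _) (HR i) u v Hd) as [d' Hd'].
  exists (mkposreal (Rmin d d') ltac:(apply Rmin_pos; [easy|apply cond_pos])).
  intros x y Hx Hy. simpl in Hx, Hy.
  rmin d d'.
  split; [apply Hd'; lra|].
  destruct (Hg x y ltac:(split; lra)) as [[_ k] [_ ->]]. easy.
Qed.

Lemma chart_image_open (i : idx S) (V : R -> R -> Prop) : open2 V ->
  (forall u v, V u v -> dom i (u, v)) ->
  is_open (fun x => exists u v, V u v /\ par i (u, v) = x).
Proof.
  intros HV HVd j. apply open_open2. intros u v [Hj [a [b [Hab E]]]].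
  assert (Hid : smooth_map (fun x : pt S => x)) by apply HS.
  destruct (smooth_map_local (fun x => x) j i u v a b V Hid Hj (HVd a b Hab))
    as [d [g1 [g2 [Hd0 [_ [_ [_ [_ Hg]]]]]]]]; [now symmetry|easy|easy|].
  destruct (dom_open j u v Hj) as [d' Hd'].
  exists (mkposreal (Rmin d d') ltac:(apply Rmin_pos; [easy|apply cond_pos])).
  intros x y Hx Hy. simpl in Hx, Hy.
  rmin d d'.
  split; [apply Hd'; lra|].
  destruct (Hg x y ltac:(split; lra)) as [k1 [k2 k3]].
  exists (g1 x y), (g2 x y). now split.
Qed.

End SurfaceTopology.

(** * Local graphs *)

Section Immersed.
Context {S : immersed_surface}.
Hypothesis (HS : is_smooth_surface S) (HI : is_immersion S).

Definition loc_x (i : idx S) (u v : R) : R := xc (local_imm i (u, v)).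
Definition loc_y (i : idx S) (u v : R) : R := yc (local_imm i (u, v)).
Definition loc_z (i : idx S) (u v : R) : R := zc (local_imm i (u, v)).

Lemma loc_smooth (i : idx S) :
  smooth_on (fun u v => dom i (u, v)) (loc_x i) /\
  smooth_on (fun u v => dom i (u, v)) (loc_y i) /\
  smooth_on (fun u v => dom i (u, v)) (loc_z i).
Proof.
  split; [|split].
  - apply (smooth_at_smooth_on _ (fun q => xc (local_imm i q))). intros; now apply HI.
  - apply (smooth_at_smooth_on _ (fun q => yc (local_imm i q))). intros; now apply HI.
  - apply (smooth_at_smooth_on _ (fun q => zc (local_imm i q))). intros; now apply HI.
Qed.

Lemma imm_pos (x : pt S) : 0 < zc (imm x).
Proof. apply HI. Qed.

Lemma local_imm_eta (i : idx S) u v :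
  local_imm i (u, v) = (loc_x i u v, loc_y i u v, loc_z i u v).
Proof. unfold loc_x, loc_y, loc_z. now destruct (local_imm i (u, v)) as [[? ?] ?]. Qed.

Lemma imm_box_open a b d :
  is_open (fun x : pt S => box a b d (xc (imm x)) (yc (imm x))).
Proof.
  intros i. apply open_open2. intros u v [H1 H2].
  destruct (loc_smooth i) as [Sx [Sy _]].
  apply locally_2d_and; [now apply (dom_open HS i)|].
  apply (continuity_box (loc_x i) (loc_y i) (box a b d)); [apply box_open| | |easy].
  - now apply (smooth_continuity (fun u v => dom i (u, v))).
  - now apply (smooth_continuity (fun u v => dom i (u, v))).
Qed.

(** The three minors are the coordinates of the cross product of the partial
    derivatives. *)
Lemma immersion_minors (i : idx S) u v : dom i (u, v) ->
  jacobian (loc_x i) (loc_y i) u v = 0 -> jacobian (loc_y i) (loc_z i) u v = 0 ->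
  jacobian (loc_z i) (loc_x i) u v = 0 -> False.
Proof.
  intros H J1 J2 J3. destruct HI as [_ HI']. destruct (HI' i (u, v) H) as [_ [_ [_ Hind]]].
  change (pd 1 0 (local_imm i) (u, v)) with
    (D1 (loc_x i) u v, D1 (loc_y i) u v, D1 (loc_z i) u v) in Hind.
  change (pd 0 1 (local_imm i) (u, v)) with
    (D2 (loc_x i) u v, D2 (loc_y i) u v, D2 (loc_z i) u v) in Hind.
  unfold xc, yc, zc in Hind. simpl in Hind. unfold jacobian in *.
  set (a1 := D1 (loc_x i) u v) in *. set (a2 := D1 (loc_y i) u v) in *.
  set (a3 := D1 (loc_z i) u v) in *. set (b1 := D2 (loc_x i) u v) in *.
  set (b2 := D2 (loc_y i) u v) in *. set (b3 := D2 (loc_z i) u v) in *.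
  destruct (Hind b1 (- a1)) as [h1 h1']; [lra|lra|lra|].
  destruct (Hind b2 (- a2)) as [h2 h2']; [lra|lra|lra|].
  destruct (Hind b3 (- a3)) as [h3 h3']; [lra|lra|lra|].
  destruct (Hind 1 0) as [h _]; lra.
Qed.

(** If the immersion reads as a graph over the plane near a point, then its
    horizontal projection is a local diffeomorphism there and the slope of
    the tangent plane is that of the graph. *)
Lemma graph_minors (i : idx S) (E : R -> R -> Prop) h u v : dom i (u, v) ->
  open2 E -> smooth_on E h -> E (loc_x i u v) (loc_y i u v) ->
  locally_2d (fun u v => loc_z i u v = h (loc_x i u v) (loc_y i u v)) u v ->
  let p := D1 h (loc_x i u v) (loc_y i u v) in
  let q := D2 h (loc_x i u v) (loc_y i u v) in
  let J := jacobian (loc_x i) (loc_y i) u v in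
  jacobian (loc_y i) (loc_z i) u v = - p * J /\
  jacobian (loc_z i) (loc_x i) u v = - q * J /\ J <> 0.
Proof.
  intros H HE Sh He Hl. cbv zeta. destruct (loc_smooth i) as [Sx [Sy Sz]].
  assert (Hd := smooth_differentiable E h HE Sh _ _ He).
  assert (Z1 : D1 (loc_z i) u v = D1 h (loc_x i u v) (loc_y i u v) * D1 (loc_x i) u v +
     D2 h (loc_x i u v) (loc_y i u v) * D1 (loc_y i) u v).
  { unfold D1 at 1. rewrite (Derive_ext_loc _ (fun t => h (loc_x i t v) (loc_y i t v))).
    - apply is_derive_unique.
      apply (derive_chain_2d h (fun t => loc_x i t v) (fun t => loc_y i t v)); [easy| |];
      now apply (smooth_derive1 (fun u v => dom i (u, v))).
    - now apply (locally_2d_1 (fun u v => loc_z i u v = h (loc_x i u v) (loc_y i u v))). }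
  assert (Z2 : D2 (loc_z i) u v = D1 h (loc_x i u v) (loc_y i u v) * D2 (loc_x i) u v +
     D2 h (loc_x i u v) (loc_y i u v) * D2 (loc_y i) u v).
  { unfold D2 at 1. rewrite (Derive_ext_loc _ (fun t => h (loc_x i u t) (loc_y i u t))).
    - apply is_derive_unique.
      apply (derive_chain_2d h (fun t => loc_x i u t) (fun t => loc_y i u t)); [easy| |];
      now apply (smooth_derive2 (fun u v => dom i (u, v))).
    - now apply (locally_2d_2 (fun u v => loc_z i u v = h (loc_x i u v) (loc_y i u v))). }
  assert (M1 : jacobian (loc_y i) (loc_z i) u v = - D1 h (loc_x i u v) (loc_y i u v) *
    jacobian (loc_x i) (loc_y i) u v) by (unfold jacobian; rewrite Z1, Z2; ring).
  assert (M2 : jacobian (loc_z i) (loc_x i) u v = - D2 h (loc_x i u v) (loc_y i u v) *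
    jacobian (loc_x i) (loc_y i) u v) by (unfold jacobian; rewrite Z1, Z2; ring).
  split; [easy|]. split; [easy|]. intros J0.
  rewrite J0 in M1, M2. apply (immersion_minors i u v H J0); lra.
Qed.

(** [tau] is a local inverse of the horizontal projection near [y], over the
    box of size [e]; there the surface is the graph of [h]. *)
Definition local_section (y : pt S) (e : R) (tau : R -> R -> pt S) (h : R -> R -> R)
  : Prop :=
  let B := box (xc (imm y)) (yc (imm y)) e in
  0 < e /\ tau (xc (imm y)) (yc (imm y)) = y /\
  (forall u v, B u v -> imm (tau u v) = (u, v, h u v)) /\
  smooth_on B h /\ (forall u v, B u v -> horo_graph_eq h u v) /\
  (forall O, is_open O -> open2 (fun u v => B u v /\ O (tau u v))) /\
  (forall V : R -> R -> Prop, open2 V -> (forall u v, V u v -> B u v) ->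
     is_open (fun x => exists u v, V u v /\ tau u v = x)).

Definition regular (y : pt S) : Prop := exists e tau h, local_section y e tau h.

Hypothesis (HN : is_unit_normal S).
Hypothesis (HH : forall (i : idx S) (q : R * R), dom i q ->
    mean_curvature (local_imm i) (local_normal i q) q =
    hyp (local_imm i q) (local_normal i q) (0, 0, 1)).

(** A horizontal normal would be orthogonal to all tangent vectors only if the
    tangent plane were vertical. *)
Lemma normal_not_horizontal (i : idx S) u v : dom i (u, v) ->
  jacobian (loc_x i) (loc_y i) u v <> 0 -> zc (local_normal i (u, v)) <> 0.
Proof.
  intros H HJ Hz. destruct (HN i (u, v) H) as [_ [_ [_ [H1 [H2 H3]]]]].
  change (pd 1 0 (local_imm i) (u, v)) with
    (D1 (loc_x i) u v, D1 (loc_y i) u v, D1 (loc_z i) u v) in H2.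
  change (pd 0 1 (local_imm i) (u, v)) with
    (D2 (loc_x i) u v, D2 (loc_y i) u v, D2 (loc_z i) u v) in H3.
  assert (Hp : 0 < zc (local_imm i (u, v))) by apply imm_pos.
  destruct (local_normal i (u, v)) as [[n1 n2] n3].
  unfold zc in Hz. simpl in Hz. subst n3.
  unfold hyp, dot3 in *. set (z := zc (local_imm i (u, v))) in *.
  unfold xc, yc, zc in H1, H2, H3. simpl in H1, H2, H3. unfold jacobian in HJ.
  set (a1 := D1 (loc_x i) u v) in *. set (a2 := D1 (loc_y i) u v) in *.
  set (b1 := D2 (loc_x i) u v) in *. set (b2 := D2 (loc_y i) u v) in *.
  assert (Hz' : / (z * (z * 1)) <> 0) by (apply Rinv_neq_0_compat; nra).
  assert (K1 : n1 * a1 + n2 * a2 = 0).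
  { apply (Rmult_eq_reg_r (/ (z * (z * 1)))); [|easy]. unfold Rdiv in H2. lra. }
  assert (K2 : n1 * b1 + n2 * b2 = 0).
  { apply (Rmult_eq_reg_r (/ (z * (z * 1)))); [|easy]. unfold Rdiv in H3. lra. }
  assert (N1 : n1 = 0).
  { apply (Rmult_eq_reg_l (a1 * b2 - b1 * a2)); [|easy].
    replace ((a1 * b2 - b1 * a2) * n1) with
      (b2 * (n1 * a1 + n2 * a2) - a2 * (n1 * b1 + n2 * b2)) by ring.
    rewrite K1, K2. ring. }
  assert (N2 : n2 = 0).
  { apply (Rmult_eq_reg_l (a1 * b2 - b1 * a2)); [|easy].
    replace ((a1 * b2 - b1 * a2) * n2) with
      (a1 * (n1 * b1 + n2 * b2) - b1 * (n1 * a1 + n2 * a2)) by ring.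
    rewrite K1, K2. ring. }
  rewrite N1, N2 in H1. unfold Rdiv in H1. lra.
Qed.

(** Where the tangent plane is not vertical, the inverse function theorem
    provides a local section. *)
Lemma regular_of_jacobian (i : idx S) u0 v0 : dom i (u0, v0) ->
  jacobian (loc_x i) (loc_y i) u0 v0 <> 0 -> regular (par i (u0, v0)).
Proof.
  intros H HJ. destruct (loc_smooth i) as [Sx [Sy Sz]].
  assert (HD := dom_open HS i).
  destruct (inverse_function _ (loc_x i) (loc_y i) u0 v0 HD Sx Sy H HJ)
    as [d [e [G1 [G2 [Hd [He [HdD [HdJ [Hinj [HG [SG1 SG2]]]]]]]]]]].
  set (h := fun a b => loc_z i (G1 a b) (G2 a b)).
  exists e, (fun a b => par i (G1 a b, G2 a b)), h.
  unfold local_section.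
  change (xc (imm (par i (u0, v0)))) with (loc_x i u0 v0).
  change (yc (imm (par i (u0, v0)))) with (loc_y i u0 v0).
  set (B := box (loc_x i u0 v0) (loc_y i u0 v0) e) in *.
  assert (HB : open2 B) by apply box_open.
  assert (Hc := box_center u0 v0 d Hd).
  assert (Hinv : forall x y, box u0 v0 d x y -> B (loc_x i x y) (loc_y i x y) ->
    G1 (loc_x i x y) (loc_y i x y) = x /\ G2 (loc_x i x y) (loc_y i x y) = y).
  { intros x y h1 h2. destruct (HG _ _ h2) as [k1 [k2 k3]]. now apply Hinj. }
  assert (Sh : smooth_on B h).
  { intros n. apply (Ck_comp n B (fun u v => dom i (u, v)) (loc_z i) G1 G2); auto.
    intros a b Hab. now apply HdD, HG. }
  split; [easy|]. split.
  { destruct (Hinv u0 v0 Hc) as [-> ->]; [now apply box_center|easy]. }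
  split.
  { intros a b Hab. destruct (HG a b Hab) as [k1 [k2 k3]].
    change (imm (par i (G1 a b, G2 a b))) with (local_imm i (G1 a b, G2 a b)).
    rewrite local_imm_eta, k2, k3. easy. }
  split; [easy|].
  set (D' := fun x y => box u0 v0 d x y /\ B (loc_x i x y) (loc_y i x y)).
  assert (HD' : forall V, open2 V -> open2 (fun x y => box u0 v0 d x y /\
    V (loc_x i x y) (loc_y i x y))).
  { intros V HV x y [h1 h2]. apply locally_2d_and; [now apply box_open|].
    apply (continuity_box (loc_x i) (loc_y i)); auto;
      apply (smooth_continuity (fun u v => dom i (u, v))); auto. }
  split; [|split].
  - intros a b Hab. destruct (HG a b Hab) as [k1 [k2 k3]].
    set (x := G1 a b) in *. set (y := G2 a b) in *.
    rewrite <- k2, <- k3.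
    assert (Hxy : D' x y).
    { split; [easy|]. now rewrite k2, k3. }
    assert (Hdx : dom i (x, y)) by now apply HdD.
    apply (graph_mean_curvature D' B (loc_x i) (loc_y i) h (local_imm i)
             (HD' B HB) HB) with (N := local_normal i (x, y)); auto.
    + intros n. apply (Ck_sub n (fun u v => dom i (u, v))); auto.
      intros s t [hs _]. now apply HdD.
    + intros n. apply (Ck_sub n (fun u v => dom i (u, v))); auto.
      intros s t [hs _]. now apply HdD.
    + now intros s t [_ hs].
    + intros s t [hs ht]. rewrite local_imm_eta. unfold h.
      destruct (Hinv s t hs ht) as [-> ->]. easy.
    + rewrite k2, k3. unfold h, loc_z. apply imm_pos.
    + now apply (HN i (x, y)).
    + now apply (HN i (x, y)).
    + apply normal_not_horizontal; auto.
  - intros O HO a b [Hab HOab]. apply locally_2d_and; [now apply HB|].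
    assert (Hl : locally_2d (fun x y => dom i (G1 x y, G2 x y) /\
       O (par i (G1 x y, G2 x y))) a b).
    { apply (continuity_box G1 G2 (fun x y => dom i (x, y) /\ O (par i (x, y)))).
      - exact (proj1 (open_open2 (fun q => dom i q /\ O (par i q))) (HO i)).
      - now apply (smooth_continuity B).
      - now apply (smooth_continuity B).
      - split; [|easy]. now apply HdD, HG. }
    revert Hl. apply locally_2d_impl, locally_2d_forall. tauto.
  - intros V HV HVB.
    apply (is_open_ext (fun x => exists s t,
      (box u0 v0 d s t /\ V (loc_x i s t) (loc_y i s t)) /\ par i (s, t) = x)).
    + intros x. split.
      * intros [s [t [[h1 h2] E]]]. exists (loc_x i s t), (loc_y i s t). split; [easy|].
        destruct (Hinv s t h1 (HVB _ _ h2)) as [-> ->]. easy.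
      * intros [a [b [Hab E]]]. exists (G1 a b), (G2 a b). split; [|easy].
        destruct (HG a b (HVB _ _ Hab)) as [k1 [k2 k3]]. split; [easy|].
        now rewrite k2, k3.
    + apply (chart_image_open HS); [now apply HD'|].
      intros s t [hs _]. now apply HdD.
Qed.

End Immersed.

(** * Rotational symmetry *)

Lemma polar_coordinates (u v : R) : exists t,
  u = cos t * sqrt (u ^ 2 + v ^ 2) /\ v = sin t * sqrt (u ^ 2 + v ^ 2).
Proof.
  assert (Hpos : forall u v, 0 < u -> u = cos (atan (v / u)) * sqrt (u ^ 2 + v ^ 2) /\
    v = sin (atan (v / u)) * sqrt (u ^ 2 + v ^ 2)).
  { intros a b Ha. rewrite cos_atan, sin_atan. unfold Rsqr.
    replace (a ^ 2 + b ^ 2) with (a ^ 2 * (1 + b / a * (b / a))) by (field; lra).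
    rewrite sqrt_mult_alt by nra. rewrite sqrt_pow2 by lra.
    assert (0 < sqrt (1 + b / a * (b / a))).
    { apply sqrt_lt_R0. assert (h := pow2_ge_0 (b / a)). simpl in h. lra. }
    split; field; lra. }
  destruct (Rtotal_order u 0) as [Hu|[->|Hu]].
  - destruct (Hpos (- u) (- v)) as [h1 h2]; [lra|].
    replace ((- u) ^ 2 + (- v) ^ 2) with (u ^ 2 + v ^ 2) in h1, h2 by ring.
    exists (atan (- v / - u) + PI). rewrite neg_cos, neg_sin. lra.
  - replace (0 ^ 2 + v ^ 2) with (v ^ 2) by ring.
    destruct (Rle_dec 0 v) as [Hv|Hv].
    + exists (PI / 2). rewrite cos_PI2, sin_PI2, sqrt_pow2 by easy. lra.
    + exists (- (PI / 2)). rewrite cos_neg, sin_neg, cos_PI2, sin_PI2.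
      replace (v ^ 2) with ((- v) ^ 2) by ring. rewrite sqrt_pow2 by lra. lra.
  - exists (atan (v / u)). now apply Hpos.
Qed.

Lemma arc_bounds (s t : R) : - (PI / 2) < t < PI / 2 -> Rmin 0 t <= s <= Rmax 0 t ->
  cos t <= cos s <= 1 /\ Rabs (sin s) <= Rabs (sin t).
Proof.
  intros Ht Hs.
  assert (Hc : cos t <= cos s).
  { destruct (Rle_dec 0 t) as [h|h].
    - rewrite Rmin_left, Rmax_right in Hs by lra. apply cos_decr_1; lra.
    - rewrite Rmin_right, Rmax_left in Hs by lra.
      rewrite <- (cos_neg t), <- (cos_neg s). apply cos_decr_1; lra. }
  assert (Hc0 : 0 <= cos t) by (apply cos_ge_0; lra).
  split; [split; [easy|apply COS_bound]|].
  apply Rsqr_le_abs_0. rewrite !sin2. unfold Rsqr. nra.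
Qed.

Section Rotational.
Context {S : immersed_surface}.
Hypotheses (HS : is_smooth_surface S) (HI : is_immersion S).
Variable act : R -> pt S -> pt S.
Hypotheses
  (A0 : forall x, act 0 x = x)
  (AD : forall s t x, act (s + t) x = act s (act t x))
  (AS : forall t, smooth_map (act t))
  (AC : forall (x : pt S) (O : pt S -> Prop), is_open O -> open (fun t : R => O (act t x)))
  (AR : forall t x, imm (act t x) = rot t (imm x)).

Lemma act_neg t x : act (- t) (act t x) = x.
Proof. rewrite <- AD. replace (- t + t) with 0 by ring. apply A0. Qed.

Lemma act_open t O : is_open O -> is_open (fun x => O (act t x)).
Proof. intros HO. apply (smooth_map_continuous HS (act t)); [apply HS|apply AS|easy]. Qed.

Lemma act_local t x O : is_open O -> O (act t x) ->
  exists d, 0 < d /\ forall s, Rabs s < d -> O (act (t + s) x).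
Proof.
  intros HO H. destruct (AC x O HO t H) as [d Hd]. exists d. split; [apply cond_pos|].
  intros s Hs. apply Hd. change (Rabs (t + s - t) < d).
  now replace (t + s - t) with s by ring.
Qed.

(** ** Local sections are equivariant *)

Section Section_.
Variables (y : pt S) (e : R) (tau : R -> R -> pt S) (h : R -> R -> R).
Hypothesis (HL : local_section y e tau h).
Let B := box (xc (imm y)) (yc (imm y)) e.

(** Small rotations keep a point of the section in its image, where the
    horizontal projection is injective. *)
Lemma section_act_local u v : B u v -> exists d, 0 < d /\ forall s, Rabs s < d ->
  act s (tau u v) = tau (cos s * u - sin s * v) (sin s * u + cos s * v).
Proof.
  intros H. destruct HL as [He [_ [Himm [_ [_ [_ Hop]]]]]].
  assert (HO := Hop B (box_open _ _ _) (fun _ _ h => h)).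
  destruct (act_local 0 (tau u v) _ HO) as [d [Hd Hd']].
  { rewrite A0. now exists u, v. }
  exists d. split; [easy|]. intros s Hs.
  destruct (Hd' s Hs) as [a [b [Hab E]]]. rewrite Rplus_0_l in E.
  assert (Ei : imm (tau a b) = rot s (imm (tau u v))) by (rewrite E; apply AR).
  rewrite !Himm in Ei by easy. unfold rot, xc, yc, zc in Ei. simpl in Ei.
  injection Ei as E1 E2 _. now rewrite <- E, E1, E2.
Qed.

(** The local statement holds along the whole arc by connectedness, as long as
    the arc stays in the box. *)
Lemma section_act_arc u v t :
  (forall s, Rmin 0 t <= s <= Rmax 0 t ->
     B (cos s * u - sin s * v) (sin s * u + cos s * v)) ->
  act t (tau u v) = tau (cos t * u - sin t * v) (sin t * u + cos t * v).
Proof.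
  intros HB.
  set (P := fun s => act s (tau u v) = tau (cos s * u - sin s * v) (sin s * u + cos s * v)).
  assert (HP : forall s, Rmin 0 t <= s <= Rmax 0 t -> (P s <-> P (Rmin 0 t))).
  { apply interval_locally_constant.
    intros s Hs. destruct (section_act_local _ _ (HB s Hs)) as [d [Hd Hd']].
    exists d. split; [easy|]. intros s' Hs' Hss. unfold P.
    specialize (Hd' (s' - s) Hss).
    set (a := cos s * u - sin s * v) in *. set (b := sin s * u + cos s * v) in *.
    replace (cos s' * u - sin s' * v) with (cos (s' - s) * a - sin (s' - s) * b).
    2:{ unfold a, b. replace s' with ((s' - s) + s) at 3 4 by ring.
        rewrite cos_plus, sin_plus. ring. }
    replace (sin s' * u + cos s' * v) with (sin (s' - s) * a + cos (s' - s) * b).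
    2:{ unfold a, b. replace s' with ((s' - s) + s) at 3 4 by ring.
        rewrite cos_plus, sin_plus. ring. }
    rewrite <- Hd'. replace s' with ((s' - s) + s) at 1 by ring. rewrite AD.
    split; [|now intros ->]. intros E.
    rewrite <- (act_neg (s' - s) (act s (tau u v))), E. apply act_neg. }
  assert (h0 : Rmin 0 t <= 0 <= Rmax 0 t) by (split; [apply Rmin_l|apply Rmax_l]).
  assert (ht : Rmin 0 t <= t <= Rmax 0 t) by (split; [apply Rmin_r|apply Rmax_r]).
  apply (HP t ht), (HP 0 h0). unfold P. rewrite A0, cos_0, sin_0. f_equal; ring.
Qed.

Lemma section_height_act u v a b t : B u v -> B a b ->
  act t (tau u v) = tau a b -> h a b = h u v.
Proof.
  intros H H' E. destruct HL as [He [_ [Himm _]]].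
  assert (Ei : imm (tau a b) = rot t (imm (tau u v))) by (rewrite <- E; apply AR).
  rewrite !Himm in Ei by easy. now injection Ei.
Qed.

Hypothesis (Hy : yc (imm y) = 0).

(** Points of the box are rotated onto the half-line without leaving it. *)
Lemma section_polar u v : 0 < u -> B u v -> B (sqrt (u ^ 2 + v ^ 2)) 0 ->
  exists t, act t (tau (sqrt (u ^ 2 + v ^ 2)) 0) = tau u v.
Proof.
  intros Hu [H1 H2] [H3 H4]. rewrite Hy in *. set (r := sqrt (u ^ 2 + v ^ 2)) in *.
  assert (Hr : 0 <= r) by apply sqrt_pos.
  set (t := atan (v / u)).
  assert (Ht : u = cos t * r /\ v = sin t * r).
  { unfold t. rewrite cos_atan, sin_atan. unfold Rsqr, r.
    replace (u ^ 2 + v ^ 2) with (u ^ 2 * (1 + v / u * (v / u))) by (field; lra).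
    rewrite sqrt_mult_alt by nra. rewrite sqrt_pow2 by lra.
    assert (0 < sqrt (1 + v / u * (v / u))).
    { apply sqrt_lt_R0. assert (k := pow2_ge_0 (v / u)). simpl in k. lra. }
    split; field; lra. }
  destruct Ht as [T1 T2]. exists t.
  rewrite section_act_arc.
  - f_equal; lra.
  - intros s Hs. assert (Hat := atan_bound (v / u)). fold t in Hat.
    destruct (arc_bounds s t ltac:(lra) Hs) as [[k1 k2] k3].
    rewrite Rmult_0_r, Rmult_0_r, Rminus_0_r, Rplus_0_r. split; rewrite ?Hy.
    + assert (u <= cos s * r <= r) by (rewrite T1 at 1; nra).
      apply Rabs_def2 in H1, H3. apply Rabs_def1; lra.
    + rewrite Rminus_0_r in *. rewrite T2, Rabs_mult in H2. rewrite Rabs_mult.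
      assert (k := Rabs_pos r). nra.
Qed.

Lemma section_radial_height u v : 0 < u -> B u v -> B (sqrt (u ^ 2 + v ^ 2)) 0 ->
  h u v = h (sqrt (u ^ 2 + v ^ 2)) 0.
Proof.
  intros Hu H1 H2. destruct (section_polar u v Hu H1 H2) as [t Ht].
  now apply section_height_act with t.
Qed.

(** The equation of graphs at a point of the half-line becomes the profile
    equation, because [h_v = 0] and [h_vv = h_u / r] there. *)
Lemma section_ode r : 0 < r -> B r 0 ->
  is_derive (fun r => h r 0) r (D1 h r 0) /\
  is_derive (fun r => D1 h r 0) r (profile_rhs r (h r 0) (D1 h r 0)).
Proof.
  intros Hr HB. destruct HL as [He [_ [Himm [Sh [Heq _]]]]]. fold B in Sh, Heq, Himm.
  assert (HBo : open2 B) by apply box_open.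
  assert (S1 := smooth_D1 B h HBo Sh).
  assert (Hs0 : sqrt (r ^ 2 + 0 ^ 2) = r).
  { replace (r ^ 2 + 0 ^ 2) with (r ^ 2) by ring. apply sqrt_pow2. lra. }
  assert (Hds : forall v, is_derive (fun v => sqrt (r ^ 2 + v ^ 2)) v (v / sqrt (r ^ 2 + v ^ 2))).
  { intros v. assert (0 < r ^ 2 + v ^ 2) by nra.
    auto_derive; [lra|].
    replace (r * (r * 1) + v * (v * 1)) with (r ^ 2 + v ^ 2) by ring.
    field. apply Rgt_not_eq, sqrt_lt_R0. easy. }
  assert (Hloc : exists d, 0 < d /\ forall v, Rabs v < d ->
    B r v /\ B (sqrt (r ^ 2 + v ^ 2)) 0).
  { destruct (HBo r 0 HB) as [d1 Hd1].
    assert (Hc := is_derive_continuity_pt _ _ _ (Hds 0)).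
    destruct (proj1 (continuity_pt_eps _ _) Hc d1 (cond_pos d1)) as [d2 [Hd2 Hd2']].
    exists (Rmin d1 d2). split; [apply Rmin_pos; [apply cond_pos|easy]|].
    intros v Hv. rmin d1 d2.
    specialize (Hd2' v ltac:(rewrite Rminus_0_r; lra)). rewrite Hs0 in Hd2'.
    assert (h3 := cond_pos d1).
    split; apply Hd1; rewrite ?Rminus_diag, ?Rabs_R0, ?Rminus_0_r; lra. }
  destruct Hloc as [d [Hd Hd']].
  set (K := fun v => D1 h (sqrt (r ^ 2 + v ^ 2)) 0 * / sqrt (r ^ 2 + v ^ 2)).
  assert (Hhv : forall v, Rabs v < d -> D2 h r v = v * K v).
  { intros v Hv. unfold D2.
    rewrite (Derive_ext_loc _ (fun v => h (sqrt (r ^ 2 + v ^ 2)) 0)).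
    - apply is_derive_unique. eapply is_derive_value.
      { apply (derive_chain (fun x => h x 0) (fun v => sqrt (r ^ 2 + v ^ 2))); [|apply Hds].
        apply (smooth_derive1 B); [easy|]. now apply Hd'. }
      unfold K. field. apply Rgt_not_eq, sqrt_lt_R0. nra.
    - assert (Hw : forall w : R, Rabs (w - v) < d - Rabs v ->
        h r w = h (sqrt (r ^ 2 + w ^ 2)) 0).
      { intros w Hw. assert (k := Rabs_triang (w - v) v).
        replace (w - v + v) with w in k by ring.
        apply section_radial_height; [easy| |]; apply Hd'; lra. }
      exists (mkposreal (d - Rabs v) ltac:(lra)). exact Hw. }
  assert (E2 : D2 h r 0 = 0).
  { rewrite Hhv by (rewrite Rabs_R0; easy). ring. }
  assert (E22 : D2 (D2 h) r 0 = D1 h r 0 / r).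
  { unfold D2 at 1. rewrite (Derive_ext_loc _ (fun v => v * K v)).
    - apply is_derive_unique. eapply is_derive_value.
      { apply (derive_mul (fun v => v) K 0 1); [apply @is_derive_id|].
        apply derive_mul.
        - apply (derive_chain (fun x => D1 h x 0) (fun v => sqrt (r ^ 2 + v ^ 2))); [|apply Hds].
          rewrite Hs0. apply (smooth_derive1 B); [apply S1|easy].
        - apply (derive_inv (fun v => sqrt (r ^ 2 + v ^ 2))); [apply Hds|].
          rewrite Hs0. lra. }
      unfold K. rewrite Hs0. field. lra.
    - exists (mkposreal d Hd). intros w Hw. apply Hhv.
      change (Rabs (w - 0) < d) in Hw. now rewrite Rminus_0_r in Hw. }
  split; [now apply (smooth_derive1 B)|].
  eapply is_derive_value; [apply (smooth_derive1 B); [apply S1|easy]|].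
  specialize (Heq r 0 HB). unfold horo_graph_eq in Heq. rewrite E2, E22 in Heq.
  unfold profile_rhs.
  replace (D1 (D1 h) r 0) with
    (D1 (D1 h) r 0 * (1 + 0 ^ 2) - 2 * D1 (D2 h) r 0 * (D1 h r 0 * 0) +
      D1 h r 0 / r * (1 + D1 h r 0 ^ 2) - D1 h r 0 / r * (1 + D1 h r 0 ^ 2)) by ring.
  rewrite Heq. ring.
Qed.

Hypothesis (Hx : xc (imm y) = 0).

Lemma section_axis_act u t : Rabs u < e ->
  B (cos t * u) (sin t * u) /\ act t (tau u 0) = tau (cos t * u) (sin t * u).
Proof.
  intros Hu.
  assert (HB : forall s, B (cos s * u) (sin s * u)).
  { intros s. assert (c1 := COS_bound s). assert (c2 := SIN_bound s).
    assert (k := Rabs_pos u).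
    assert (c1' : Rabs (cos s) <= 1) by (apply Rabs_le; lra).
    assert (c2' : Rabs (sin s) <= 1) by (apply Rabs_le; lra).
    split; rewrite ?Hx, ?Hy, Rminus_0_r, Rabs_mult; nra. }
  split; [easy|]. rewrite section_act_arc.
  - f_equal; ring.
  - intros s _. rewrite Rmult_0_r, Rmult_0_r, Rminus_0_r, Rplus_0_r. apply HB.
Qed.

(** Turning by [PI] shows that [h] is even along the first axis. *)
Lemma section_axis_slope : D1 h 0 0 = 0.
Proof.
  destruct HL as [He [_ [Himm [Sh [Heq _]]]]]. fold B in Sh, Heq, Himm.
  assert (HB0 : B 0 0).
  { split; rewrite ?Hx, ?Hy, Rminus_diag, Rabs_R0; easy. }
  assert (Hd : is_derive (fun u => h u 0) 0 (D1 h 0 0)) by now apply (smooth_derive1 B).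
  assert (Heven : forall u, Rabs u < e -> h (- u) 0 = h u 0).
  { intros u Hu. destruct (section_axis_act u PI Hu) as [k1 k2].
    destruct (section_axis_act u 0 Hu) as [k3 _].
    rewrite cos_PI, sin_PI in *. rewrite cos_0, sin_0 in k3.
    replace (-1 * u) with (- u) in * by ring. rewrite Rmult_0_l in *. rewrite Rmult_1_l in k3.
    now apply section_height_act with PI. }
  assert (Hd' : is_derive (fun u => h u 0) 0 (D1 h 0 0 * (- 1))).
  { apply (derive_ext_near (fun u => h (- u) 0) _ 0 _ e He).
    - intros u Hu. apply Heven. now rewrite Rminus_0_r in Hu.
    - apply (derive_chain (fun u => h u 0) (fun u => - u)).
      + now rewrite Ropp_0.
      + auto_derive; [easy|ring]. }
  apply is_derive_unique in Hd. apply is_derive_unique in Hd'. lra.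
Qed.

End Section_.

(** ** Points on the axis *)

(** Two of the coordinates of the immersion form a local diffeomorphism. *)
Lemma locally_injective (i : idx S) u v : dom i (u, v) ->
  exists d, 0 < d /\ (forall x y, box u v d x y -> dom i (x, y)) /\
    forall x y x' y', box u v d x y -> box u v d x' y' ->
      local_imm i (x, y) = local_imm i (x', y') -> x = x' /\ y = y'.
Proof.
  intros H. destruct (loc_smooth HI i) as [Sx [Sy Sz]]. assert (HD := dom_open HS i).
  assert (Hgen : forall F1 F2 : R -> R -> R, smooth_on (fun u v => dom i (u, v)) F1 ->
    smooth_on (fun u v => dom i (u, v)) F2 -> jacobian F1 F2 u v <> 0 ->
    (forall x y x' y', local_imm i (x, y) = local_imm i (x', y') ->
       F1 x y = F1 x' y' /\ F2 x y = F2 x' y') ->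
    exists d, 0 < d /\ (forall x y, box u v d x y -> dom i (x, y)) /\
    forall x y x' y', box u v d x y -> box u v d x' y' ->
      local_imm i (x, y) = local_imm i (x', y') -> x = x' /\ y = y').
  { intros F1 F2 S1 S2 HJ HF.
    destruct (inverse_function _ F1 F2 u v HD S1 S2 H HJ)
      as [d [_ [_ [_ [Hd [_ [HdD [_ [Hinj _]]]]]]]]].
    exists d. split; [easy|]. split; [easy|]. intros x y x' y' h h' E.
    destruct (HF _ _ _ _ E). now apply Hinj. }
  assert (Hloc : forall x y x' y', local_imm i (x, y) = local_imm i (x', y') ->
    loc_x i x y = loc_x i x' y' /\ loc_y i x y = loc_y i x' y' /\ loc_z i x y = loc_z i x' y').
  { intros x y x' y' E. unfold loc_x, loc_y, loc_z. now rewrite E. }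
  destruct (Req_dec (jacobian (loc_x i) (loc_y i) u v) 0) as [J1|J1].
  2:{ apply (Hgen (loc_x i) (loc_y i)); auto. intros; split; now apply Hloc. }
  destruct (Req_dec (jacobian (loc_y i) (loc_z i) u v) 0) as [J2|J2].
  2:{ apply (Hgen (loc_y i) (loc_z i)); auto. intros; split; now apply Hloc. }
  destruct (Req_dec (jacobian (loc_z i) (loc_x i) u v) 0) as [J3|J3].
  2:{ apply (Hgen (loc_z i) (loc_x i)); auto. intros; split; now apply Hloc. }
  exfalso. now apply (immersion_minors HI i u v).
Qed.

Lemma rot_axis t P : on_axis P -> rot t P = P.
Proof.
  destruct P as [[a b] c]. unfold on_axis, rot, xc, yc, zc. simpl. intros [-> ->].
  f_equal. f_equal; ring.
Qed.

(** All points of the orbit have the same image, while the immersion is locally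
    injective; so the orbit stays at [x] for a while, hence for ever. *)
Lemma axis_fixed_small x : on_axis (imm x) ->
  exists d, 0 < d /\ forall t, Rabs t < d -> act t x = x.
Proof.
  intros Hx. destruct (chart_at HS x) as [i [u [v [Hd E]]]].
  destruct (locally_injective i u v Hd) as [d [Hd0 [HdD Hinj]]].
  assert (HO := chart_image_open HS i (box u v d) (box_open _ _ _) HdD).
  destruct (act_local 0 x _ HO) as [d' [Hd' H]].
  { rewrite A0. exists u, v. split; [now apply box_center|easy]. }
  exists d'. split; [easy|]. intros t Ht. destruct (H t Ht) as [a [b [Hab Eab]]].
  rewrite Rplus_0_l in Eab. rewrite <- Eab, <- E.
  destruct (Hinj a b u v Hab (box_center u v d Hd0)) as [-> ->]; [|easy].
  unfold local_imm. rewrite Eab, E, AR. now apply rot_axis.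
Qed.

Lemma axis_fixed x t : on_axis (imm x) -> act t x = x.
Proof.
  intros Hx. destruct (axis_fixed_small x Hx) as [d [Hd H]].
  destruct (INR_unbounded (Rabs t / d)) as [n Hn].
  assert (Hn0 : 0 < INR n).
  { eapply Rle_lt_trans; [|exact Hn]. apply Rdiv_le_0_compat; [apply Rabs_pos|easy]. }
  assert (Hs : act (t / INR n) x = x).
  { apply H. unfold Rdiv. rewrite Rabs_mult, Rabs_inv, (Rabs_pos_eq (INR n)) by lra.
    apply Rmult_lt_reg_r with (INR n / d); [now apply Rdiv_lt_0_compat|].
    replace (Rabs t * / INR n * (INR n / d)) with (Rabs t / d) by (field; lra).
    replace (d * (INR n / d)) with (INR n) by (field; lra). easy. }
  assert (Hm : forall m, act (INR m * (t / INR n)) x = x).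
  { induction m as [|m IH]; [rewrite Rmult_0_l; apply A0|].
    rewrite S_INR, Rmult_plus_distr_r, Rmult_1_l, AD, Hs. easy. }
  rewrite <- (Hm n) at 2. f_equal. field. lra.
Qed.

(** The tangent plane at a fixed point is invariant under rotations, hence
    horizontal. *)
Lemma axis_horizontal (i : idx S) u v : dom i (u, v) -> on_axis (imm (par i (u, v))) ->
  jacobian (loc_x i) (loc_y i) u v <> 0.
Proof.
  intros Hd Hax J3.
  assert (Hfix := axis_fixed (par i (u, v)) 1 Hax).
  assert (HD := dom_open HS i).
  destruct (smooth_map_local HS (act 1) i i u v u v (fun x y => dom i (x, y)) (AS 1) Hd Hd Hfix HD Hd)
    as [d [g1 [g2 [Hd0 [S1 [S2 [E1 [E2 Hg]]]]]]]].
  destruct (loc_smooth HI i) as [Sx [Sy Sz]].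
  assert (Hc := box_center u v d Hd0).
  assert (HB := box_open u v d).
  assert (HgD : forall x y, box u v d x y -> dom i (g1 x y, g2 x y)) by (intros; now apply Hg).
  (* the chain rule for the equivariance of the immersion *)
  assert (Hco : forall x y, box u v d x y -> local_imm i (g1 x y, g2 x y) =
    rot 1 (local_imm i (x, y))).
  { intros x y Hxy. unfold local_imm. destruct (Hg x y Hxy) as [_ [_ <-]]. apply AR. }
  assert (Hco' : forall x y, box u v d x y ->
    loc_x i (g1 x y) (g2 x y) = cos 1 * loc_x i x y + (- sin 1) * loc_y i x y /\
    loc_y i (g1 x y) (g2 x y) = sin 1 * loc_x i x y + cos 1 * loc_y i x y /\
    loc_z i (g1 x y) (g2 x y) = loc_z i x y).
  { intros x y Hxy. unfold loc_x, loc_y, loc_z. rewrite Hco by easy.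
    unfold rot. set (P := local_imm i (x, y)).
    split; [|split]; cbn [xc yc zc fst snd]; easy || (unfold xc, yc; simpl; ring). }
  assert (L : forall c1 c2 (F : R -> R -> R), smooth_on (fun u v => dom i (u, v)) F ->
    (forall x y, box u v d x y -> F (g1 x y) (g2 x y) = c1 * loc_x i x y + c2 * loc_y i x y) ->
    D1 F u v * D1 g1 u v + D2 F u v * D1 g2 u v =
      c1 * D1 (loc_x i) u v + c2 * D1 (loc_y i) u v /\
    D1 F u v * D2 g1 u v + D2 F u v * D2 g2 u v =
      c1 * D2 (loc_x i) u v + c2 * D2 (loc_y i) u v).
  { intros c1 c2 F SF HF.
    assert (C1 := comp_D1 _ _ g1 g2 HD S1 S2 HgD F u v SF Hc).
    assert (C2 := comp_D2 _ _ g1 g2 HD S1 S2 HgD F u v SF Hc).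
    rewrite E1, E2 in C1, C2. rewrite <- C1, <- C2.
    rewrite (D1_ext _ _ _ u v HB HF Hc), (D2_ext _ _ _ u v HB HF Hc).
    split; apply is_derive_unique.
    - apply (derive_add (fun t => c1 * loc_x i t v) (fun t => c2 * loc_y i t v)).
      + apply (is_derive_scal (fun t => loc_x i t v)).
        now apply (smooth_derive1 (fun u v => dom i (u, v))).
      + apply (is_derive_scal (fun t => loc_y i t v)).
        now apply (smooth_derive1 (fun u v => dom i (u, v))).
    - apply (derive_add (fun t => c1 * loc_x i u t) (fun t => c2 * loc_y i u t)).
      + apply (is_derive_scal (fun t => loc_x i u t)).
        now apply (smooth_derive2 (fun u v => dom i (u, v))).
      + apply (is_derive_scal (fun t => loc_y i u t)).
        now apply (smooth_derive2 (fun u v => dom i (u, v))). }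
  destruct (L (cos 1) (- sin 1) (loc_x i) Sx ltac:(intros; now apply Hco')) as [X1 X2].
  destruct (L (sin 1) (cos 1) (loc_y i) Sy ltac:(intros; now apply Hco')) as [Y1 Y2].
  assert (Z : D1 (loc_z i) u v * D1 g1 u v + D2 (loc_z i) u v * D1 g2 u v = D1 (loc_z i) u v /\
    D1 (loc_z i) u v * D2 g1 u v + D2 (loc_z i) u v * D2 g2 u v = D2 (loc_z i) u v).
  { assert (C1 := comp_D1 _ _ g1 g2 HD S1 S2 HgD (loc_z i) u v Sz Hc).
    assert (C2 := comp_D2 _ _ g1 g2 HD S1 S2 HgD (loc_z i) u v Sz Hc).
    rewrite E1, E2 in C1, C2. rewrite <- C1, <- C2.
    split; [apply (D1_ext (box u v d))|apply (D2_ext (box u v d))]; auto;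
      intros; now apply Hco'. }
  destruct Z as [Z1 Z2].
  set (al := D1 g1 u v) in *. set (be := D1 g2 u v) in *.
  set (ga := D2 g1 u v) in *. set (de := D2 g2 u v) in *.
  assert (HJ := immersion_minors HI i u v Hd J3).
  unfold jacobian in *.
  set (a1 := D1 (loc_x i) u v) in *. set (a2 := D1 (loc_y i) u v) in *.
  set (a3 := D1 (loc_z i) u v) in *. set (b1 := D2 (loc_x i) u v) in *.
  set (b2 := D2 (loc_y i) u v) in *. set (b3 := D2 (loc_z i) u v) in *.
  set (n1 := a2 * b3 - b2 * a3) in *. set (n2 := a3 * b1 - b3 * a1) in *.
  set (lam := al * de - be * ga).
  (* the cross product is an eigenvector of the rotation *)
  assert (R1 : cos 1 * n1 - sin 1 * n2 = lam * n1).
  { replace (cos 1 * n1 - sin 1 * n2) with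
      ((sin 1 * a1 + cos 1 * a2) * b3 - (sin 1 * b1 + cos 1 * b2) * a3)
      by (unfold n1, n2; ring).
    rewrite <- Y1, <- Y2.
    transitivity ((a2 * al + b2 * be) * (a3 * ga + b3 * de) -
                  (a2 * ga + b2 * de) * (a3 * al + b3 * be)).
    - now rewrite Z1, Z2.
    - unfold lam, n1. ring. }
  assert (R2 : sin 1 * n1 + cos 1 * n2 = lam * n2).
  { replace (sin 1 * n1 + cos 1 * n2) with
      (a3 * (cos 1 * b1 + - sin 1 * b2) - b3 * (cos 1 * a1 + - sin 1 * a2))
      by (unfold n1, n2; ring).
    rewrite <- X1, <- X2.
    transitivity ((a3 * al + b3 * be) * (a1 * ga + b1 * de) -
                  (a3 * ga + b3 * de) * (a1 * al + b1 * be)).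
    - now rewrite Z1, Z2.
    - unfold lam, n2. ring. }
  assert (Hsin : 0 < sin 1).
  { apply sin_gt_0; [lra|]. assert (k := PI2_1). lra. }
  assert (Hn : n1 ^ 2 + n2 ^ 2 <= 0).
  { assert (k : sin 1 * (n1 ^ 2 + n2 ^ 2) = 0).
    { replace (sin 1 * (n1 ^ 2 + n2 ^ 2)) with
        (n1 * (sin 1 * n1 + cos 1 * n2) - n2 * (cos 1 * n1 - sin 1 * n2)) by ring.
      rewrite R1, R2. ring. }
    apply Rmult_integral in k. lra. }
  assert (N1 := sum_sqr_le_0 _ _ Hn). rewrite Rplus_comm in Hn.
  assert (N2 := sum_sqr_le_0 _ _ Hn). now apply HJ.
Qed.

End Rotational.

(** * The rotational entire graphs *)

Definition everywhere (u v : R) : Prop := True.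

Lemma everywhere_open : open2 everywhere.
Proof. intros u v _. now apply locally_2d_forall. Qed.

Lemma continuous_pair (f : R * R -> R) u v :
  continuity_2d_pt (fun x y => f (x, y)) u v -> continuous f (u, v).
Proof.
  intros H. apply continuity_2d_pt_filterlim in H.
  apply (filterlim_ext (fun z => f (fst z, snd z))); [now intros [x y]|exact H].
Qed.

Lemma plane_smooth : is_smooth_surface plane.
Proof.
  split; [intros i; apply open_true|]. split; [easy|].
  split; [exists (fun _ => tt); intros x; now exists O, x|].
  split.
  - intros i j q p _ _ _. exists (fun w => w). apply filter_forall.
    intros w. split; [|split; [|easy]].
    + apply (smooth_on_smooth_at everywhere (fun u _ => u)); [apply everywhere_open| |easy].
      intros n. apply Ck_fst.
    + apply (smooth_on_smooth_at everywhere (fun _ v => v)); [apply everywhere_open| |easy].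
      intros n. apply Ck_snd.
  - intros [a b] [a' b'] Hn.
    assert (Hop : forall x y d, @is_open plane (fun q => box x y d (fst q) (snd q))).
    { intros x y d i. apply open_open2. intros u v [_ h].
      apply locally_2d_impl with (2 := box_open _ _ _ _ _ h).
      apply locally_2d_forall. simpl. tauto. }
    set (d := (Rabs (a - a') + Rabs (b - b')) / 4).
    exists (fun q => box a b d (fst q) (snd q)), (fun q => box a' b' d (fst q) (snd q)).
    assert (Hd : 0 < d).
    { unfold d. assert (h1 := Rabs_pos (a - a')). assert (h2 := Rabs_pos (b - b')).
      destruct (Req_dec a a') as [->|Ha].
      - assert (Hb : b <> b') by (intros ->; now apply Hn).
        assert (h := Rabs_pos_lt (b - b') ltac:(lra)). lra.
      - assert (h := Rabs_pos_lt (a - a') ltac:(lra)). lra. }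
    split; [apply Hop|]. split; [apply Hop|].
    split; [now apply box_center|]. split; [now apply box_center|].
    intros [x y] [[h1 h2] [h3 h4]]. simpl in *.
    assert (k1 := Rabs_triang (x - a') (a - x)). assert (k2 := Rabs_triang (y - b') (b - y)).
    replace (x - a' + (a - x)) with (a - a') in k1 by ring.
    replace (y - b' + (b - y)) with (b - b') in k2 by ring.
    rewrite (Rabs_minus_sym a x) in k1. rewrite (Rabs_minus_sym b y) in k2.
    unfold d in *. lra.
Qed.

(** Any two points are joined by a segment. *)
Lemma plane_connected : connected plane.
Proof.
  split; [now exists (0, 0)|]. intros O HO HO' [[a b] Hx] [a' b'].
  set (P := fun t => O (a + t * (a' - a), b + t * (b' - b))).
  set (N := Rabs (a' - a) + Rabs (b' - b) + 1).
  assert (HN : 0 < N).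
  { assert (h1 := Rabs_pos (a' - a)). assert (h2 := Rabs_pos (b' - b)). unfold N. lra. }
  assert (Hloc : forall O : R * R -> Prop, @is_open plane O -> forall t,
    O (a + t * (a' - a), b + t * (b' - b)) -> exists d, 0 < d /\ forall s,
      Rabs (s - t) < d -> O (a + s * (a' - a), b + s * (b' - b))).
  { intros Q HQ t Ht.
    assert (h := HQ tt (a + t * (a' - a), b + t * (b' - b)) (conj I Ht)).
    apply locally_pair_box in h. destruct h as [d [Hd h]].
    exists (d / N). split; [now apply Rdiv_lt_0_compat|]. intros s Hs. apply h.
    assert (Hs' : Rabs (s - t) * N < d).
    { apply Rmult_lt_compat_r with (r := N) in Hs; [|easy].
      replace (d / N * N) with d in Hs by (field; lra). easy. }
    assert (h1 := Rabs_pos (a' - a)). assert (h2 := Rabs_pos (b' - b)).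
    split.
    - replace (a + s * (a' - a) - (a + t * (a' - a))) with ((s - t) * (a' - a)) by ring.
      rewrite Rabs_mult. unfold N in Hs'. nra.
    - replace (b + s * (b' - b) - (b + t * (b' - b))) with ((s - t) * (b' - b)) by ring.
      rewrite Rabs_mult. unfold N in Hs'. nra. }
  assert (HP : forall t, 0 <= t <= 1 -> (P t <-> P 0)).
  { apply interval_locally_constant. intros t _.
    destruct (classic (P t)) as [Ht|Ht].
    - destruct (Hloc O HO t Ht) as [d [Hd h]]. exists d. split; [easy|].
      intros s _ Hs. split; [easy|]. intros _. now apply h.
    - destruct (Hloc _ HO' t Ht) as [d [Hd h]]. exists d. split; [easy|].
      intros s _ Hs. split; [|easy]. intros Hs'. exfalso. now apply (h s Hs). }
  assert (H1 : P 1).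
  { apply (HP 1 ltac:(lra)). unfold P. rewrite !Rmult_0_l, !Rplus_0_r. exact Hx. }
  unfold P in H1. rewrite !Rmult_1_l in H1.
  replace (a + (a' - a)) with a' in H1 by ring.
  now replace (b + (b' - b)) with b' in H1 by ring.
Qed.

Section Rotate.
Variables (z0 c : R) (phi psi w : R -> R).
Hypotheses (Hc : c < 0) (HE : entire_solution z0 c phi psi)
  (Hw : forall r, 0 <= r -> w r = phi (r ^ 2)).

Definition radial (u v : R) : R := phi (u ^ 2 + v ^ 2).

Lemma sum_sqr_domain u v : c < u ^ 2 + v ^ 2.
Proof. assert (h := pow2_ge_0 u). assert (h' := pow2_ge_0 v). lra. Qed.

Lemma height_radial : height w = radial.
Proof.
  apply functional_extensionality. intros u. apply functional_extensionality. intros v.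
  unfold height, radial. rewrite Hw by apply sqrt_pos. rewrite pow2_sqrt; [easy|].
  assert (h := pow2_ge_0 u). assert (h' := pow2_ge_0 v). lra.
Qed.

Lemma radial_pos u v : 0 < radial u v.
Proof. apply HE, sum_sqr_domain. Qed.

(** The profile in the variable [r^2] is smooth on both sides of 0, so the axis
    is no exception. *)
Lemma radial_smooth : smooth_on everywhere radial.
Proof.
  intros n. destruct HE as [Hphi _].
  apply (Ck_comp n everywhere (fun x _ => c < x) (fun x _ => phi x)
           (fun u v => u ^ 2 + v ^ 2) (fun _ _ => 0)).
  - apply open1_gt.
  - intros u v _. apply sum_sqr_domain.
  - apply Hphi.
  - apply Ck_add; apply Ck_mul; try apply Ck_mul;
      apply Ck_fst || apply Ck_snd || apply Ck_const.
  - apply Ck_const.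
Qed.

Lemma radial_derive (f : R -> R) f' u v : is_derive f (u ^ 2 + v ^ 2) f' ->
  is_derive (fun t => f (t ^ 2 + v ^ 2)) u (2 * u * f') /\
  is_derive (fun t => f (u ^ 2 + t ^ 2)) v (2 * v * f').
Proof.
  intros H. split.
  - eapply is_derive_value.
    { apply (derive_chain f (fun t => t ^ 2 + v ^ 2) u f' (2 * u) H).
      auto_derive; [easy|ring]. }
    ring.
  - eapply is_derive_value.
    { apply (derive_chain f (fun t => u ^ 2 + t ^ 2) v f' (2 * v) H).
      auto_derive; [easy|ring]. }
    ring.
Qed.

Lemma radial_D1 u v : D1 radial u v = 2 * u * psi (u ^ 2 + v ^ 2).
Proof.
  apply is_derive_unique. refine (proj1 (radial_derive phi _ u v _)).
  apply HE, sum_sqr_domain.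
Qed.

Lemma radial_D2 u v : D2 radial u v = 2 * v * psi (u ^ 2 + v ^ 2).
Proof.
  apply is_derive_unique. refine (proj2 (radial_derive phi _ u v _)).
  apply HE, sum_sqr_domain.
Qed.

Lemma radial_psi_derive u v :
  is_derive (fun t => psi (t ^ 2 + v ^ 2)) u (2 * u * Derive psi (u ^ 2 + v ^ 2)) /\
  is_derive (fun t => psi (u ^ 2 + t ^ 2)) v (2 * v * Derive psi (u ^ 2 + v ^ 2)).
Proof.
  apply radial_derive. destruct HE as [_ [H _]].
  apply (proj1 (Ck1_derive 0 _ psi (open1_gt c) (H 1%nat))), sum_sqr_domain.
Qed.

Lemma radial_horo_graph_eq u v : horo_graph_eq radial u v.
Proof.
  assert (HO := everywhere_open).
  destruct (radial_psi_derive u v) as [d1 d2].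
  set (x := u ^ 2 + v ^ 2) in *. set (dp := Derive psi x) in *.
  assert (E11 : D1 (D1 radial) u v = 2 * psi x + 4 * u ^ 2 * dp).
  { rewrite (D1_ext everywhere _ (fun u v => 2 * u * psi (u ^ 2 + v ^ 2)) u v HO
      (fun u v _ => radial_D1 u v) I).
    apply is_derive_unique. eapply is_derive_value.
    { apply (derive_mul (fun t => 2 * t) (fun t => psi (t ^ 2 + v ^ 2)) u 2 (2 * u * dp)); [|exact d1].
      auto_derive; [easy|ring]. }
    fold x. ring. }
  assert (E12 : D1 (D2 radial) u v = 4 * u * v * dp).
  { rewrite (D1_ext everywhere _ (fun u v => 2 * v * psi (u ^ 2 + v ^ 2)) u v HO
      (fun u v _ => radial_D2 u v) I).
    apply is_derive_unique. eapply is_derive_value.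
    { apply (derive_mul (fun t => 2 * v) (fun t => psi (t ^ 2 + v ^ 2)) u 0 (2 * u * dp)); [|exact d1].
      apply @is_derive_const. }
    fold x. ring. }
  assert (E22 : D2 (D2 radial) u v = 2 * psi x + 4 * v ^ 2 * dp).
  { rewrite (D2_ext everywhere _ (fun u v => 2 * v * psi (u ^ 2 + v ^ 2)) u v HO
      (fun u v _ => radial_D2 u v) I).
    apply is_derive_unique. eapply is_derive_value.
    { apply (derive_mul (fun t => 2 * t) (fun t => psi (u ^ 2 + t ^ 2)) v 2 (2 * v * dp)); [|exact d2].
      auto_derive; [easy|ring]. }
    fold x. ring. }
  unfold horo_graph_eq. rewrite E11, E12, E22, radial_D1, radial_D2.
  change (radial u v) with (phi x). fold x.
  destruct HE as [_ [_ [_ [_ [_ Hode]]]]]. specialize (Hode x (sum_sqr_domain u v)).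
  fold dp in Hode.
  replace ((2 * psi x + 4 * u ^ 2 * dp) * (1 + (2 * v * psi x) ^ 2)
     - 2 * (4 * u * v * dp) * (2 * u * psi x * (2 * v * psi x))
     + (2 * psi x + 4 * v ^ 2 * dp) * (1 + (2 * u * psi x) ^ 2)) with
    (4 * psi x + 4 * (x * dp) + 8 * x * psi x ^ 3) by (unfold x; ring).
  rewrite Hode. generalize (force (phi x)) (psi x). intros F P. unfold x. field.
Qed.

Lemma rotate_pd (i : idx (rotate w)) u v :
  pd 1 0 (local_imm i) (u, v) = (1, 0, D1 radial u v) /\
  pd 0 1 (local_imm i) (u, v) = (0, 1, D2 radial u v).
Proof.
  change (pd 1 0 (local_imm i) (u, v)) with
    (Derive (fun t => t) u, Derive (fun _ => v) u, D1 (height w) u v).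
  change (pd 0 1 (local_imm i) (u, v)) with
    (Derive (fun _ => u) v, Derive (fun t => t) v, D2 (height w) u v).
  now rewrite height_radial, !Derive_id, !Derive_const.
Qed.

Lemma rotate_immersion : is_immersion (rotate w).
Proof.
  split.
  - intros [u v]. change (0 < height w u v). rewrite height_radial. apply radial_pos.
  - intros i [u v] _. destruct (rotate_pd i u v) as [-> ->].
    split; [|split; [|split]].
    + apply (smooth_on_smooth_at everywhere (fun u _ => u)); [apply everywhere_open| |easy].
      intros n. apply Ck_fst.
    + apply (smooth_on_smooth_at everywhere (fun _ v => v)); [apply everywhere_open| |easy].
      intros n. apply Ck_snd.
    + apply (smooth_on_smooth_at everywhere (height w)); [apply everywhere_open| |easy].
      rewrite height_radial. apply radial_smooth.
    + unfold xc, yc, zc. simpl. intros a b h1 h2 _. lra.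
Qed.

Lemma rotate_unit_normal : is_unit_normal (rotate w).
Proof.
  intros i [u v] _. destruct (rotate_pd i u v) as [-> ->].
  assert (HO := everywhere_open). assert (Sr := radial_smooth).
  set (W := fun u v => sqrt (1 + D1 radial u v ^ 2 + D2 radial u v ^ 2)).
  set (k := fun u v => radial u v / W u v).
  assert (EN : forall q, local_normal i q =
    (- (k (fst q) (snd q) * D1 radial (fst q) (snd q)),
     - (k (fst q) (snd q) * D2 radial (fst q) (snd q)), k (fst q) (snd q))).
  { intros [x y]. unfold k, W. rewrite <- height_radial. easy. }
  assert (HWp : forall u v, 0 < 1 + D1 radial u v ^ 2 + D2 radial u v ^ 2).
  { intros x y. assert (h := pow2_ge_0 (D1 radial x y)).
    assert (h' := pow2_ge_0 (D2 radial x y)). lra. }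
  assert (HW : forall u v, 0 < W u v) by (intros; now apply sqrt_lt_R0).
  assert (S1 := smooth_D1 _ _ HO Sr). assert (S2 := smooth_D2 _ _ HO Sr).
  assert (C1 := smooth_continuity _ _ S1 u v I). assert (C2 := smooth_continuity _ _ S2 u v I).
  assert (Ck : continuity_2d_pt k u v).
  { apply continuity_2d_pt_mult; [now apply (smooth_continuity everywhere)|].
    apply continuity_2d_pt_inv; [|assert (h := HW u v); lra].
    apply (continuity_1d_2d_pt_comp sqrt
      (fun u v => 1 + D1 radial u v ^ 2 + D2 radial u v ^ 2)).
    - apply continuity_pt_sqrt. assert (h := HWp u v). lra.
    - apply continuity_2d_pt_plus; [apply continuity_2d_pt_plus|].
      + apply continuity_2d_pt_const.
      + apply (continuity_1d_2d_pt_comp (fun x => x ^ 2)); [|easy].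
        apply derivable_continuous_pt, derivable_pt_pow.
      + apply (continuity_1d_2d_pt_comp (fun x => x ^ 2)); [|easy].
        apply derivable_continuous_pt, derivable_pt_pow. }
  split; [|split; [|split]].
  - apply continuous_pair.
    apply continuity_2d_pt_ext with (fun u v => - (k u v * D1 radial u v));
      [intros; now rewrite EN|].
    now apply continuity_2d_pt_opp, continuity_2d_pt_mult.
  - apply continuous_pair.
    apply continuity_2d_pt_ext with (fun u v => - (k u v * D2 radial u v));
      [intros; now rewrite EN|].
    now apply continuity_2d_pt_opp, continuity_2d_pt_mult.
  - apply continuous_pair.
    apply continuity_2d_pt_ext with k; [intros; now rewrite EN|easy].
  - rewrite EN. unfold local_imm. simpl fst. simpl snd.
    change (imm (par i (u, v))) with ((u, v, height w u v) : R3). rewrite height_radial.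
    unfold hyp, dot3, xc, yc, zc. simpl fst. simpl snd.
    assert (hr := radial_pos u v). assert (hW := HW u v).
    assert (hW2 : W u v ^ 2 = 1 + D1 radial u v ^ 2 + D2 radial u v ^ 2).
    { unfold W. rewrite pow2_sqrt; [easy|]. assert (h := HWp u v). lra. }
    set (a := D1 radial u v) in *. set (b := D2 radial u v) in *.
    split; [|split; unfold Rdiv; ring].
    replace ((- (k u v * a) * - (k u v * a) + - (k u v * b) * - (k u v * b) + k u v * k u v) /
       radial u v ^ 2) with (k u v ^ 2 * W u v ^ 2 / radial u v ^ 2)
      by (rewrite hW2; field; lra).
    unfold k. field. lra.
Qed.

Lemma rotate_horo_shrinker : horo_shrinker (rotate w).
Proof.
  split; [apply plane_smooth|]. split; [apply rotate_immersion|].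
  split; [apply rotate_unit_normal|].
  intros i [u v] _.
  destruct (rotate_unit_normal i (u, v) I) as [_ [_ [_ [N1 [N2 N3]]]]].
  apply (graph_mean_curvature everywhere everywhere (fun u _ => u) (fun _ v => v) radial);
    auto using everywhere_open, radial_smooth, radial_pos.
  - intros n. apply Ck_fst.
  - intros n. apply Ck_snd.
  - intros x y _. now rewrite <- height_radial.
  - easy.
  - unfold jacobian, D1, D2. rewrite !Derive_id, !Derive_const. lra.
  - intros E. apply (Rlt_irrefl 0).
    assert (H : 0 < zc (local_normal i (u, v))).
    { change (0 < height w u v / sqrt (1 + partial_derive 1 0 (height w) u v ^ 2 +
        partial_derive 0 1 (height w) u v ^ 2)).
      apply Rdiv_lt_0_compat; [rewrite height_radial; apply radial_pos|].
      apply sqrt_lt_R0.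
      assert (h := pow2_ge_0 (partial_derive 1 0 (height w) u v)).
      assert (h' := pow2_ge_0 (partial_derive 0 1 (height w) u v)). lra. }
    now rewrite E in H.
  - apply radial_horo_graph_eq.
Qed.

Definition turn (t : R) (q : R * R) : R * R :=
  (cos t * fst q - sin t * snd q, sin t * fst q + cos t * snd q).

Lemma rotate_rotational : rotational (rotate w).
Proof.
  exists turn. split; [|split; [|split; [|split; [|split]]]].
  - intros [u v]. unfold turn. simpl. rewrite cos_0, sin_0. f_equal; ring.
  - intros s t [u v]. unfold turn. simpl. rewrite cos_plus, sin_plus. f_equal; ring.
  - intros [u v]. unfold turn. simpl. rewrite cos_2PI, sin_2PI. f_equal; ring.
  - intros t i j q p _ _ _. exists (turn t). apply filter_forall.
    assert (HC : forall a b, smooth_on everywhere (fun u v => a * u + b * v)).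
    { intros a b n. apply Ck_add; apply Ck_mul;
        apply Ck_fst || apply Ck_snd || apply Ck_const. }
    intros x. split; [|split; [|easy]].
    + apply (smooth_on_smooth_at everywhere (fun u v => cos t * u - sin t * v));
        [apply everywhere_open| |easy].
      intros n. apply (Ck_ext n _ (fun u v => cos t * u + (- sin t) * v));
        [apply everywhere_open|intros; ring|apply HC].
    + apply (smooth_on_smooth_at everywhere (fun u v => sin t * u + cos t * v));
        [apply everywhere_open|apply HC|easy].
  - intros [u v] O HO t Ht.
    assert (h := HO tt (turn t (u, v)) (conj I Ht)).
    apply locally_pair_box in h. destruct h as [d [Hd h]].
    assert (c1 : continuity_pt (fun t => cos t * u - sin t * v) t).
    { apply continuity_pt_minus; apply continuity_pt_mult;
        try (apply continuity_pt_const; now intros ? ?).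
      - apply continuity_cos.
      - apply continuity_sin. }
    assert (c2 : continuity_pt (fun t => sin t * u + cos t * v) t).
    { apply continuity_pt_plus; apply continuity_pt_mult;
        try (apply continuity_pt_const; now intros ? ?).
      - apply continuity_sin.
      - apply continuity_cos. }
    destruct (proj1 (continuity_pt_eps _ _) c1 d Hd) as [d1 [Hd1 h1]].
    destruct (proj1 (continuity_pt_eps _ _) c2 d Hd) as [d2 [Hd2 h2]].
    exists (mkposreal _ (Rmin_pos _ _ Hd1 Hd2)). intros s Hs.
    assert (Hs' : Rabs (s - t) < Rmin d1 d2) by exact Hs.
    rmin d1 d2.
    apply h. split; [apply h1; lra|apply h2; lra].
  - intros t [u v]. change (@imm (rotate w) (turn t (u, v))) with
      ((fst (turn t (u, v)), snd (turn t (u, v)),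
        height w (fst (turn t (u, v))) (snd (turn t (u, v)))) : R3).
    change (@imm (rotate w) (u, v)) with ((u, v, height w u v) : R3).
    unfold turn, rot, xc, yc, zc. simpl. f_equal.
    rewrite height_radial. unfold radial. f_equal.
    assert (E := sin2_cos2 t). unfold Rsqr in E.
    replace ((cos t * u - sin t * v) ^ 2 + (sin t * u + cos t * v) ^ 2) with
      ((sin t * sin t + cos t * cos t) * (u ^ 2 + v ^ 2)) by ring.
    rewrite E. ring.
Qed.

Lemma rotate_connected_rotational : connected_rotational_horo_shrinker (rotate w).
Proof.
  split; [apply rotate_horo_shrinker|]. split; [apply plane_connected|].
  apply rotate_rotational.
Qed.

(** An entire graph cannot be extended: its image in a larger surface [T] is
    open by the inverse function theorem, and closed because a limit of it
    lies over some point of the plane, over which there is already a point. *)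
Lemma rotate_maximal (T : immersed_surface) (f : pt (rotate w) -> pt T) :
  connected_rotational_horo_shrinker T -> smooth_map f ->
  (forall x, imm (f x) = imm x) -> forall y, exists x, f x = y.
Proof.
  intros [[HS [HI [HN HH]]] [[_ Hconn] _]] Hf Himm.
  assert (Hxy : forall u v, xc (imm (f (u, v))) = u /\ yc (imm (f (u, v))) = v).
  { intros u v. now rewrite Himm. }
  assert (Hf_open : forall O : pt T -> Prop, is_open O -> forall u v, O (f (u, v)) ->
    exists d, 0 < d /\ forall x y, box u v d x y -> O (f (x, y))).
  { intros O HO u v Huv.
    assert (h := smooth_map_continuous HS f O (fun i => open_true) Hf HO tt).
    apply open_open2 in h. destruct (h u v (conj I Huv)) as [d Hd].
    exists d. split; [apply cond_pos|]. intros x y [h1 h2]. now apply Hd. }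
  set (U := fun y => exists x, f x = y).
  apply (Hconn U).
  - apply is_open_of_neighbourhoods. intros y [[u v] <-].
    destruct (chart_at HS (f (u, v))) as [j [a [b [Hj Ej]]]].
    destruct (smooth_map_local HS f tt j u v a b everywhere Hf I Hj (eq_sym Ej)
      everywhere_open I) as [d [g1 [g2 [Hd [S1 [S2 [E1 [E2 Hg]]]]]]]].
    destruct (loc_smooth HI j) as [Sx [Sy _]]. assert (HD := dom_open HS j).
    assert (HB := box_open u v d). assert (Hcen := box_center u v d Hd).
    assert (HgD : forall x y, box u v d x y -> dom j (g1 x y, g2 x y)) by (intros; now apply Hg).
    assert (Hx : forall x y, box u v d x y -> loc_x j (g1 x y) (g2 x y) = x).
    { intros x y h. unfold loc_x, local_imm. destruct (Hg x y h) as [_ [_ <-]]. apply Hxy. }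
    assert (Hy : forall x y, box u v d x y -> loc_y j (g1 x y) (g2 x y) = y).
    { intros x y h. unfold loc_y, local_imm. destruct (Hg x y h) as [_ [_ <-]]. apply Hxy. }
    assert (X1 := comp_D1 _ _ g1 g2 HD S1 S2 HgD (loc_x j) u v Sx Hcen).
    assert (X2 := comp_D2 _ _ g1 g2 HD S1 S2 HgD (loc_x j) u v Sx Hcen).
    assert (Y1 := comp_D1 _ _ g1 g2 HD S1 S2 HgD (loc_y j) u v Sy Hcen).
    assert (Y2 := comp_D2 _ _ g1 g2 HD S1 S2 HgD (loc_y j) u v Sy Hcen).
    rewrite (D1_ext _ _ (fun u _ => u) u v HB Hx Hcen) in X1.
    rewrite (D2_ext _ _ (fun u _ => u) u v HB Hx Hcen) in X2.
    rewrite (D1_ext _ _ (fun _ v => v) u v HB Hy Hcen) in Y1.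
    rewrite (D2_ext _ _ (fun _ v => v) u v HB Hy Hcen) in Y2.
    unfold D1 at 1 in X1. unfold D2 at 1 in X2. unfold D1 at 1 in Y1. unfold D2 at 1 in Y2.
    rewrite Derive_id in X1, Y2. rewrite Derive_const in X2, Y1. rewrite E1, E2 in *.
    assert (HJ : jacobian (loc_x j) (loc_y j) a b <> 0).
    { unfold jacobian. intros J0. apply R1_neq_R0.
      transitivity ((D1 (loc_x j) a b * D2 (loc_y j) a b - D2 (loc_x j) a b * D1 (loc_y j) a b)
        * jacobian g1 g2 u v); [|rewrite J0; ring].
      unfold jacobian.
      transitivity (1 * 1 - 0 * 0); [ring|].
      rewrite X1 at 1. rewrite Y2 at 1. rewrite X2 at 1. rewrite Y1 at 1. ring. }
    destruct (regular_of_jacobian HS HI HN HH j a b Hj HJ) as [e [tau [h HL]]].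
    rewrite Ej in HL. destruct HL as [He [Ht0 [Htau [_ [_ [_ Hop]]]]]].
    destruct (Hxy u v) as [Eu Ev]. rewrite Eu, Ev in *.
    destruct (Hf_open _ (Hop _ (box_open u v e) (fun _ _ h => h)) u v) as [d' [Hd' Hbox]].
    { exists u, v. split; [now apply box_center|exact Ht0]. }
    assert (Hft : forall x y, box u v d' x y -> box u v e x y /\ f (x, y) = tau x y).
    { intros x y Hxy'. destruct (Hbox x y Hxy') as [x' [y' [H' E]]].
      assert (Ei : imm (tau x' y') = imm (f (x, y))) by now rewrite E.
      rewrite Htau in Ei by easy. destruct (Hxy x y) as [k1 k2]. rewrite <- Ei in k1, k2.
      unfold xc, yc in k1, k2. simpl in k1, k2. subst x' y'. now split. }
    exists (fun z => exists x y, box u v d' x y /\ tau x y = z). split; [|split].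
    + apply Hop; [apply box_open|]. intros; now apply Hft.
    + exists u, v. split; [now apply box_center|]. symmetry. apply Hft. now apply box_center.
    + intros z [x [y [Hb <-]]]. exists (x, y). now apply Hft.
  - apply is_open_of_neighbourhoods. intros y Hy.
    set (u := xc (imm y)). set (v := yc (imm y)).
    assert (Hn : y <> f (u, v)) by (intros E; apply Hy; now exists (u, v)).
    assert (HS' := HS). destruct HS' as [_ [_ [_ [_ Hh]]]].
    destruct (Hh _ _ Hn) as [O [O' [HO [HO' [Oy [Of Hdis]]]]]].
    destruct (Hf_open O' HO' u v Of) as [d [Hd Hbox]].
    exists (fun z => O z /\ box u v d (xc (imm z)) (yc (imm z))). split; [|split].
    + apply is_open_and; [easy|]. now apply imm_box_open.
    + split; [easy|]. now apply box_center.
    + intros z [Oz Hz] [[a b] E]. apply (Hdis z). split; [easy|].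
      rewrite <- E in Hz |- *. destruct (Hxy a b) as [k1 k2]. rewrite k1, k2 in Hz.
      now apply Hbox.
  - now exists (f (0, 0)), (0, 0).
Qed.

End Rotate.

(** * Classification *)

Lemma local_section_restrict {S : immersed_surface} (y : pt S) e tau h u v :
  local_section y e tau h -> box (xc (imm y)) (yc (imm y)) e u v ->
  exists e', local_section (tau u v) e' tau h.
Proof.
  intros [He [Hc [Himm [Sh [Heq [Hcont Hop]]]]]] Huv.
  set (B := box (xc (imm y)) (yc (imm y)) e) in *.
  destruct (proj1 (locally_2d_box B u v) (box_open _ _ _ u v Huv)) as [e' [He' HB]].
  exists e'. unfold local_section.
  assert (Ei := Himm u v Huv).
  replace (xc (imm (tau u v))) with u by now rewrite Ei.
  replace (yc (imm (tau u v))) with v by now rewrite Ei.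
  split; [easy|]. split; [easy|]. split; [auto|]. split; [|split; [auto|split]].
  - intros n. apply (Ck_sub n B); auto.
  - intros O HO a b [h1 h2]. apply locally_2d_and; [now apply box_open|].
    generalize (Hcont O HO a b (conj (HB _ _ h1) h2)).
    apply locally_2d_impl, locally_2d_forall. tauto.
  - intros V HV HVB. apply Hop; auto.
Qed.

Section Classify.
Context {S : immersed_surface}.
Hypotheses (HS : is_smooth_surface S) (HI : is_immersion S) (HN : is_unit_normal S)
  (HH : forall (i : idx S) (q : R * R), dom i q ->
    mean_curvature (local_imm i) (local_normal i q) q =
    hyp (local_imm i q) (local_normal i q) (0, 0, 1)).
Variable act : R -> pt S -> pt S.
Hypotheses
  (A0 : forall x, act 0 x = x)
  (AD : forall s t x, act (s + t) x = act s (act t x))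
  (AP : forall x, act (2 * PI) x = x)
  (AS : forall t, smooth_map (act t))
  (AC : forall (x : pt S) (O : pt S -> Prop), is_open O -> open (fun t : R => O (act t x)))
  (AR : forall t x, imm (act t x) = rot t (imm x)).
Variable x0 : pt S.
Hypothesis (Hx0 : on_axis (imm x0)).
Variables (c B : R) (phi psi : R -> R).
Hypotheses (Hc : c < 0) (HE : entire_solution (zc (imm x0)) c phi psi)
  (HB : forall x, 0 <= x -> / B < phi x < B /\ 4 * x * psi x ^ 2 <= B ^ 2).

Let Z (r : R) := phi (r ^ 2).
Let P (r : R) := 2 * r * psi (r ^ 2).

(** Turning by a multiple of [2 pi] is the identity also on the surface. *)
Lemma act_full_turn t x : cos t = 1 -> act t x = x.
Proof.
  intros Ht.
  assert (Hs : sin (t / 2) = 0).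
  { apply Rsqr_0_uniq. unfold Rsqr. assert (h := cos_2a_sin (t / 2)).
    replace (2 * (t / 2)) with t in h by field. lra. }
  destruct (sin_eq_0_0 _ Hs) as [k Hk].
  assert (Ek : t = IZR k * (2 * PI)) by lra.
  assert (Hn : forall n y, act (INR n * (2 * PI)) y = y).
  { induction n as [|n IH]; intros y; [rewrite Rmult_0_l; apply A0|].
    rewrite S_INR, Rmult_plus_distr_r, Rmult_1_l, AD, AP. apply IH. }
  destruct (Z.le_gt_cases 0 k) as [h|h].
  - rewrite Ek, <- (Z2Nat.id k h), <- INR_IZR_INZ. apply Hn.
  - assert (E : t = - (INR (Z.to_nat (- k)) * (2 * PI))).
    { rewrite INR_IZR_INZ, Z2Nat.id, opp_IZR by lia. rewrite Ek. ring. }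
    rewrite E. rewrite <- (Hn (Z.to_nat (- k)) x) at 1.
    apply (act_neg act A0 AD).
Qed.

Lemma section_agrees (y x : pt S) e tau h u v : local_section y e tau h ->
  (exists a b, box (xc (imm y)) (yc (imm y)) e a b /\ tau a b = x) ->
  xc (imm x) = u -> yc (imm x) = v -> x = tau u v.
Proof.
  intros [_ [_ [Himm _]]] [a [b [Hab <-]]] E1 E2. rewrite Himm in E1, E2 by easy.
  unfold xc, yc in E1, E2. simpl in E1, E2. now subst.
Qed.

(** Near a point of the closed half-line, every point of a local section is
    rotated from the half-line; this holds also around the axis. *)
Lemma section_polar_near (y : pt S) e tau h eta : local_section y e tau h ->
  yc (imm y) = 0 -> 0 <= xc (imm y) -> 0 < eta ->
  exists d, 0 < d /\ d <= e /\ forall u v, box (xc (imm y)) 0 d u v ->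
    Rabs (sqrt (u ^ 2 + v ^ 2) - xc (imm y)) < eta /\
    exists t, act t (tau (sqrt (u ^ 2 + v ^ 2)) 0) = tau u v.
Proof.
  intros HL Hy Hx Heta. set (R0 := xc (imm y)) in *.
  assert (He : 0 < e) by apply HL.
  assert (Hc2 : continuity_2d_pt (fun u v => sqrt (u ^ 2 + v ^ 2)) R0 0).
  { apply (continuity_1d_2d_pt_comp sqrt (fun u v => u ^ 2 + v ^ 2)).
    - apply continuity_pt_sqrt. assert (h1 := pow2_ge_0 R0). lra.
    - apply (Ck_continuity 0 everywhere); [|easy].
      apply Ck_add; apply Ck_mul; try apply Ck_mul;
        apply Ck_fst || apply Ck_snd || apply Ck_const. }
  assert (Hs0 : sqrt (R0 ^ 2 + 0 ^ 2) = R0).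
  { replace (R0 ^ 2 + 0 ^ 2) with (R0 ^ 2) by ring. now apply sqrt_pow2. }
  destruct (Hc2 (mkposreal _ (Rmin_pos _ _ He Heta))) as [d1 Hd1]. simpl in Hd1.
  change (R0 * (R0 * 1) + 0 * (0 * 1)) with (R0 ^ 2 + 0 ^ 2) in Hd1. rewrite Hs0 in Hd1.
  rmin e eta.
  destruct (Rle_lt_or_eq_dec 0 R0 Hx) as [HR|HR].
  - set (d := Rmin d1 (Rmin e R0)).
    assert (k1 := Rmin_l d1 (Rmin e R0)). assert (k2 := Rmin_r d1 (Rmin e R0)).
    rmin e R0.
    exists d. split; [apply Rmin_pos; [apply cond_pos|now apply Rmin_pos]|].
    split; [unfold d; lra|]. intros u v [Hu Hv]. fold d in k1, k2.
    assert (Hr := Hd1 u v ltac:(lra) ltac:(lra)).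
    change (Rabs (sqrt (u ^ 2 + v ^ 2) - R0) < Rmin e eta) in Hr.
    split; [lra|].
    apply (section_polar act A0 AD AC AR y e tau h HL Hy).
    + apply Rabs_def2 in Hu. lra.
    + rewrite Hy. split; fold R0; lra.
    + rewrite Hy. split; fold R0; [lra|]. rewrite Rminus_diag, Rabs_R0. lra.
  - set (d := Rmin d1 e).
    assert (k1 := Rmin_l d1 e). assert (k2 := Rmin_r d1 e).
    exists d. split; [apply Rmin_pos; [apply cond_pos|easy]|].
    split; [unfold d; lra|]. intros u v [Hu Hv]. fold d in k1, k2.
    assert (Hr := Hd1 u v ltac:(lra) ltac:(lra)).
    change (Rabs (sqrt (u ^ 2 + v ^ 2) - R0) < Rmin e eta) in Hr.
    split; [lra|]. destruct (polar_coordinates u v) as [t [T1 T2]]. exists t.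
    set (r := sqrt (u ^ 2 + v ^ 2)) in *.
    destruct (section_axis_act act A0 AD AC AR y e tau h HL Hy (eq_sym HR) r t) as [_ E].
    { rewrite <- HR, Rminus_0_r in Hr. lra. }
    now rewrite E, <- T1, <- T2.
Qed.

(** The initial data determine the profile of a local section. *)
Lemma section_profile_unique (y : pt S) e tau h r1 r : local_section y e tau h ->
  yc (imm y) = 0 -> 0 <= r1 <= r ->
  (forall s, r1 <= s <= r -> Rabs (s - xc (imm y)) < e) ->
  h r1 0 = Z r1 -> D1 h r1 0 = P r1 -> h r 0 = Z r.
Proof.
  intros HL Hy Hr Hin E1 E2.
  assert (HL' := HL). destruct HL' as [He [_ [Himm [Sh _]]]].
  set (Bx := box (xc (imm y)) (yc (imm y)) e) in *.
  assert (HBx : open2 Bx) by apply box_open.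
  assert (Hbox : forall s, r1 <= s <= r -> Bx s 0).
  { intros s Hs. split; [now apply Hin|]. rewrite Hy, Rminus_diag, Rabs_R0. easy. }
  assert (S1 := smooth_D1 Bx h HBx Sh).
  assert (Hode := section_ode act A0 AD AC AR y e tau h HL Hy).
  assert (Hb1 : Bx r1 0) by (apply Hbox; lra).
  apply (profile_ode_unique (fun s => h s 0) (fun s => D1 h s 0) Z P r1 r); auto.
  - apply continuity_pt_right, (is_derive_continuity_pt _ _ (D1 h r1 0)).
    now apply (smooth_derive1 Bx).
  - apply continuity_pt_right, (is_derive_continuity_pt _ _ (D1 (D1 h) r1 0)).
    now apply (smooth_derive1 Bx).
  - apply continuity_pt_right, (is_derive_continuity_pt _ _ (P r1)).
    now apply (entire_derive_z _ c phi psi Hc HE).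
  - apply continuity_pt_right.
    eapply is_derive_continuity_pt, (entire_derive_p _ c phi psi Hc HE).
  - intros s Hs. apply Hode; [lra|]. apply Hbox. lra.
  - intros s Hs. apply Hode; [lra|]. apply Hbox. lra.
  - intros s Hs. apply (entire_derive_z _ c phi psi Hc HE).
  - intros s Hs. apply (entire_derive_p_rhs _ c phi psi Hc HE). lra.
  - intros s Hs. assert (h1 := imm_pos HI (tau s 0)).
    rewrite Himm in h1 by now apply Hbox. exact h1.
  - intros s Hs. apply (entire_z_pos _ c phi psi Hc HE).
Qed.

(** A good curve is a piece of the profile lifted to the surface, starting at
    the point on the axis. *)
Definition good (gam : R -> pt S) (l : R) : Prop :=
  0 < l /\ gam 0 = x0 /\ forall r, 0 <= r < l ->
    imm (gam r) = (r, 0, Z r) /\ regular (gam r) /\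
    forall O, is_open O -> O (gam r) -> exists d, 0 < d /\
      forall r', 0 <= r' < l -> Rabs (r' - r) < d -> O (gam r').

Definition swept (x : pt S) : Prop :=
  exists gam l r t, good gam l /\ 0 <= r < l /\ x = act t (gam r).

Lemma regular_axis : regular x0.
Proof.
  destruct (chart_at HS x0) as [i [u [v [Hd E]]]]. rewrite <- E.
  apply regular_of_jacobian; auto.
  apply (axis_horizontal HS HI act A0 AD AS AC AR); [easy|]. now rewrite E.
Qed.

Lemma section_curve_continuous (y : pt S) e tau h r O : local_section y e tau h ->
  box (xc (imm y)) (yc (imm y)) e r 0 -> is_open O -> O (tau r 0) ->
  exists d, 0 < d /\ forall r', Rabs (r' - r) < d -> O (tau r' 0).
Proof.
  intros HL Hr HO H. destruct HL as [_ [_ [_ [_ [_ [Hcont _]]]]]].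
  destruct (Hcont O HO r 0 (conj Hr H)) as [d Hd]. exists d. split; [apply cond_pos|].
  intros r' Hr'. apply Hd; [easy|]. rewrite Rminus_diag, Rabs_R0. apply cond_pos.
Qed.

(** Around the point on the axis the surface is a local section, and its height
    along the half-line is the profile by uniqueness. *)
Lemma good_exists : exists gam l, good gam l.
Proof.
  destruct regular_axis as [e [tau [h HL]]]. destruct Hx0 as [Ex Ey].
  assert (HL' := HL). destruct HL' as [He [Hcen [Himm [Sh _]]]].
  assert (Hbox : forall r, 0 <= r < e -> box (xc (imm x0)) (yc (imm x0)) e r 0).
  { intros r Hr. rewrite Ex, Ey. split; rewrite Rminus_0_r; [rewrite Rabs_pos_eq; lra|].
    rewrite Rabs_R0. lra. }
  assert (Hh : forall r, 0 <= r < e -> h r 0 = Z r).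
  { intros r Hr. apply (section_profile_unique x0 e tau h 0 r HL Ey); [lra| | |].
    - intros s Hs. rewrite Ex, Rminus_0_r, Rabs_pos_eq; lra.
    - transitivity (zc (imm x0)); [|symmetry; apply (entire_z_0 _ c phi psi HE)].
      rewrite <- Hcen, Ex, Ey, Himm; [easy|]. apply Hbox. lra.
    - rewrite (section_axis_slope act A0 AD AC AR x0 e tau h HL Ey Ex). unfold P. ring. }
  exists (fun r => tau r 0), e. split; [easy|]. split.
  - rewrite Ex, Ey in Hcen. exact Hcen.
  - intros r Hr. split; [|split].
    + rewrite Himm, Hh by auto. easy.
    + destruct (local_section_restrict x0 e tau h r 0 HL (Hbox r Hr)) as [e' H'].
      now exists e', tau, h.
    + intros O HO H.
      destruct (section_curve_continuous x0 e tau h r O HL (Hbox r Hr) HO H) as [d [Hd Hd']].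
      exists d. auto.
Qed.

(** A good curve follows every local section that it meets. *)
Lemma good_near_section gam l (y : pt S) e tau h r : good gam l -> local_section y e tau h ->
  yc (imm y) = 0 -> 0 <= r < l -> Rabs (r - xc (imm y)) < e -> gam r = tau r 0 ->
  exists d, 0 < d /\ forall r', 0 <= r' < l -> Rabs (r' - r) < d -> gam r' = tau r' 0.
Proof.
  intros [_ [_ Hg]] HL Hy Hr Hre E. assert (HL' := HL).
  destruct HL' as [He [_ [_ [_ [_ [_ Hop]]]]]].
  destruct (Hg r Hr) as [_ [_ Hcont]].
  destruct (Hcont _ (Hop _ (box_open _ _ _) (fun _ _ k => k))) as [d [Hd Hd']].
  { exists r, 0. split; [|easy]. split; [easy|]. rewrite Hy, Rminus_diag, Rabs_R0. easy. }
  exists d. split; [easy|]. intros r' Hr' Hrr.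
  apply (section_agrees y _ e tau h); [easy|now apply Hd'| |];
    now rewrite (proj1 (Hg r' Hr')).
Qed.

(** The Hausdorff axiom separates [g1 r] and [g2 r], so curves on a surface do
    not branch. *)
Lemma curves_separate (g1 g2 : R -> pt S) (D : R -> Prop) r :
  (forall i, i = g1 \/ i = g2 -> forall O, is_open O -> O (i r) -> exists d, 0 < d /\
     forall r', D r' -> Rabs (r' - r) < d -> O (i r')) ->
  g1 r <> g2 r -> exists d, 0 < d /\ forall r', D r' -> Rabs (r' - r) < d -> g1 r' <> g2 r'.
Proof.
  intros Hcont Hn. assert (HS' := HS). destruct HS' as [_ [_ [_ [_ Hh]]]].
  destruct (Hh _ _ Hn) as [O [O' [HO [HO' [H1 [H2 Hdis]]]]]].
  destruct (Hcont g1 (or_introl eq_refl) O HO H1) as [d1 [Hd1 K1]].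
  destruct (Hcont g2 (or_intror eq_refl) O' HO' H2) as [d2 [Hd2 K2]].
  assert (m1 := Rmin_l d1 d2). assert (m2 := Rmin_r d1 d2).
  exists (Rmin d1 d2). split; [now apply Rmin_pos|]. intros r' Hr' Hrr E.
  apply (Hdis (g1 r')). split; [apply K1; [easy|lra]|]. rewrite E. apply K2; [easy|lra].
Qed.

(** The set of radii where two good curves agree is open, because both follow
    the same local section, and closed, because the surface is Hausdorff. *)
Lemma good_unique g1 l1 g2 l2 r : good g1 l1 -> good g2 l2 ->
  0 <= r < l1 -> r < l2 -> g1 r = g2 r.
Proof.
  intros G1 G2 Hr1 Hr2. assert (K1 := G1). assert (K2 := G2).
  destruct K1 as [_ [E1 K1]]. destruct K2 as [_ [E2 K2]].
  apply (interval_locally_constant (fun s => g1 s = g2 s) 0 r); [|lra|congruence].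
  intros s Hs. destruct (classic (g1 s = g2 s)) as [E|Hn].
  - destruct (K1 s ltac:(lra)) as [Ei [[e [tau [h HL]]] _]].
    assert (Hy : yc (imm (g1 s)) = 0) by now rewrite Ei.
    assert (Hxs : xc (imm (g1 s)) = s) by now rewrite Ei.
    assert (Hse : Rabs (s - xc (imm (g1 s))) < e).
    { rewrite Hxs, Rminus_diag, Rabs_R0. apply HL. }
    assert (Hc0 : g1 s = tau s 0).
    { destruct HL as [_ [Hcen _]]. rewrite Hxs, Hy in Hcen. easy. }
    destruct (good_near_section g1 l1 _ e tau h s G1 HL Hy ltac:(lra) Hse Hc0)
      as [d1 [Hd1 H1]].
    destruct (good_near_section g2 l2 _ e tau h s G2 HL Hy ltac:(lra) Hse ltac:(congruence))
      as [d2 [Hd2 H2]].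
    exists (Rmin d1 d2). split; [now apply Rmin_pos|]. intros s' Hs' Hss.
    rmin d1 d2.
    rewrite H1, H2 by lra. tauto.
  - destruct (curves_separate g1 g2 (fun s => 0 <= s <= r) s) as [d [Hd H]]; [|easy|].
    + intros g [-> | ->] O HO Os.
      * destruct (K1 s ltac:(lra)) as [_ [_ H]]. destruct (H O HO Os) as [d [Hd H']].
        exists d. split; [easy|]. intros; apply H'; [lra|easy].
      * destruct (K2 s ltac:(lra)) as [_ [_ H]]. destruct (H O HO Os) as [d [Hd H']].
        exists d. split; [easy|]. intros; apply H'; [lra|easy].
    + exists d. split; [easy|]. intros s' Hs' Hss. split; [|easy].
      intros E. now elim (H s' Hs' Hss).
Qed.

Lemma swept_act t x : swept x -> swept (act t x).
Proof.
  intros [gam [l [r [s [Hg [Hr ->]]]]]]. exists gam, l, r, (t + s).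
  split; [easy|]. split; [easy|]. now rewrite AD.
Qed.

Lemma swept_graph x : swept x -> imm x = (xc (imm x), yc (imm x),
  radial phi (xc (imm x)) (yc (imm x))).
Proof.
  intros [gam [l [r [t [[_ [_ Hg]] [Hr ->]]]]]]. destruct (Hg r Hr) as [E _].
  rewrite AR, E. unfold rot, xc, yc, zc. simpl. f_equal. unfold Z, radial. f_equal.
  assert (T := sin2_cos2 t). unfold Rsqr in T.
  replace ((cos t * r - sin t * 0) ^ 2 + (sin t * r + cos t * 0) ^ 2) with
    ((sin t * sin t + cos t * cos t) * r ^ 2) by ring.
  rewrite T. ring.
Qed.

(** A neighbourhood of a point of a good curve consists of rotated points of the
    local section over the half-line, and there the section is the curve. *)
Lemma swept_open : is_open swept.
Proof.
  apply is_open_of_neighbourhoods. intros x [gam [l [r [t [Hg [Hr ->]]]]]].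
  assert (Hg' := Hg). destruct Hg' as [_ [_ Hg']].
  destruct (Hg' r Hr) as [Ei [[e [tau [h HL]]] _]].
  assert (Hy : yc (imm (gam r)) = 0) by now rewrite Ei.
  assert (Hxr : xc (imm (gam r)) = r) by now rewrite Ei.
  assert (He : 0 < e) by apply HL.
  assert (Hc0 : gam r = tau r 0).
  { destruct HL as [_ [Hcen _]]. now rewrite Hxr, Hy in Hcen. }
  destruct (good_near_section gam l _ e tau h r Hg HL Hy Hr) as [d1 [Hd1 H1]];
    [rewrite Hxr, Rminus_diag, Rabs_R0; easy|easy|].
  destruct (section_polar_near _ e tau h (Rmin d1 (l - r)) HL Hy) as [d [Hd [Hde Hpol]]];
    [rewrite Hxr; lra|apply Rmin_pos; lra|].
  rewrite Hxr in Hpol.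
  rmin d1 (l - r).
  assert (HO : is_open (fun x => exists u v, box r 0 d u v /\ tau u v = x)).
  { apply HL; [apply box_open|]. rewrite Hxr, Hy. intros u v. now apply box_le. }
  exists (fun x => exists u v, box r 0 d u v /\ tau u v = act (- t) x).
  split; [|split].
  - apply (act_open HS act AS (- t) _ HO).
  - exists r, 0. split; [now apply box_center|].
    now rewrite (act_neg act A0 AD).
  - intros y [u [v [Huv E]]]. destruct (Hpol u v Huv) as [k1 [s Es]].
    set (rho := sqrt (u ^ 2 + v ^ 2)) in *.
    assert (Hrho : 0 <= rho < l).
    { split; [apply sqrt_pos|]. apply Rabs_def2 in k1. lra. }
    exists gam, l, rho, (t + s). split; [easy|]. split; [easy|].
    rewrite AD, H1 by (easy || lra). rewrite Es, E.
    rewrite <- AD. replace (t + - t) with 0 by ring. now rewrite A0.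
Qed.

(** At points of the swept part the slope is that of the graph, hence bounded;
    the bound passes to limit points, whose tangent planes are therefore not
    vertical. *)
Lemma swept_limit_regular (y : pt S) :
  (forall O, is_open O -> O y -> exists x, O x /\ swept x) -> regular y.
Proof.
  intros Hlim. destruct (chart_at HS y) as [j [u [v [Hj E]]]]. rewrite <- E.
  assert (HD := dom_open HS j). destruct (loc_smooth HI j) as [Sx [Sy Sz]].
  apply regular_of_jacobian; auto. intros J0.
  set (n1 := jacobian (loc_y j) (loc_z j)). set (n2 := jacobian (loc_z j) (loc_x j)).
  set (n3 := jacobian (loc_x j) (loc_y j)).
  assert (T1 := smooth_on_jacobian _ _ _ HD Sy Sz). assert (T2 := smooth_on_jacobian _ _ _ HD Sz Sx).
  assert (T3 := smooth_on_jacobian _ _ _ HD Sx Sy). fold n1 in T1. fold n2 in T2. fold n3 in T3.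
  set (g := fun u v => B * n3 u v * (B * n3 u v) - (n1 u v * n1 u v + n2 u v * n2 u v)).
  assert (Tg : smooth_on (fun u v => dom j (u, v)) g).
  { intros n. apply Ck_minus; [easy| |].
    - apply Ck_mul; apply Ck_mul; auto; apply Ck_const.
    - apply Ck_add; apply Ck_mul; auto. }
  assert (Hneg : g u v < 0).
  { unfold g. change (n3 u v = 0) in J0. rewrite J0.
    assert (h1 := pow2_ge_0 (n1 u v)). assert (h2 := pow2_ge_0 (n2 u v)).
    destruct (Req_dec (n1 u v) 0) as [z1|z1].
    - destruct (Req_dec (n2 u v) 0) as [z2|z2].
      + exfalso. now apply (immersion_minors HI j u v).
      + assert (0 < n2 u v * n2 u v) by now apply Rsqr_pos_lt. lra.
    - assert (0 < n1 u v * n1 u v) by now apply Rsqr_pos_lt. lra. }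
  assert (Hloc : locally_2d (fun x y => dom j (x, y) /\ g x y < 0) u v).
  { apply locally_2d_and; [now apply HD|].
    assert (Cg := smooth_continuity _ _ Tg u v Hj).
    destruct (Cg (mkposreal (- g u v) ltac:(lra))) as [d Hd]. exists d.
    intros x' y' k1 k2. specialize (Hd x' y' k1 k2). simpl in Hd.
    apply Rabs_def2 in Hd. lra. }
  apply locally_2d_box in Hloc. destruct Hloc as [d [Hd Hloc]].
  destruct (Hlim (fun x => exists a b, box u v d a b /\ par j (a, b) = x)) as [x [[a [b [Hab Ex]]] Sw]].
  { apply (chart_image_open HS); [apply box_open|]. intros; now apply Hloc. }
  { exists u, v. split; [now apply box_center|easy]. }
  destruct (Hloc a b Hab) as [Hja Hga].
  assert (Hgr : locally_2d (fun u v => loc_z j u v = radial phi (loc_x j u v) (loc_y j u v)) a b).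
  { assert (Hso := swept_open j). apply open_open2 in Hso.
    destruct (Hso a b) as [d' Hd']; [split; [easy|now rewrite Ex]|].
    exists d'. intros a' b' k1 k2. destruct (Hd' a' b' k1 k2) as [_ k3].
    apply swept_graph in k3. unfold loc_z, loc_x, loc_y, local_imm.
    rewrite k3 at 1. easy. }
  destruct (graph_minors HI j everywhere (radial phi) a b Hja everywhere_open
    (radial_smooth _ c phi psi Hc HE) I Hgr) as [M1 [M2 _]].
  change (n1 a b = - D1 (radial phi) (loc_x j a b) (loc_y j a b) * n3 a b) in M1.
  change (n2 a b = - D2 (radial phi) (loc_x j a b) (loc_y j a b) * n3 a b) in M2.
  rewrite (radial_D1 _ c phi psi Hc HE) in M1. rewrite (radial_D2 _ c phi psi Hc HE) in M2.
  set (s := loc_x j a b) in *. set (t := loc_y j a b) in *.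
  unfold g in Hga. rewrite M1, M2 in Hga.
  destruct (HB (s ^ 2 + t ^ 2)) as [_ Hp].
  { assert (h1 := pow2_ge_0 s). assert (h2 := pow2_ge_0 t). lra. }
  set (q := psi (s ^ 2 + t ^ 2)) in *. assert (h3 := pow2_ge_0 (n3 a b)).
  assert (h4 : 4 * (s ^ 2 + t ^ 2) * q ^ 2 * n3 a b ^ 2 <= B ^ 2 * n3 a b ^ 2)
    by now apply Rmult_le_compat_r.
  lra.
Qed.

(** The extension step: a limit point of the swept part on the half-line has a
    local section, which continues a good curve by uniqueness of the profile;
    the Hausdorff axiom excludes that it branches off. *)
Lemma swept_closed_ray (y : pt S) : yc (imm y) = 0 -> 0 <= xc (imm y) ->
  (forall O, is_open O -> O y -> exists x, O x /\ swept x) -> swept y.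
Proof.
  intros Hy Hx Hlim. destruct (swept_limit_regular y Hlim) as [e [tau [h HL]]].
  assert (HL' := HL). destruct HL' as [He [Hcen [Himm [Sh [_ [_ Hop]]]]]].
  set (R0 := xc (imm y)) in *. rewrite Hy in Hcen, Himm, Sh, Hop.
  set (eta := if Rlt_dec 0 R0 then Rmin e R0 else e).
  assert (Heta : 0 < eta <= e /\ (0 < R0 -> eta <= R0)).
  { unfold eta. destruct Rlt_dec.
    - rmin e R0.
      split; [split; [now apply Rmin_pos|easy]|easy].
    - split; [lra|easy]. }
  destruct (section_polar_near y e tau h eta HL Hy Hx ltac:(lra)) as [d [Hd [Hde Hpol]]].
  fold R0 in Hpol.
  destruct (Hlim (fun x => exists u v, box R0 0 d u v /\ tau u v = x))
    as [x [[u [v [Huv Ex]]] [gam [l [r [s [Hg [Hr Es]]]]]]]].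
  { apply Hop; [apply box_open|]. intros; now apply (box_le R0 0 d). }
  { exists R0, 0. split; [now apply box_center|easy]. }
  destruct (Hpol u v Huv) as [Hrho [t Et]].
  assert (Hg' := Hg). destruct Hg' as [_ [Eg0 Hg']].
  (* the good curve passes through the section at radius [r] *)
  assert (Eiu : (u, v, h u v) = rot s (r, 0, Z r)).
  { rewrite <- (Himm u v) by now apply (box_le R0 0 d). rewrite Ex, Es, AR.
    now rewrite (proj1 (Hg' r Hr)). }
  unfold rot, xc, yc, zc in Eiu. simpl in Eiu. injection Eiu as U1 U2 _.
  assert (Er : sqrt (u ^ 2 + v ^ 2) = r).
  { rewrite U1, U2. assert (T := sin2_cos2 s). unfold Rsqr in T.
    replace ((cos s * r - sin s * 0) ^ 2 + (sin s * r + cos s * 0) ^ 2) with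
      ((sin s * sin s + cos s * cos s) * r ^ 2) by ring.
    rewrite T, Rmult_1_l. apply sqrt_pow2. lra. }
  rewrite Er in Hrho, Et.
  assert (Hbox : forall r', Rabs (r' - R0) < e -> box R0 0 e r' 0).
  { intros r' Hr'. split; [easy|]. now rewrite Rminus_diag, Rabs_R0. }
  assert (Egr : gam r = tau r 0).
  { assert (E : act (- t + s) (gam r) = tau r 0).
    { rewrite AD, <- Es, <- Ex, <- Et. apply (act_neg act A0 AD). }
    destruct (Req_dec r 0) as [r0|r0].
    - rewrite r0 in *. rewrite Eg0 in *. rewrite <- E.
      symmetry. now apply (axis_fixed HS HI act A0 AD AC AR).
    - rewrite act_full_turn in E; [easy|].
      assert (Ei : imm (tau r 0) = rot (- t + s) (r, 0, Z r)).
      { rewrite <- E, AR. now rewrite (proj1 (Hg' r Hr)). }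
      rewrite Himm in Ei by (apply Hbox; lra).
      unfold rot, xc, yc, zc in Ei. simpl in Ei. injection Ei as Ei _ _.
      apply (Rmult_eq_reg_r r); [lra|easy]. }
  destruct (Rle_lt_dec R0 r) as [Hle|Hlt].
  - (* the curve has already passed [y] *)
    assert (Ey : gam R0 = tau R0 0).
    { assert (HP : forall a, R0 <= a <= r -> (gam a = tau a 0 <-> gam R0 = tau R0 0));
        [|apply (HP r); [lra|easy]].
      apply (interval_locally_constant (fun s => gam s = tau s 0)).
      intros a Ha.
      assert (Hae : Rabs (a - R0) < e).
      { apply Rabs_def2 in Hrho. apply Rabs_def1; lra. }
      destruct (classic (gam a = tau a 0)) as [E|Hn].
      - destruct (good_near_section gam l y e tau h a Hg HL Hy ltac:(lra) Hae E)
          as [d1 [Hd1 H1]].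
        exists d1. split; [easy|]. intros b Hb Hba. rewrite H1 by lra. tauto.
      - destruct (curves_separate gam (fun s => tau s 0) (fun s => R0 <= s <= r) a)
          as [d1 [Hd1 H1]]; [|easy|].
        + intros g [-> | ->] O HO Os.
          * destruct (Hg' a ltac:(lra)) as [_ [_ H]]. destruct (H O HO Os) as [d1 [Hd1 H']].
            exists d1. split; [easy|]. intros; apply H'; [lra|easy].
          * destruct (section_curve_continuous y e tau h a O HL) as [d1 [Hd1 H']];
              [rewrite Hy; now apply Hbox|easy|easy|].
            exists d1. split; [easy|]. auto.
        + exists d1. split; [easy|]. intros b Hb Hba. split; [|easy].
          intros E. now elim (H1 b Hb Hba). }
    exists gam, l, R0, 0. split; [easy|]. split; [lra|].
    now rewrite A0, Ey, Hcen.
  - (* the curve is continued through [y] *)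
    assert (Hr0 : 0 < r) by (apply Rabs_def2 in Hrho; lra).
    assert (Hre : Rabs (r - R0) < e) by lra.
    destruct (good_near_section gam l y e tau h r Hg HL Hy Hr Hre Egr) as [d1 [Hd1 H1]].
    assert (Hin : forall a, r <= a < R0 + e -> Rabs (a - R0) < e).
    { intros a Ha. apply Rabs_def2 in Hre. apply Rabs_def1; lra. }
    assert (Hhr : forall r', 0 <= r' < l -> Rabs (r' - r) < d1 -> Rabs (r' - R0) < e ->
      h r' 0 = Z r').
    { intros r' k1 k2 k3. assert (Ei := proj1 (Hg' r' k1)).
      rewrite H1, Himm in Ei by (easy || now apply Hbox). now injection Ei. }
    assert (Hslope : D1 h r 0 = P r).
    { apply is_derive_unique, is_derive_ext_loc with Z;
        [|apply (entire_derive_z _ c phi psi Hc HE)].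
      set (d2 := Rmin (Rmin d1 (e - Rabs (r - R0))) (Rmin r (l - r))).
      assert (Hd2 : 0 < d2) by (repeat apply Rmin_pos; lra).
      assert (m1 := Rmin_l (Rmin d1 (e - Rabs (r - R0))) (Rmin r (l - r))).
      assert (m2 := Rmin_r (Rmin d1 (e - Rabs (r - R0))) (Rmin r (l - r))).
      rmin d1 (e - Rabs (r - R0)).
      rmin r (l - r).
      fold d2 in m1, m2.
      assert (Hnear : forall r' : R, Rabs (r' - r) < d2 -> Z r' = h r' 0).
      { intros r' Hr'. assert (k := Rabs_def2 _ _ Hr'). symmetry. apply Hhr; [lra|lra|].
        assert (k' := Rabs_triang (r' - r) (r - R0)).
        replace (r' - r + (r - R0)) with (r' - R0) in k' by ring. lra. }
      exists (mkposreal d2 Hd2). exact Hnear. }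
    assert (Hprof : forall a, r <= a < R0 + e -> h a 0 = Z a).
    { intros a Ha. apply (section_profile_unique y e tau h r a HL Hy); [lra| | |easy].
      - intros b Hb. apply Hin. lra.
      - apply Hhr; [easy|rewrite Rminus_diag, Rabs_R0; easy|easy]. }
    set (g2 := fun a => if Rle_dec a r then gam a else tau a 0).
    exists g2, (R0 + e), R0, 0. split; [|split; [lra|]].
    + split; [lra|]. split.
      { unfold g2. destruct Rle_dec; [easy|lra]. }
      intros a Ha. unfold g2 at 1 2 3. destruct (Rle_dec a r) as [Har|Har].
      * destruct (Hg' a ltac:(lra)) as [k1 [k2 k3]]. split; [easy|]. split; [easy|].
        intros O HO Os. destruct (k3 O HO Os) as [d2 [Hd2 K2]].
        destruct (Req_dec a r) as [->|Hne].
        -- destruct (section_curve_continuous y e tau h r O HL) as [d3 [Hd3 K3]];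
             [rewrite Hy; now apply Hbox|easy|now rewrite <- Egr|].
           exists (Rmin d2 d3). split; [now apply Rmin_pos|]. intros b Hb Hba.
           rmin d2 d3.
           unfold g2. destruct Rle_dec; [apply K2; lra|apply K3; lra].
        -- exists (Rmin d2 (r - a)). split; [apply Rmin_pos; lra|]. intros b Hb Hba.
           rmin d2 (r - a).
           assert (k := Rabs_def2 (b - a) (Rmin d2 (r - a)) Hba).
           unfold g2. destruct Rle_dec; [apply K2; lra|lra].
      * assert (Hae : Rabs (a - R0) < e) by (apply Hin; lra).
        split; [|split].
        -- rewrite Himm, Hprof by (lra || now apply Hbox). easy.
        -- destruct (local_section_restrict y e tau h a 0 HL) as [e' H'];
             [rewrite Hy; now apply Hbox|]. now exists e', tau, h.
        -- intros O HO Os. destruct (section_curve_continuous y e tau h a O HL) as [d3 [Hd3 K3]];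
             [rewrite Hy; now apply Hbox|easy|easy|].
           exists (Rmin d3 (a - r)). split; [apply Rmin_pos; lra|]. intros b Hb Hba.
           rmin d3 (a - r).
           assert (k := Rabs_def2 (b - a) (Rmin d3 (a - r)) Hba).
           unfold g2. destruct Rle_dec; [lra|apply K3; lra].
    + rewrite A0. unfold g2. destruct Rle_dec; [lra|]. now symmetry.
Qed.

(** Rotation reduces the statement to limit points over the half-line. *)
Lemma swept_closed : is_open (fun x => ~ swept x).
Proof.
  apply is_open_of_neighbourhoods. intros y Hy. apply NNPP. intros Hn.
  assert (Hlim : forall O, is_open O -> O y -> exists x, O x /\ swept x).
  { intros O HO Oy. apply NNPP. intros Hne. apply Hn. exists O.
    split; [easy|]. split; [easy|]. intros x Ox Sx. apply Hne. now exists x. }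
  apply Hy. destruct (polar_coordinates (xc (imm y)) (yc (imm y))) as [t [T1 T2]].
  set (r := sqrt (xc (imm y) ^ 2 + yc (imm y) ^ 2)) in *.
  assert (Ey : y = act t (act (- t) y)).
  { rewrite <- AD. replace (t + - t) with 0 by ring. now rewrite A0. }
  rewrite Ey. apply swept_act.
  assert (Ei : imm (act (- t) y) = (r, 0, zc (imm y))).
  { rewrite AR. unfold rot. rewrite cos_neg, sin_neg, T1, T2.
    assert (T := sin2_cos2 t). unfold Rsqr in T. f_equal. f_equal; [|ring].
    replace (cos t * (cos t * r) - - sin t * (sin t * r)) with
      ((sin t * sin t + cos t * cos t) * r) by ring.
    rewrite T. ring. }
  apply swept_closed_ray.
  - now rewrite Ei.
  - rewrite Ei. apply sqrt_pos.
  - intros O HO Oy.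
    destruct (Hlim (fun x => O (act (- t) x)) (act_open HS act AS (- t) O HO) Oy) as [x [Ox Sx]].
    exists (act (- t) x). split; [easy|]. now apply swept_act.
Qed.

Hypothesis (Hconn : connected S).

Lemma all_swept x : swept x.
Proof.
  destruct Hconn as [_ H]. apply (H swept swept_open swept_closed).
  destruct good_exists as [gam [l Hg]]. exists x0, gam, l, 0, 0.
  split; [easy|]. destruct Hg as [Hl [E _]]. split; [lra|]. now rewrite A0.
Qed.

(** Two points over the same point of the plane are obtained from good curves at
    the same radius, which agree, by rotations through the same angle up to
    full turns; over the axis the angle is irrelevant. *)
Lemma projection_injective (x y : pt S) :
  xc (imm x) = xc (imm y) -> yc (imm x) = yc (imm y) -> x = y.
Proof.
  intros E1 E2.
  destruct (all_swept x) as [g1 [l1 [r1 [t1 [G1 [H1 ->]]]]]].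
  destruct (all_swept y) as [g2 [l2 [r2 [t2 [G2 [H2 ->]]]]]].
  assert (K1 := G1). assert (K2 := G2).
  destruct K1 as [_ [O1 K1]]. destruct K2 as [_ [O2 K2]].
  rewrite !AR, (proj1 (K1 r1 H1)), (proj1 (K2 r2 H2)) in E1, E2.
  unfold rot, xc, yc, zc in E1, E2. simpl in E1, E2.
  assert (T1 := sin2_cos2 t1). assert (T2 := sin2_cos2 t2). unfold Rsqr in T1, T2.
  assert (Er : r1 = r2).
  { apply Rsqr_inj; [lra|lra|]. unfold Rsqr.
    transitivity ((cos t1 * r1 - sin t1 * 0) ^ 2 + (sin t1 * r1 + cos t1 * 0) ^ 2).
    - transitivity ((sin t1 * sin t1 + cos t1 * cos t1) * (r1 * r1)); [rewrite T1|]; ring.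
    - rewrite E1, E2.
      transitivity ((sin t2 * sin t2 + cos t2 * cos t2) * (r2 * r2)); [|rewrite T2]; ring. }
  subst r2. rewrite (good_unique g1 l1 g2 l2 r1 G1 G2 H1 (proj2 H2)).
  destruct (Req_dec r1 0) as [->|Hr].
  - rewrite O2. now rewrite !(axis_fixed HS HI act A0 AD AC AR).
  - replace t1 with (t2 + (t1 - t2)) by ring. rewrite AD. f_equal.
    apply act_full_turn. rewrite cos_minus.
    assert (C1 : cos t1 = cos t2) by (apply (Rmult_eq_reg_r r1); [lra|easy]).
    assert (C2 : sin t1 = sin t2) by (apply (Rmult_eq_reg_r r1); [lra|easy]).
    rewrite C1, C2. lra.
Qed.

Lemma projection_jacobian (j : idx S) u v :
  dom j (u, v) -> jacobian (loc_x j) (loc_y j) u v <> 0.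
Proof.
  intros Hj. apply (graph_minors HI j everywhere (radial phi) u v Hj everywhere_open
    (radial_smooth _ c phi psi Hc HE) I).
  apply locally_2d_forall. intros a b. unfold loc_z, loc_x, loc_y, local_imm.
  now rewrite (swept_graph _ (all_swept (par j (a, b)))) at 1.
Qed.

(** The horizontal projection, injective and compatible with the immersions,
    embeds the surface into the rotated profile, which is itself a connected
    rotational horo-shrinker.  By maximality the embedding is onto, and its
    inverse is smooth by the inverse function theorem. *)
Lemma same_surface_rotate :
  (forall (T : immersed_surface) (f : pt S -> pt T),
    connected_rotational_horo_shrinker T ->
    smooth_map f -> (forall x y, f x = f y -> x = y) ->
    (forall x, imm (f x) = imm x) ->
    forall y : pt T, exists x : pt S, f x = y) ->
  same_surface S (rotate (fun r => phi (r ^ 2))).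
Proof.
  intros Hmax. set (w := fun r => phi (r ^ 2)).
  assert (Hw : forall r, 0 <= r -> w r = phi (r ^ 2)) by easy.
  set (f := fun x : pt S => (xc (imm x), yc (imm x)) : pt (rotate w)).
  assert (Hf : smooth_map f).
  { intros i j [u v] p Hi _ _. exists (fun q => (xc (local_imm i q), yc (local_imm i q))).
    destruct HS as [Hop _]. generalize (Hop i (u, v) Hi). apply filter_imp.
    intros q Hq. destruct HI as [_ HI']. destruct (HI' i q Hq) as [Qx [Qy _]].
    now split. }
  assert (Hinj : forall x y, f x = f y -> x = y).
  { intros x y E. injection E as E1 E2. now apply projection_injective. }
  assert (Himm : forall x, imm (f x) = imm x).
  { intros x. rewrite (swept_graph x (all_swept x)).
    change (imm (f x)) with ((xc (imm x), yc (imm x), height w (xc (imm x)) (yc (imm x))) : R3).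
    now rewrite (height_radial phi w Hw). }
  assert (Hsurj := Hmax (rotate w) f
    (rotate_connected_rotational _ c phi psi w Hc HE Hw) Hf Hinj Himm).
  set (h := fun y => proj1_sig (constructive_indefinite_description _ (Hsurj y))).
  assert (Hfh : forall y, f (h y) = y).
  { intros y. unfold h. now destruct constructive_indefinite_description. }
  exists f, h. split; [easy|]. split; [|split; [|split; [easy|easy]]].
  2:{ intros x. apply Hinj. now rewrite Hfh. }
  intros i j [u v] [a b] _ Hj E.
  assert (HD := dom_open HS j). destruct (loc_smooth HI j) as [Sx [Sy _]].
  destruct (inverse_function _ (loc_x j) (loc_y j) a b HD Sx Sy Hj (projection_jacobian j a b Hj))
    as [d [e [G1 [G2 [Hd [He [HdD [_ [_ [HG [SG1 SG2]]]]]]]]]]].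
  assert (Ec : (loc_x j a b, loc_y j a b) = (u, v)).
  { change (par i (u, v)) with ((u, v) : pt (rotate w)) in E.
    rewrite <- (Hfh (u, v)), E. easy. }
  injection Ec as E1 E2. rewrite E1, E2 in *.
  exists (fun q => (G1 (fst q) (snd q), G2 (fst q) (snd q))).
  apply locally_pair_box. exists e. split; [easy|]. intros x y Hxy.
  destruct (HG x y Hxy) as [k1 [k2 k3]].
  split; [|split; [|split]].
  - apply (smooth_on_smooth_at (box u v e) G1); [apply box_open|easy|easy].
  - apply (smooth_on_smooth_at (box u v e) G2); [apply box_open|easy|easy].
  - now apply HdD.
  - apply Hinj. rewrite Hfh. simpl. unfold f.
    change (xc (imm (par j (G1 x y, G2 x y)))) with (loc_x j (G1 x y) (G2 x y)).
    change (yc (imm (par j (G1 x y, G2 x y)))) with (loc_y j (G1 x y) (G2 x y)).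
    now rewrite k2, k3.
Qed.

Lemma axis_height (x : pt S) : on_axis (imm x) -> imm x = (0, 0, zc (imm x0)).
Proof.
  intros [E1 E2]. rewrite (swept_graph x (all_swept x)), E1, E2.
  f_equal. unfold radial. replace (0 ^ 2 + 0 ^ 2) with 0 by ring. apply HE.
Qed.

End Classify.

(** * The theorem *)

Theorem theorem4p3 :
  (* the profile z of B(z0) exists and is unique *)
  (forall z0 : R, 0 < z0 ->
     exists (b : Rbar) (z : R -> R), maximal_profile z0 b z) /\
  (forall (z0 : R) (b c : Rbar) (z w : R -> R), 0 < z0 ->
     maximal_profile z0 b z -> maximal_profile z0 c w ->
     b = c /\ agree_on b z w) /\
  (* it is entire, so that B(z0) is the surface rotate z *)
  (forall (z0 : R) (b : Rbar) (z : R -> R), 0 < z0 -> maximal_profile z0 b z ->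
     b = p_infty /\
     oscillates_around_H1 z0 z /\
     (* B(z0) is one of the surfaces to be classified, and meets the axis
        exactly at height z0 *)
     spherical_rotational_horo_shrinker (rotate z) /\
     (exists x : pt (rotate z), imm x = (0, 0, z0)) /\
     (forall x : pt (rotate z), on_axis (imm x) -> imm x = (0, 0, z0)) /\
     (z0 = 1 ->
        forall P : R3, (exists x : pt (rotate z), imm x = P) <-> horosphere 1 P) /\
     (0 < z0 < 1 -> strictly_convex_at_0 b z) /\
     (1 < z0 -> strictly_concave_at_0 b z)) /\
  (* there are no other ones *)
  (forall S : immersed_surface,
     spherical_rotational_horo_shrinker S ->
     (exists x : pt S, on_axis (imm x)) ->
     exists (z0 : R) (z : R -> R),
       0 < z0 /\ maximal_profile z0 p_infty z /\ same_surface S (rotate z) /\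
       forall x : pt S, on_axis (imm x) -> imm x = (0, 0, z0)).
Proof.
  split; [|split; [|split]].
  - intros z0 Hz0. destruct (entire_solution_exists z0 Hz0) as [c [phi [psi [B [Hc [HE _]]]]]].
    exists p_infty, (fun r => phi (r ^ 2)). now apply (entire_maximal z0 c phi psi).
  - intros z0 b c' z w Hz0 Mz Mw.
    destruct (entire_solution_exists z0 Hz0) as [c [phi [psi [B [Hc [HE _]]]]]].
    destruct (maximal_profile_entire z0 c phi psi Hc HE b z Mz) as [-> Ez].
    destruct (maximal_profile_entire z0 c phi psi Hc HE c' w Mw) as [-> Ew].
    split; [easy|]. intros r Hr _. now rewrite Ez, Ew.
  - intros z0 b z Hz0 Mz.
    destruct (entire_solution_exists z0 Hz0) as [c [phi [psi [B [Hc [HE HB]]]]]].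
    destruct (maximal_profile_entire z0 c phi psi Hc HE b z Mz) as [-> Ez].
    assert (Hz : spherical_rotational_horo_shrinker (rotate z)).
    { split; [now apply (rotate_connected_rotational z0 c phi psi)|].
      intros T f HT Hf _ Himm. now apply (rotate_maximal z T f HT Hf Himm). }
    assert (Hh0 : height z 0 0 = z0).
    { rewrite (height_radial phi z Ez). unfold radial.
      replace (0 ^ 2 + 0 ^ 2) with 0 by ring. apply HE. }
    split; [easy|]. split; [now apply (profile_oscillates z0 c B phi psi)|].
    split; [easy|]. split; [|split; [|split; [|split]]].
    + exists (0, 0). change (@imm (rotate z) (0, 0)) with ((0, 0, height z 0 0) : R3).
      now rewrite Hh0.
    + intros [u v] [Hu Hv]. change (u = 0) in Hu. change (v = 0) in Hv. subst u v.
      change (@imm (rotate z) (0, 0)) with ((0, 0, height z 0 0) : R3). now rewrite Hh0.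
    + intros Hz1 [[u v] t]. unfold horosphere.
      assert (Hh : forall u v, height z u v = 1).
      { intros a b. apply (profile_constant z0 c phi psi z Hc HE Ez); [easy|apply sqrt_pos]. }
      split.
      * intros [[a b] E]. rewrite <- E. apply Hh.
      * intros E. change (t = 1) in E. exists (u, v).
        change (@imm (rotate z) (u, v)) with ((u, v, height z u v) : R3).
        now rewrite Hh, E.
    + now apply (profile_convex z0 c phi psi).
    + now apply (profile_concave z0 c phi psi).
  - intros S [[[HS [HI [HN HH]]] [Hconn [act [A0 [AD [AP [AS [AC AR]]]]]]]] Hmax] [x0 Hx0].
    assert (Hz0 : 0 < zc (imm x0)) by apply HI.
    destruct (entire_solution_exists _ Hz0) as [c [phi [psi [B [Hc [HE HB]]]]]].
    exists (zc (imm x0)), (fun r => phi (r ^ 2)). split; [easy|].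
    split; [now apply (entire_maximal _ c phi psi)|]. split.
    + now apply (same_surface_rotate HS HI HN HH act A0 AD AP AS AC AR x0 Hx0 c B phi psi).
    + now apply (axis_height HS HI HN HH act A0 AD AP AS AC AR x0 Hx0 c B phi psi).
Qed.
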